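(* Let $C_0\subset\mathbb{P}^2$ be a smooth plane curve of degree $d\ge 2$ and let $D_0\subset\mathbb{P}^2$ be a line transversal to $C_0$, meeting $C_0$ at the points $P_1,\dots,P_d$. Let $S$ be the complex surface obtained by gluing copies of small tubular neighborhoods of $C_0$ and $D_0$ only along the component of their intersection containing $P_1$, as described in the context. Then $S$ is not algebraizable.
   Context: A smooth holomorphic surface $S$ is called algebraizable if there exists a holomorphic embedding of $S$ into a smooth projective surface; otherwise it is called non-algebraizable. Construction of $S$: choose small tubular neighborhoods $V_0$ of $C_0$ and $W_0$ of $D_0$ in $\mathbb{P}^2$ such that $V_0\cap W_0$ splits into $d$ connected components $U_1,\dots,U_d$ with $P_j\in U_j$. Take (disjoint) copies $(V,C)$ and $(W,D)$ of $(V_0,C_0)$ and $(W_0,D_0)$. Let $V_j\subset V$ and $W_j\subset W$ be the respective copies of $U_j$, and let $\Psi_j:V_j\to W_j$ be the biholomorphism given by their identifications with $U_j$. The surface $S$ is obtained by gluing $V$ with $W$ through the single map $\Psi_1:V_1\to W_1$ (so no identification is made over $U_j$ for $j\ge 2$). *)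

(* Defs.v *)
From HB Require Import structures.
From mathcomp Require Import -(notations) mpoly.
From mathcomp Require Import all_boot all_order all_algebra.
From mathcomp Require Import generic_quotient complex.
From mathcomp Require Import all_classical all_reals topology normedtype derive.

Set Implicit Arguments.
Unset Strict Implicit.
Unset Printing Implicit Defensive.

Import Order.TTheory GRing.Theory Num.Theory.
Import numFieldNormedType.Exports.

Local Open Scope classical_set_scope.
Local Open Scope ring_scope.
Local Open Scope complex_scope.
Local Open Scope quotient_scope.

Definition C (R : realType) : numClosedFieldType := R[i].

Record chart (T V : topologicalType) := Chart {
  chart_dom : set T;
  chart_map :> T -> V }.

(* The last clause says that [c] restricts to a homeomorphism from its domain
   onto an open subset of [V]. *)
Definition is_chart (T V : topologicalType) (c : chart T V) :=
  [/\ open (chart_dom c),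
      {in chart_dom c &, injective c} &
      forall A, A `<=` chart_dom c -> open A <-> open (c @` A)].

Definition holomorphic_on (R : realType) (V W : normedModType (C R))
    (A : set V) (f : V -> W) :=
  forall x, A x -> differentiable f x.

Record complex_manifold (R : realType) (n : nat) := ComplexManifold {
  carrier :> topologicalType;
  atlas : set (chart carrier 'rV[C R]_n);
  atlas_chart : forall c, atlas c -> is_chart c;
  atlas_cover : forall x, exists2 c, atlas c & chart_dom c x;
  atlas_compat : forall c c', atlas c -> atlas c' ->
    exists2 g : 'rV[C R]_n -> 'rV[C R]_n,
      holomorphic_on (c @` (chart_dom c `&` chart_dom c')) g &
      forall x, chart_dom c x -> chart_dom c' x -> g (c x) = c' x;
  manifold_hausdorff : hausdorff_space carrier;
  manifold_second_countable : @second_countable carrier }.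

Lemma second_countable_charts (T V : topologicalType) (I : countType)
    (c : I -> chart T V) :
  @second_countable V -> (forall i, is_chart (c i)) ->
  (forall x, exists i, chart_dom (c i) x) -> @second_countable T.
Proof.
move=> [B cB [oB bB]] hc cov.
exists [set chart_dom (c iA.1) `&` c iA.1 @^-1` iA.2 | iA in [set: I] `*` B].
  apply: (sub_countable (card_image_le _ _)).
  by apply: countableX => //; exact: countableP.
have op (i : I) (A : set V) : open A -> open (chart_dom (c i) `&` c i @^-1` A).
  move=> oA; have [od inj hom] := hc i.
  apply/hom; first by move=> x [].
  have -> : c i @` (chart_dom (c i) `&` c i @^-1` A) = (c i @` chart_dom (c i)) `&` A.
    apply/seteqP; split => [_ [x [dx Ax] <-]|_ [[x dx <-] Ax]].
      by split => //; exists x.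
    by exists x.
  apply: openI => //; exact/hom.
split; first by move=> _ [[i A] [_ /= BA] <-]; apply: op; exact: oB.
move=> x N /= nN.
have [i dx] := cov x; have [od inj hom] := hc i.
move: nN; rewrite nbhsE => -[O [oO Ox] ON].
have oc : open (c i @` (O `&` chart_dom (c i))).
  by apply/hom; [move=> ? []|exact: openI].
have : nbhs (c i x) (c i @` (O `&` chart_dom (c i))).
  by apply: open_nbhs_nbhs; split => //; exists x.
move=> /bB [A [BA Ax] sA].
exists (chart_dom (c i) `&` c i @^-1` A).
  by split => //; exists (i, A).
move=> y [dy /sA [z [Oz dz] zy]]; apply: ON.
by rewrite -(inj z y) ?inE.
Qed.

Lemma dense_rat_complex (R : realType) (z : C R) (e : R) : 0 < e ->
  exists q : rat * rat, `|z - (ratr q.1 +i* ratr q.2 : C R)| < (e%:C : C R).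
Proof.
move=> e0; case: z => a b.
have h (t : R) : exists q : rat, `|t - ratr q| < e / 2.
  have [|q] := @rat_in_itvoo R (t - e / 2) (t + e / 2).
    by rewrite ltrBlDr -addrA ltrDl addr_gt0 // divr_gt0.
  rewrite in_itv /= => /andP[h1 h2]; exists q.
  rewrite distrC ltr_norml; apply/andP; split.
    by rewrite ltrBrDl.
  by rewrite ltrBlDl.
have [q hq] := h a; have [q' hq'] := h b; exists (q, q').
have -> : ((a +i* b) - (ratr q +i* ratr q') : C R) =
   ((a - ratr q)%:C + 'i * (b - ratr q')%:C :> R[i]).
  by rewrite [LHS]complexE.
apply: le_lt_trans (ler_normD _ _) _.
rewrite normrM.
have -> : `|'i%C : R[i]| = 1.
  by rewrite normc_def /= expr0n /= add0r expr1n sqrtr1.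
rewrite mul1r !normc_def /= expr0n /= !addr0 !sqrtr_sqr -rmorphD /= ltcR.
by rewrite [e]splitr ltrD.
Qed.

Lemma second_countable_rV (R : realType) (n : nat) :
  @second_countable 'rV[C R]_n.
Proof.
pose ctr (q : 'rV[rat]_n * 'rV[rat]_n) : 'rV[C R]_n :=
  \row_j (ratr (q.1 0 j) +i* ratr (q.2 0 j)).
pose D : set (('rV[rat]_n * 'rV[rat]_n) * rat) := [set q | 0 < q.2].
exists [set ball (ctr q.1) ((ratr q.2 : R)%:C : C R) | q in D].
  by apply: (sub_countable (card_image_le _ _)); exact: countableP.
split; first by move=> _ [q q0 <-]; apply: ball_open; rewrite ltcR ltr0q.
move=> x N /= nN; have {nN}[e /= e0 eN] := (nbhs_ballP x N).1 nN.
have er : e = (complex.Re e)%:C.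
  by move: e0; case: (e) => a b; rewrite ltcE /= => /andP[/eqP -> _].
have Re0 : 0 < complex.Re e by move: e0; rewrite {1}er ltcR.
have [r] := @rat_in_itvoo R 0 (complex.Re e / 2) (divr_gt0 Re0 (ltr0n _ 2)).
rewrite in_itv /= => /andP[r0 r2].
have rC : (ratr r + ratr r : R)%:C < e.
  by rewrite er ltcR [ltRHS]splitr ltrD.
have /choice [f hf] : forall j, exists q : rat * rat,
    `|x 0 j - (ratr q.1 +i* ratr q.2 : C R)| < ((ratr r : R)%:C : C R).
  by move=> j; exact: dense_rat_complex.
pose q := (\row_j (f j).1, \row_j (f j).2).
have xq : ball (ctr q) ((ratr r : R)%:C : C R) x.
  split; first by rewrite ltcR.
  by move=> i j; rewrite ord1 !mxE /ball /= distrC.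
exists (ball (ctr q) ((ratr r : R)%:C : C R)).
  by split => //; exists (q, r) => //=; rewrite /D /= -(ltr0q R).
move=> y qy; apply: eN.
have := ball_triangle (ball_sym xq) qy.
by apply: le_ball; rewrite -rmorphD; apply: ltW.
Qed.

Lemma open_neq0C (R : realType) : open [set x : C R | x != 0].
Proof.
rewrite openE => x /= x0; apply/nbhs_ballP; exists `|x|; first by rewrite /= normr_gt0.
by move=> y /=; rewrite /ball /=; apply: contraTneq => ->; rewrite subr0 ltxx.
Qed.

Section ProjectiveSpace.
Variables (R : realType) (n : nat).

Record proj_point := ProjPoint {
  line :> {vspace 'rV[C R]_n.+1};
  line_dim : \dim line == 1%N }.

HB.instance Definition _ := [isSub for line].
HB.instance Definition _ := [Choice of proj_point by <:].

Implicit Types (l : proj_point) (v w : 'rV[C R]_n.+1) (A B : set proj_point).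

Definition cone A : set 'rV[C R]_n.+1 :=
  [set v | v != 0 /\ exists2 l, A l & v \in line l].

Lemma lineE l v : v != 0 -> v \in line l -> line l = <[v]>%VS.
Proof.
move=> v0 vl; apply/eqP; rewrite eq_sym eqEdim dim_vline v0.
by rewrite (eqP (line_dim l)) -memvE vl.
Qed.

Lemma line_inj_in l l' v : v != 0 -> v \in line l -> v \in line l' -> l = l'.
Proof. by move=> v0 h h'; apply: val_inj; rewrite /= (lineE v0 h) (lineE v0 h'). Qed.

Lemma line_scale l v w : v != 0 -> v \in line l -> w != 0 -> w \in line l ->
  exists2 a : C R, a != 0 & w = a *: v.
Proof.
move=> v0 vl w0 wl; move: (wl); rewrite (lineE v0 vl) => /vlineP[a wE].
by exists a => //; apply: contraNneq w0 => a0; rewrite wE a0 scale0r.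
Qed.

Lemma vpick_line l : (vpick (line l) != 0) /\ vpick (line l) \in line l.
Proof.
split; last exact: memv_pick.
rewrite vpick0; apply/eqP => l0; have := line_dim l.
by rewrite l0 dimv0.
Qed.

Definition pt v (v0 : v != 0) : proj_point.
Proof. by exists <[v]>%VS; rewrite dim_vline v0. Defined.

Lemma pt_mem v (v0 : v != 0) : v \in line (pt v0).
Proof. exact: memv_line. Qed.

Definition proj_op A := open (cone A).

Lemma proj_neq0_open : open [set v : 'rV[C R]_n.+1 | v != 0].
Proof.
have -> : [set v : 'rV[C R]_n.+1 | v != 0] = \bigcup_(i : 'I_n.+1) [set v : 'rV[C R]_n.+1 | v 0 i != 0].
  apply/seteqP; split => v /=.
    move=> v0; have [//|h] := pselect ((\bigcup_i [set v | v 0 i != 0]) v).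
    case/eqP: v0; apply/rowP => j; rewrite mxE; apply/eqP.
    by apply/negPn/negP => vj; apply: h; exists j.
  by move=> [i _] /=; apply: contra => /eqP ->; rewrite mxE.
apply: bigcup_open => i _.
apply: (@open_comp _ _ (fun v => v 0 i) [set x : C R | x != 0]).
  by move=> v _; exact: coord_continuous.
exact: open_neq0C.
Qed.

Lemma proj_coneT : cone setT = [set v | v != 0].
Proof.
apply/seteqP; split => v; first by case.
by move=> v0; split => //; exists (pt v0) => //; exact: pt_mem.
Qed.

Lemma proj_opT : proj_op setT.
Proof. by rewrite /proj_op proj_coneT; exact: proj_neq0_open. Qed.

Lemma proj_opI : setI_closed proj_op.
Proof.
move=> A B oA oB; rewrite /proj_op.
suff -> : cone (A `&` B) = cone A `&` cone B by exact: openI.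
apply/seteqP; split => [v [v0 [l [Al Bl] vl]]|v [[v0 [l Al vl]] [_ [l' Bl' vl']]]].
  by split; split => //; exists l.
split => //; exists l => //; split => //.
by rewrite (line_inj_in v0 vl vl').
Qed.

Lemma proj_op_bigU (I : Type) (f : I -> set proj_point) :
  (forall i, proj_op (f i)) -> proj_op (\bigcup_i f i).
Proof.
move=> of_; rewrite /proj_op.
suff -> : cone (\bigcup_i f i) = \bigcup_i cone (f i) by apply: bigcup_open => i _; exact: of_.
apply/seteqP; split => [v [v0 [l [i _ fl] vl]]|v [i _ [v0 [l fl vl]]]].
  by exists i => //; split => //; exists l.
by split => //; exists l => //; exists i.
Qed.

(* The quotient topology of C^(n+1) minus 0: a set of lines is open iff the
   punctured cone over it is. *)
HB.instance Definition _ :=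
  isOpenTopological.Build proj_point proj_opT proj_opI proj_op_bigU.

Lemma proj_openE A : open A = open (cone A).
Proof. by []. Qed.

(* Inhomogeneous coordinates with respect to the [i]-th homogeneous one. *)
Definition inhom (i : 'I_n.+1) v : 'rV[C R]_n := (v 0 i)^-1 *: col' i v.

Definition affine_chart (i : 'I_n.+1) : chart proj_point 'rV[C R]_n :=
  Chart [set l : proj_point | exists2 v, v \in line l & v 0 i != 0]
        (fun l : proj_point => inhom i (vpick (line l))).

Definition homog_coord (i : 'I_n.+1) (z : 'rV[C R]_n) : 'rV[C R]_n.+1 :=
  \row_j oapp (z 0) 1 (unlift i j).

Lemma hom_i i z : homog_coord i z 0 i = 1.
Proof. by rewrite mxE unlift_none. Qed.

Lemma row_neq0 v i : v 0 i != 0 -> v != 0.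
Proof. by apply: contra => /eqP ->; rewrite mxE. Qed.

Lemma inhom_hom i z : inhom i (homog_coord i z) = z.
Proof. by apply/rowP => j; rewrite mxE hom_i invr1 mul1r !mxE liftK. Qed.

Lemma hom_inhom i v : v 0 i != 0 -> homog_coord i (inhom i v) = (v 0 i)^-1 *: v.
Proof.
move=> vi; apply/rowP => j; rewrite !mxE.
case: unliftP => [k ->|->] /=; first by rewrite !mxE.
by rewrite mulVf.
Qed.

Lemma inhomZ i a v : a != 0 -> inhom i (a *: v) = inhom i v.
Proof.
move=> a0; apply/rowP => j; rewrite !mxE invfM mulrACA mulVf ?mul1r //.
Qed.

Lemma proj_chartE i l v : v != 0 -> v \in line l -> affine_chart i l = inhom i v.
Proof.
move=> v0 vl; have [w0 wl] := vpick_line l.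
by have [a a0 /= ->] := line_scale v0 vl w0 wl; rewrite inhomZ.
Qed.

Lemma proj_domE i l v : v != 0 -> v \in line l ->
  chart_dom (affine_chart i) l <-> v 0 i != 0.
Proof.
move=> v0 vl; split => [[w wl wi]|vi]; last by exists v.
have [a a0 vE] := line_scale (row_neq0 wi) wl v0 vl.
by rewrite vE mxE mulf_neq0.
Qed.

Lemma inhom_diff i v : v 0 i != 0 -> differentiable (inhom i) v.
Proof.
move=> vi.
have -> : inhom i = \sum_(j < n)
    (fun v : 'rV[C R]_n.+1 => ((v 0 i)^-1 * v 0 (lift i j)) *: delta_mx 0 j).
  apply/funext => w; rewrite fct_sumE [LHS]row_sum_delta.
  by apply: eq_bigr => j _; rewrite !mxE.
apply: differentiable_sum => j; apply: differentiableZl.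
apply: (@differentiableM _ _ (fun v : 'rV[C R]_n.+1 => (v 0 i)^-1)
   (fun v : 'rV[C R]_n.+1 => v 0 (lift i j))).
  by apply: differentiableV => //; exact: differentiable_coord.
exact: differentiable_coord.
Qed.

Lemma hom_diff i z : differentiable (homog_coord i) z.
Proof.
have -> : homog_coord i = \sum_(j < n.+1)
    (fun z : 'rV[C R]_n => oapp (z 0) 1 (unlift i j) *: delta_mx 0 j).
  apply/funext => w; rewrite fct_sumE [LHS]row_sum_delta.
  by apply: eq_bigr => j _; rewrite !mxE.
apply: differentiable_sum => j; apply: differentiableZl.
case: unlift => [k|] /=; last exact: differentiable_cst.
exact: differentiable_coord.
Qed.

Lemma affine_is_chart i : is_chart (affine_chart i).
Proof.
have odom : open [set v : 'rV[C R]_n.+1 | v 0 i != 0].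
  apply: (@open_comp _ _ (fun v : 'rV[C R]_n.+1 => v 0 i) [set x : C R | x != 0]).
    by move=> v _; exact: coord_continuous.
  exact: open_neq0C.
split.
- rewrite proj_openE; congr (open _): odom; apply/seteqP; split => v /=.
    move=> vi; have v0 := row_neq0 vi.
    by split => //; exists (pt v0); [exists v => //|]; exact: pt_mem.
  by move=> [v0 [l dl vl]]; apply/(proj_domE i v0 vl).
- move=> l l'; rewrite !inE => -[v vl vi] [w wl' wi].
  rewrite (proj_chartE i (row_neq0 vi) vl) (proj_chartE i (row_neq0 wi) wl') => e.
  have := hom_inhom vi; rewrite e (hom_inhom wi) => e'.
  have ev : (v 0 i)^-1 *: v != 0 by rewrite scaler_eq0 invr_eq0 negb_or vi (row_neq0 vi).
  apply: (line_inj_in ev); first by rewrite memvZ.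
  by rewrite -e' memvZ.
- move=> A sA.
  have imE z : (affine_chart i @` A) z <-> cone A (homog_coord i z).
    have z0 : homog_coord i z != 0 by apply: (@row_neq0 _ i); rewrite hom_i oner_eq0.
    split => [[l Al <-]|[_ [l Al zl]]].
      have [v vl vi] := sA _ Al; rewrite (proj_chartE i (row_neq0 vi) vl) hom_inhom //.
      split; first by rewrite scaler_eq0 invr_eq0 negb_or vi (row_neq0 vi).
      by exists l => //; rewrite memvZ.
    by exists l => //; rewrite (proj_chartE i z0 zl) inhom_hom.
  split => [oA|oA].
    have -> : affine_chart i @` A = homog_coord i @^-1` cone A.
      by apply/seteqP; split => z /imE.
    apply: open_comp => // z _; apply: differentiable_continuous; exact: hom_diff.
  rewrite proj_openE.
  have -> : cone A = [set v : 'rV[C R]_n.+1 | v 0 i != 0] `&` inhom i @^-1` (affine_chart i @` A).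
    apply/seteqP; split => v.
      move=> [v0 [l Al vl]]; have vi : v 0 i != 0.
        by apply/(proj_domE i v0 vl); exact: sA.
      by split => //; exists l => //; rewrite (proj_chartE i v0 vl).
    move=> [vi [l Al e]]; have {}vi : v 0 i != 0 := vi; have [w wl wi] := sA _ Al.
    split; first exact: row_neq0 vi.
    exists l => //; move: e; rewrite (proj_chartE i (row_neq0 wi) wl) => e.
    have := hom_inhom vi; rewrite -e (hom_inhom wi) => e'.
    have -> : v = v 0 i *: ((v 0 i)^-1 *: v) by rewrite scalerA divff // scale1r.
    by rewrite -e' !memvZ.
  rewrite openE => v [/= vi Av]; apply: filterI; first exact: open_nbhs_nbhs.
  apply: (differentiable_continuous (inhom_diff vi)).
  exact: open_nbhs_nbhs.
Qed.

Lemma proj_cover l : exists i, chart_dom (affine_chart i) l.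
Proof.
have [v0 vl] := vpick_line l.
have [i vi] : exists i, vpick (line l) 0 i != 0.
  apply: contrapT => h; case/eqP: v0; apply/rowP => j; rewrite mxE.
  by apply/eqP/negPn/negP => vj; apply: h; exists j.
by exists i; exists (vpick (line l)).
Qed.

Definition proj_atlas : set (chart proj_point 'rV[C R]_n) := range affine_chart.

Lemma proj_atlas_chart c : proj_atlas c -> is_chart c.
Proof. by move=> [i _ <-]; exact: affine_is_chart. Qed.

Lemma proj_atlas_cover l : exists2 c, proj_atlas c & chart_dom c l.
Proof. by have [i il] := proj_cover l; exists (affine_chart i) => //; exists i. Qed.

Lemma proj_compat c c' : proj_atlas c -> proj_atlas c' ->
  exists2 g : 'rV[C R]_n -> 'rV[C R]_n,
    holomorphic_on (c @` (chart_dom c `&` chart_dom c')) g &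
    forall x, chart_dom c x -> chart_dom c' x -> g (c x) = c' x.
Proof.
move=> [i _ <-] [k _ <-]; exists (inhom k \o homog_coord i).
  move=> _ [l [[v vl vi] dk] <-].
  have v0 := row_neq0 vi; have vk := (proj_domE k v0 vl).1 dk.
  rewrite (proj_chartE i v0 vl).
  apply: differentiable_comp; first exact: hom_diff.
  by apply: inhom_diff; rewrite hom_inhom // mxE mulf_neq0 // invr_eq0.
move=> l [v vl vi] dk; have v0 := row_neq0 vi.
rewrite (proj_chartE i v0 vl) (proj_chartE k v0 vl) /= hom_inhom //.
by rewrite inhomZ // invr_eq0.
Qed.

Lemma proj_hausdorff : hausdorff_space proj_point.
Proof.
rewrite open_hausdorff => l l' ll'.
have [v0 vl] := vpick_line l; have [w0 wl'] := vpick_line l'.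
set v := vpick _ in v0 vl; set w := vpick _ in w0 wl'.
pose m (x y : 'rV[C R]_n.+1) i j := x 0 i * y 0 j - x 0 j * y 0 i.
have [i [j mij]] : exists i j, m v w i j != 0.
  apply: contrapT => h; case/eqP: ll'.
  have [i vi] : exists i, v 0 i != 0.
    apply: contrapT => h'; case/eqP: v0; apply/rowP => j; rewrite mxE.
    by apply/eqP/negPn/negP => vj; apply: h'; exists j.
  have mE j : v 0 i * w 0 j = v 0 j * w 0 i.
    apply/eqP; rewrite -subr_eq0; apply/negPn/negP => mij.
    by apply: h; exists i, j.
  have e : v 0 i *: w = w 0 i *: v.
    by apply/rowP => j; rewrite !mxE mE mulrC.
  apply: (line_inj_in w0) => //.
  have -> : w = ((v 0 i)^-1 * w 0 i) *: v.
    by rewrite -scalerA -e scalerA mulVf // scale1r.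
  by rewrite memvZ.
have mc : {for (v, w), continuous (fun xy : 'rV[C R]_n.+1 * 'rV[C R]_n.+1 => m xy.1 xy.2 i j)}.
  have c1 k : {for (v, w), continuous (fun xy : 'rV[C R]_n.+1 * 'rV[C R]_n.+1 => xy.1 0 k)}.
    apply: (@continuous_comp _ _ _ fst (fun x : 'rV[C R]_n.+1 => x 0 k)).
      exact: cvg_fst.
    exact: coord_continuous.
  have c2 k : {for (v, w), continuous (fun xy : 'rV[C R]_n.+1 * 'rV[C R]_n.+1 => xy.2 0 k)}.
    apply: (@continuous_comp _ _ _ snd (fun x : 'rV[C R]_n.+1 => x 0 k)).
      exact: cvg_snd.
    exact: coord_continuous.
  by apply: cvgB; apply: cvgM; (exact: c1 || exact: c2).
have : nbhs (m v w i j) [set x : C R | x != 0].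
  by apply: open_nbhs_nbhs; split => //; exact: open_neq0C.
move=> /mc [[A B] /= [nA nB] sAB].
have sat (A' : set 'rV[C R]_n.+1) (x : 'rV[C R]_n.+1) (lx : proj_point) :
    nbhs x A' -> x != 0 -> x \in line lx ->
  exists2 O : set proj_point, open O /\ O lx &
    forall l0, O l0 -> exists y, [/\ A' y, y != 0 & y \in line l0].
  rewrite nbhsE => -[A2 [oA2 A2x] sA2] x0 xl.
  exists [set l0 : proj_point | exists y, [/\ A2 y, y != 0 & y \in line l0]].
    split; last by exists x.
    rewrite proj_openE.
    have -> : cone [set l0 : proj_point | exists y, [/\ A2 y, y != 0 & y \in line l0]]
        = \bigcup_(a in [set a : C R | a != 0])
           (fun y : 'rV[C R]_n.+1 => a *: y) @^-1` (A2 `&` [set v | v != 0]).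
      apply/seteqP; split => y.
        move=> [y0 [l0 [z [A2z z0 zl]] yl]].
        have [a a0 zE] := line_scale y0 yl z0 zl.
        by exists a => //=; rewrite -zE.
      move=> [a /= a0 [A2y /= y0]].
      have y0' : y != 0 by apply: contra y0 => /eqP ->; rewrite scaler0.
      split => //; exists (pt y0'); last exact: pt_mem.
      by exists (a *: y); split => //; rewrite memvZ // pt_mem.
    apply: bigcup_open => a _; apply: open_comp.
      by move=> y _; exact: scaler_continuous.
    exact: (openI oA2 (proj_neq0_open)).
  by move=> l0 [y [A2y y0 yl]]; exists y; split => //; exact: sA2.
have [O1 [oO1 O1l] h1] := sat _ _ _ nA v0 vl.
have [O2 [oO2 O2l] h2] := sat _ _ _ nB w0 wl'.
exists (O1, O2); first by rewrite !inE.
split => //; apply/eqP/seteqP; split => // l0 [/= /h1 [y [Ay y0 yl]] /h2 [z [Bz z0 zl]]].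
have := sAB (y, z) (conj Ay Bz); rewrite /m /=.
have [a a0 ->] := line_scale y0 yl z0 zl.
by rewrite !mxE mulrCA (mulrC (y 0 j)) -mulrA subrr eqxx.
Qed.

Lemma proj_second_countable : @second_countable proj_point.
Proof.
apply: (second_countable_charts (@second_countable_rV R n)).
  exact: affine_is_chart.
exact: proj_cover.
Qed.

Definition projective_space : complex_manifold R n :=
  ComplexManifold proj_atlas_chart proj_atlas_cover proj_compat
    proj_hausdorff proj_second_countable.

End ProjectiveSpace.

Definition clopen_part (T : topologicalType) (A U : set T) :=
  [/\ U `<=` A, open U & open (A `\` U)].

Section Gluing.
Variables (R : realType) (n : nat) (M : complex_manifold R n).
Variables V W U : set M.

Definition side (b : bool) : set M := if b then W else V.

(* The disjoint union of a copy of [V] (index [false]) and a copy of [W]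
   (index [true]). *)
Definition copies := {b : bool & set_type (side b)}.

Definition copy_point (p : copies) : M := set_val (projT2 p).

(* A point of the copy of [V] is identified with a point of the copy of [W] iff
   they come from the same point of [M] and this point lies in [U]. *)
Definition glue_rel (p q : copies) :=
  (copy_point p == copy_point q) &&
  ((projT1 p == projT1 q) || (copy_point p \in U)).

Lemma glue_rel_refl : reflexive glue_rel.
Proof. by move=> p; rewrite /glue_rel !eqxx. Qed.

Lemma glue_rel_sym : symmetric glue_rel.
Proof.
move=> p q; rewrite /glue_rel (eq_sym (copy_point q)) (eq_sym (projT1 q)).
by have [->|] := eqVneq (copy_point p) (copy_point q).
Qed.

Lemma glue_rel_trans : transitive glue_rel.
Proof.
move=> q p r /andP[/eqP pq h1] /andP[/eqP qr h2]; rewrite /glue_rel.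
rewrite pq qr eqxx /=; rewrite pq qr in h1; rewrite qr in h2.
case/orP: h1 => [/eqP ->|->]; first exact: h2.
by rewrite orbT.
Qed.

Definition glue_equiv := EquivRel _ glue_rel_refl glue_rel_sym glue_rel_trans.
Definition glued := {eq_quot glue_equiv}.

HB.instance Definition _ := Topological.copy glued (quotient_topology glued).
HB.instance Definition _ := Quotient.on glued.

Definition glue_proj (s : glued) : M := copy_point (repr s).

(* The points of [glued] coming from the points of [A] in the copy [b]. *)
Definition lift_side (b : bool) (A : set M) : set glued :=
  [set s | exists2 p : copies, projT1 p = b /\ A (copy_point p) & s = \pi p].

Definition glued_chart (T : topologicalType) (b : bool) (c : chart M T) :
    chart glued T :=
  Chart (lift_side b (chart_dom c)) (c \o glue_proj).

Definition glued_atlas : set (chart glued 'rV[C R]_n) :=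
  [set c' | exists b c, atlas c /\ c' = glued_chart b c].

Hypotheses (oV : open V) (oW : open W) (hU : clopen_part (V `&` W) U).

Lemma side_open b : open (side b).
Proof. by case: b. Qed.

Lemma dev_pi (p : copies) : glue_proj (\pi p) = copy_point p.
Proof.
rewrite /glue_proj; have : \pi_glued (repr (\pi_glued p)) = \pi_glued p by rewrite reprK.
move=> h; have /andP[/eqP e _] : glue_equiv (repr (\pi_glued p)) p by apply/eqmodP.
exact: e.
Qed.

Lemma pi_dev (s : glued) : exists p : copies, s = \pi p.
Proof. by exists (repr s); rewrite reprK. Qed.

Lemma copy_side (p : copies) : side (projT1 p) (copy_point p).
Proof. by case: p => b [x xb]; exact: set_mem xb. Qed.

Lemma dev_inj b : {in lift_side b setT &, injective glue_proj}.
Proof.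
move=> s t; rewrite !inE => -[p [pb _] ->] [q [qb _] ->]; rewrite !dev_pi => e.
by apply/eqmodP; rewrite /= /glue_rel e eqxx pb qb eqxx.
Qed.

Lemma lift_sideS b A B : A `<=` B -> lift_side b A `<=` lift_side b B.
Proof. by move=> AB s [p [pb Ap] ->]; exists p => //; split => //; exact: AB. Qed.

Lemma set_val_open b (A : set (set_type (side b))) :
  open A -> open ([set set_val x | x in A] : set M).
Proof.
move=> [B oB <-].
suff -> : [set set_val x | x in (set_val @^-1` B : set (set_type (side b)))]
    = (side b `&` B : set M) by exact: (openI (@side_open b) oB).
apply/seteqP; split => [_ [x Bx <-]|x [bx Bx]].
  by split => //; case: x {Bx} => x xb; exact: set_mem xb.
by exists (@exist _ _ x (mem_set bx)).
Qed.

Lemma lift_open b A : open A -> open (lift_side b A).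
Proof.
move=> oA; apply/sigT_openP => b'.
have [sU oU _] := hU.
pose O := if b' == b then A else A `&` U.
have oO : open O by rewrite /O; case: ifP => // _; exact: openI.
exists O => //; apply/seteqP; split => -[x xb] /=.
  rewrite /O /=; case: eqVneq => [bb' Ax|bb' [Ax Ux]].
    by exists (existT _ b' (exist _ x xb)).
  have xb2 : x \in side b by apply/mem_set; have [] := sU _ Ux; case: (b).
  exists (existT _ b (exist _ x xb2)) => //.
  by apply/eqmodP; rewrite /= /glue_rel /copy_point /= eqxx (mem_set Ux) orbT.
move=> [p [pb Ap] /eqmodP]; rewrite /= /glue_rel {1 3}/copy_point /= => /andP[/eqP xp].
rewrite /O pb -xp in Ap *.
case: eqVneq => //= _ /set_mem Ux; split => //.
Qed.

Lemma dev_open (A : set glued) : open A -> open (glue_proj @` A).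
Proof.
move=> /sigT_openP oA.
have -> : glue_proj @` A = \bigcup_b [set set_val x | x in
    (existT _ b @^-1` (\pi_glued @^-1` A) : set (set_type (side b)))].
  apply/seteqP; split => [_ [s As <-]|x [b _ [y Ay <-]]].
    move: As; have [[b y] ->] := pi_dev s => Ay.
    by rewrite dev_pi; exists b => //; exists y.
  by exists (\pi_glued (existT _ b y : copies)); rewrite ?dev_pi.
by apply: bigcup_open => b _; apply: set_val_open; exact: oA.
Qed.

Lemma dev_lift b A : glue_proj @` lift_side b A `<=` A.
Proof. by move=> _ [s [p [_ Ap] ->] <-]; rewrite dev_pi. Qed.

Lemma lift_sideT b A s : lift_side b A s -> lift_side b setT s.
Proof. by move=> [p [pb Ap] ->]; exists p. Qed.

Lemma lift_sub b A (B : set glued) : B `<=` lift_side b A ->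
  B = lift_side b (glue_proj @` B).
Proof.
move=> BA; apply/seteqP; split => s.
  move=> Bs; have [p [pb Ap] sE] := BA _ Bs; exists p => //; split => //.
  by exists s; rewrite ?sE ?dev_pi // -sE.
move=> [p [pb [t Bt tp]] ->]; suff -> : \pi p = t by [].
apply: (@dev_inj b); rewrite ?inE; first by exists p.
  exact: lift_sideT (BA _ Bt).
by rewrite dev_pi.
Qed.

Lemma glued_is_chart (T : topologicalType) b (c : chart M T) :
  is_chart c -> is_chart (glued_chart b c).
Proof.
move=> [oc ic hc]; split => /=; first exact: lift_open.
  move=> s t; rewrite !inE => hs ht /= e.
  apply: (@dev_inj b); rewrite ?inE; [exact: lift_sideT hs|exact: lift_sideT ht|].
  apply: ic => //; rewrite inE.
    by apply: (@dev_lift b); exists s.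
  by apply: (@dev_lift b); exists t.
move=> A sA; rewrite -image_comp -hc; last first.
  by move=> _ [s /sA hs <-]; apply: (@dev_lift b); exists s.
split; first exact: dev_open.
by move=> oA; rewrite (lift_sub sA); exact: lift_open.
Qed.

Lemma glued_atlas_chart c : glued_atlas c -> is_chart c.
Proof. by move=> [b [c' [ac ->]]]; apply: glued_is_chart; exact: atlas_chart ac. Qed.

Lemma glued_atlas_cover s : exists2 c, glued_atlas c & chart_dom c s.
Proof.
have [p ->] := pi_dev s; have [c ac cp] := atlas_cover (copy_point p).
by exists (glued_chart (projT1 p) c); [exists (projT1 p), c|exists p].
Qed.

Lemma glued_compat c c' : glued_atlas c -> glued_atlas c' ->
  exists2 g : 'rV[C R]_n -> 'rV[C R]_n,
    holomorphic_on (c @` (chart_dom c `&` chart_dom c')) g &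
    forall x, chart_dom c x -> chart_dom c' x -> g (c x) = c' x.
Proof.
move=> [b [c1 [ac1 ->]]] [b' [c2 [ac2 ->]]].
have [g hg gE] := atlas_compat ac1 ac2; exists g.
  move=> _ [s [/= h1 h2] <-]; apply: hg; exists (glue_proj s) => //.
  by split; [apply: (@dev_lift b)|apply: (@dev_lift b')]; exists s.
move=> s /= h1 h2.
by apply: gE; [apply: (@dev_lift b)|apply: (@dev_lift b')]; exists s.
Qed.

Lemma lift_disjoint A A' b b' s : A `&` A' = set0 ->
  lift_side b A s -> lift_side b' A' s -> False.
Proof.
move=> AA' h h'; suff : set0 (glue_proj s) by [].
rewrite -AA'; split; first by apply: (@dev_lift b); exists s.
by apply: (@dev_lift b'); exists s.
Qed.

Lemma glued_hausdorff : hausdorff_space glued.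
Proof.
rewrite open_hausdorff => s t st.
have [p sp] := pi_dev s; have [q tq] := pi_dev t.
have [pq|pq] := eqVneq (copy_point p) (copy_point q); last first.
  have := @manifold_hausdorff R n M; rewrite open_hausdorff => /(_ _ _ pq).
  move=> [[A B] /= [/set_mem Ap /set_mem Bq] [oA oB /eqP AB]].
  exists (lift_side (projT1 p) A, lift_side (projT1 q) B) => /=.
    by split; apply/mem_set; [exists p|exists q].
  split; [exact: lift_open|exact: lift_open|apply/eqP/seteqP; split => //].
  by move=> r [h1 h2]; exact: (lift_disjoint AB h1 h2).
have npq : ~ (projT1 p = projT1 q \/ U (copy_point p)).
  move=> h; case/eqP: st; rewrite sp tq; apply/eqmodP.
  rewrite /= /glue_rel pq eqxx /=.
  by case: h => [->|h]; [rewrite eqxx|rewrite -pq (mem_set h) orbT].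
have [_ _ oU'] := hU.
have Op : ((V `&` W) `\` U) (copy_point p).
  split; last by move=> h; apply: npq; right.
  have := copy_side p; have := copy_side q; rewrite -pq.
  have : projT1 p <> projT1 q by move=> e; apply: npq; left.
  by rewrite /side; case: (projT1 p); case: (projT1 q).
exists (lift_side (projT1 p) ((V `&` W) `\` U),
        lift_side (projT1 q) ((V `&` W) `\` U)) => /=.
  by split; apply/mem_set; [exists p|exists q; rewrite -?pq].
split; [exact: lift_open|exact: lift_open|apply/eqP/seteqP; split => //].
move=> r [[p' [pp' [_ nU]] ->] [q' [qq' _] /eqmodP]].
rewrite /= /glue_rel => /andP[/eqP e /orP[/eqP e'|/set_mem //]].
by apply: npq; left; rewrite -pp' -qq'.
Qed.

Lemma glued_second_countable : @second_countable glued.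
Proof.
pose idc := Chart [set: M] (@id M).
apply: (second_countable_charts (@manifold_second_countable R n M)
  (c := fun b : bool => glued_chart b idc)).
  move=> b; apply: glued_is_chart; split => //=; first exact: openT.
  by move=> A _; rewrite image_id.
by move=> s; have [p ->] := pi_dev s; exists (projT1 p); exists p.
Qed.

Definition glue_along : complex_manifold R n :=
  ComplexManifold glued_atlas_chart glued_atlas_cover glued_compat
    glued_hausdorff glued_second_countable.

End Gluing.

Lemma connected_between (T : topologicalType) (B D : set T) :
  connected B -> B `<=` D -> D `<=` closure B -> connected D.
Proof.
move=> cB BD DB; apply/connectedP => E [E0 DE [s1 s2]].
have key b : ~ B `<=` E b.
  move=> /closureS BE; have [x xE] := E0 (~~ b).
  have : closure (E b) x by apply/BE/DB; rewrite DE; case: b xE {BE} => ? /=; [left|right].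
  by case: b xE {BE} => /= xE clx; [have : set0 x by rewrite -s2|have : set0 x by rewrite -s1].
have BE : B `<=` E false `|` E true by rewrite -DE.
by have [h|h] := connected_subset (conj s1 s2) BE cB; exact: key h.
Qed.

(* For [P j] in [A]: [A] has exactly [d] connected components, represented by
   the [P j]. *)
Definition component_points (T : topologicalType) (d : nat) (A : set T)
    (P : 'I_d -> T) :=
  A = \bigcup_j connected_component A (P j) /\
  trivIset setT (fun j => connected_component A (P j)).

Lemma component_clopen (T : topologicalType) (d : nat) (A : set T)
    (P : 'I_d -> T) (j : 'I_d) :
  open A -> component_points A P ->
  clopen_part A (connected_component A (P j)).
Proof.
move=> oA [AE triv]; set U := fun j => connected_component A (P j).
have UA k : U k `<=` A by exact: connected_component_sub.
have clU k : A `&` closure (U k) `<=` U k.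
  have [APk|nAPk] := pselect (A (P k)); last first.
    have -> : U k = set0.
      by apply/seteqP; split => // x [B [BP BA _] _]; apply: nAPk; exact: BA.
    by rewrite closure0 setI0.
  apply: connected_component_max; [|by move=> ? []|].
    split => //; apply: subset_closure; exact: connected_component_refl.
  apply: (@connected_between _ (U k)); first exact: component_connected.
    by move=> x Ux; split; [exact: (UA k x Ux)|exact: subset_closure].
  by move=> ? [].
have oK (K : set 'I_d) : open (A `\` \bigcup_(k in K) closure (U k)).
  apply: openI => //; rewrite openC; apply: closed_bigcup.
    exact: finite_finset.
  by move=> k _; exact: closed_closure.
split; first exact: (UA j).
- have -> : connected_component A (P j) = A `\` \bigcup_(k in [set~ j]) closure (U k).
    apply/seteqP; split => x.
      move=> Ux; split; first exact: (UA j).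
      move=> [k kj /(conj (UA j x Ux)) /clU Uk]; apply: kj.
      by apply: (triv k j) => //; exists x.
    move=> [Ax nx]; move: (Ax); rewrite {1}AE => -[k _ Uk].
    have [<-//|kj] := eqVneq k j.
    by case: nx; exists k; [exact/eqP|exact: subset_closure].
  exact: oK.
- have -> : A `\` connected_component A (P j) = A `\` \bigcup_(k in [set j]) closure (U k).
    rewrite bigcup_set1; apply/seteqP; split => x [Ax nx]; split => //.
      by move=> cl; apply: nx; apply: clU.
    by move=> Ux; apply: nx; exact: subset_closure.
  exact: oK.
Qed.

Section Maps.
Variables (R : realType) (m n : nat).
Variables (M : complex_manifold R m) (N : complex_manifold R n) (f : M -> N).

Definition local_expression (c : chart M 'rV[C R]_m) (c' : chart N 'rV[C R]_n)
    (g : 'rV[C R]_m -> 'rV[C R]_n) :=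
  forall x, chart_dom c x -> chart_dom c' (f x) -> g (c x) = c' (f x).

Definition holomorphic := continuous f /\
  forall c c', atlas c -> atlas c' ->
    exists2 g, local_expression c c' g &
      holomorphic_on (c @` (chart_dom c `&` f @^-1` chart_dom c')) g.

Definition immersion :=
  forall c c' g x, atlas c -> atlas c' -> chart_dom c x ->
    chart_dom c' (f x) -> local_expression c c' g -> injective ('d g (c x)).

Definition holomorphic_embedding :=
  [/\ holomorphic, immersion, injective f &
      forall A, open A -> exists2 B, open B & f @` A = B `&` range f].
End Maps.

Section RealSmoothness.
Variables (R : realType) (V W : normedModType (C R)).

Definition is_real_derive (f : V -> W) (x v : V) (l : W) :=
  (h^-1)%:C *: (f (x + h%:C *: v) - f x) @[h --> (0 : R)^'] --> l.

(* Real C^k maps on the open set [A]: all iterated directional derivatives of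
   order at most [k], along real lines, exist and are continuous. *)
Fixpoint Ck_on (k : nat) (A : set V) (f : V -> W) : Prop :=
  (forall x, A x -> {for x, continuous f}) /\
  if k is k'.+1 then
    forall v, exists2 f', (forall x, A x -> is_real_derive f x v (f' x)) &
      Ck_on k' A f'
  else True.

Definition smooth_on (A : set V) (f : V -> W) := forall k, Ck_on k A f.
End RealSmoothness.

Section Tubular.
Variables (R : realType) (M : complex_manifold R 2).

(* [theta] is a (real) C^infinity diffeomorphism of C^2 onto an open subset. *)
Definition smooth_open_embedding (theta : C R * C R -> M) :=
  [/\ continuous theta, open (range theta) &
      forall c, atlas c ->
        smooth_on (theta @^-1` chart_dom c) (c \o theta) /\
        exists2 g : 'rV[C R]_2 -> C R * C R,
          smooth_on (c @` (chart_dom c `&` range theta)) g &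
          forall p, chart_dom c (theta p) -> g (c (theta p)) = p].

Definition real_linear (L : C R -> C R) :=
  forall (a : R) (w w' : C R), L (a%:C * w + w') = a%:C * L w + L w'.

(* [V] is the diffeomorphic image of a real vector bundle of rank 2 over the
   curve [Y], with [Y] as zero section.  The bundle is given by its local
   trivialisations [theta (z, w)] over coordinate discs of [Y], which are
   identified with C: [z] is the coordinate on the base and [w] the one on the
   fibre. *)
Definition tubular_neighborhood (Y V : set M) :=
  [/\ open V, Y `<=` V &
      exists Th : set (C R * C R -> M),
        [/\ forall theta, Th theta -> smooth_open_embedding theta,
            V = \bigcup_(theta in Th) range theta,
            forall theta, Th theta -> forall z w, Y (theta (z, w)) <-> w = 0 &
            forall theta theta', Th theta -> Th theta' -> forall z z' w0 w0',
              theta (z, w0) = theta' (z', w0') ->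
              exists2 L, real_linear L &
                forall w, theta (z, w) = theta' (z', L w)]].

Lemma tubular_open (Y V : set M) : tubular_neighborhood Y V -> open V.
Proof. by case. Qed.
End Tubular.

Section Projective.
Variables (R : realType) (n : nat).
Local Notation P := (projective_space R n).
Implicit Types (F G : mpoly n.+1 (C R)) (X : set P) (v : 'rV[C R]_n.+1).

Definition evalp F v : C R := meval (v 0) F.

Definition gradient F v : 'rV[C R]_n.+1 := \row_i evalp (mderiv i F) v.

Definition zero_locus F : set P :=
  [set l : P | forall v, v \in line l -> evalp F v = 0].

Definition algebraic X := exists2 s : seq (mpoly n.+1 (C R)),
  forall F, F \in s -> F \is ishomog mdeg &
  X = [set l | forall F, F \in s -> zero_locus F l].

Definition irreducible X := X !=set0 /\
  forall F G, F \is ishomog mdeg -> G \is ishomog mdeg ->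
    X `<=` zero_locus F `|` zero_locus G ->
    X `<=` zero_locus F \/ X `<=` zero_locus G.

(* The projective variety [X] is smooth of dimension [k]: at each of its points,
   the common kernel in C^(n+1) of the differentials of all the homogeneous
   equations of [X] (the tangent space of the affine cone) has dimension
   [k.+1], i.e. the Jacobian matrix of the ideal of [X] has rank [n - k]. *)
Definition smooth_of_dim (k : nat) X :=
  forall v (l : P), X l -> v \in line l -> v != 0 ->
    exists2 T : {vspace 'rV[C R]_n.+1}, \dim T = k.+1 &
      forall u, u \in T <->
        forall F, F \is ishomog mdeg -> X `<=` zero_locus F ->
          \sum_i gradient F v 0 i * u 0 i = 0.

Definition smooth_projective_surface X :=
  [/\ algebraic X, irreducible X & smooth_of_dim 2 X].
End Projective.

(* A smooth projective surface [X] is a closed submanifold of the projective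
   space, so an embedding into [X] is an embedding into the projective space
   with image in [X]. *)
Definition algebraizable (R : realType) (S : complex_manifold R 2) :=
  exists (n : nat) (X : set (projective_space R n))
    (f : S -> projective_space R n),
    [/\ smooth_projective_surface X, holomorphic_embedding f & range f `<=` X].

Section PlaneCurves.
Variable R : realType.
Implicit Types F G : mpoly 3 (C R).

Definition smooth_plane_curve (d : nat) F := F \is ishomog1 d mdeg /\
  forall v : 'rV[C R]_3, v != 0 -> evalp F v = 0 -> gradient F v != 0.

Definition plane_line G := G \is ishomog1 1 mdeg /\ G != 0.

Definition transversal_curves F G :=
  forall v : 'rV[C R]_3, v != 0 -> evalp F v = 0 -> evalp G v = 0 ->
    row_free (col_mx (gradient F v) (gradient G v)).
End PlaneCurves.

(* Main.v *)
(** Let [f] embed [S] into a projective space.  On each line close to [D_0] the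
    restriction of [f] to [W] is holomorphic, hence rational, and a function which
    is rational on the lines of two pencils is rational; so [f] is given on [W],
    near [P_1], by quotients of homogeneous polynomials.  The identity theorem
    propagates these formulas along the whole of [D_0] and, since the two
    restrictions of [f] agree over [U_1], along a part [E] of [C_0] which is open
    and closed in [C_0] and contains [P_1].

    [E] contains a second point of [D_0].  Otherwise project [C_0] from a point of
    [D_0] outside of [C_0]: [D_0] would meet [E] once and transversally, so [E]
    would be a sheet of degree one, the graph of an entire function, along which
    the derivative of [F] in the direction of the projection never vanishes and
    grows like the power [d - 1 > 0]; its inverse would be entire and vanish at
    infinity.

    At such a point [P_j] with [j <> 1] the same rational map gives both
    restrictions of [f], which therefore agree there, although [P_j] has two
    different lifts to [S]: [f] is not injective. *)

Require Import Defs.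
From HB Require Import structures.
From mathcomp Require Import -(notations) mpoly.
From mathcomp Require Import all_boot all_order all_algebra.
From mathcomp Require Import generic_quotient complex ring lra zify.
From mathcomp Require Import all_classical all_reals topology normedtype sequences derive.

Set Implicit Arguments.
Unset Strict Implicit.
Unset Printing Implicit Defensive.

Import Order.TTheory GRing.Theory Num.Theory.
Import numFieldNormedType.Exports.

Local Open Scope classical_set_scope.
Local Open Scope ring_scope.
Local Open Scope complex_scope.
Local Open Scope quotient_scope.

(** The one-variable theory starts from complex differentiability alone. Bisection of squares serves
    for Goursat's lemma and, as [square_ind], for compactness and connectedness. Goursat gives a
    maximum principle with a wrong constant, which taking powers removes; division by [z - c] keeps
    holomorphy and plays the part of power series.

    The lines near [D_0] are taken from two pencils with centres on [D_0]. Nothing bounds the degree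
    of [f] on them in advance, so uniformity comes from Baire's theorem. The parameters of the
    pencils degenerate on [D_0] itself; the formulas are found beside [D_0] and then moved onto it.

    A formula is a homogeneous relation [q i * u i = p i * u i0] valid near a vector, so it
    continues through points where numerator and denominator both vanish.

    Of [E] only one more point of [D_0] is wanted. Having a single simple root is open and closed on
    the lines of the projection, so one such root at [P_1] spreads to all of them. At infinity the
    graph tends to [P_1], where transversality keeps the derivative of [F] away from zero;
    homogeneity then supplies the growth. *)

Section RealNorm.
Variable R : realType.
Implicit Types (V : normedModType (C R)) (a e d : R).

(** [normr] takes its values in [C R], which is only partially ordered; its real part lives in [R],
    where [lra] and [nra] apply. *)
Definition nrm V (v : V) : R := complex.Re `|v|.

Lemma nrmE V (v : V) : `|v| = (nrm v)%:C.
Proof.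
have := normr_ge0 v; rewrite /nrm; case: `|v| => a b.
by rewrite lecE /= => /andP[/eqP -> _].
Qed.

Lemma nrm_ge0 V (v : V) : 0 <= nrm v.
Proof. by have := normr_ge0 v; rewrite nrmE lecR. Qed.

Lemma nrmD V (v w : V) : nrm (v + w) <= nrm v + nrm w.
Proof. by have := ler_normD v w; rewrite !nrmE -rmorphD lecR. Qed.

Lemma nrmZ V (z : C R) (v : V) : nrm (z *: v) = nrm z * nrm v.
Proof. by apply: complexI; rewrite rmorphM /= -!nrmE normrZ. Qed.

Lemma nrmN V (v : V) : nrm (- v) = nrm v.
Proof. by rewrite /nrm normrN. Qed.

Lemma nrmB V (v w : V) : nrm (v - w) = nrm (w - v).
Proof. by rewrite -nrmN opprB. Qed.

Lemma nrm0 V : nrm (0 : V) = 0.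
Proof. by rewrite /nrm normr0. Qed.

Lemma nrm_eq0 V (v : V) : (nrm v == 0) = (v == 0).
Proof. by rewrite -[RHS]normr_eq0 nrmE (inj_eq (@complexI R) (nrm v) 0). Qed.

Lemma nrm_gt0 V (v : V) : (0 < nrm v) = (v != 0).
Proof. by rewrite lt_def nrm_ge0 nrm_eq0 andbT. Qed.

Lemma nrmM (z w : C R) : nrm (z * w) = nrm z * nrm w.
Proof. by apply: complexI; rewrite rmorphM /= -!nrmE normrM. Qed.

Lemma nrm1 : nrm (1 : C R) = 1.
Proof. by rewrite /nrm normr1. Qed.

Lemma nrmX (z : C R) n : nrm (z ^+ n) = nrm z ^+ n.
Proof. by apply: complexI; rewrite rmorphXn /= -!nrmE normrX. Qed.

Lemma nrmV (z : C R) : nrm z^-1 = (nrm z)^-1.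
Proof. by apply: complexI; rewrite fmorphV /= -!nrmE normfV. Qed.

Lemma nrmR a : nrm (a%:C : C R) = `|a|.
Proof. by rewrite /nrm normc_def /= expr0n addr0 sqrtr_sqr. Qed.

Lemma nrmi : nrm ('i : C R) = 1.
Proof. by rewrite /nrm normc_def /= expr0n add0r expr1n sqrtr1. Qed.

Lemma nrmBr V (v w : V) : nrm v - nrm w <= nrm (v - w).
Proof. by rewrite lerBlDr -{1}(subrK w v) nrmD. Qed.

Lemma Re_le (z : C R) : `|complex.Re z| <= nrm z.
Proof. by rewrite -lecR -nrmE; exact: normc_ge_Re. Qed.

Lemma Im_le (z : C R) : `|complex.Im z| <= nrm z.
Proof.
have -> : complex.Im z = - complex.Re (z * 'i) by rewrite ReiNIm opprK.
by rewrite normrN; apply: le_trans (Re_le _) _; rewrite nrmM nrmi mulr1.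
Qed.

Lemma nrm_ReIm (z : C R) : nrm z <= `|complex.Re z| + `|complex.Im z|.
Proof.
rewrite {1}[z]complexE; apply: le_trans (nrmD _ _) _.
by rewrite nrmM nrmi mul1r !nrmR.
Qed.

Lemma nrm_sum V (I : Type) (r : seq I) (f : I -> V) :
  nrm (\sum_(i <- r) f i) <= \sum_(i <- r) nrm (f i).
Proof.
elim/big_ind2: _ => [|a b c d h1 h2|//]; first by rewrite nrm0.
by apply: le_trans (nrmD _ _) _; apply: lerD.
Qed.

Lemma nrm_prod (I : Type) (r : seq I) (f : I -> C R) :
  nrm (\prod_(i <- r) f i) = \prod_(i <- r) nrm (f i).
Proof. by elim/big_rec2: _ => [|i a b _ <-]; rewrite ?nrm1 ?nrmM. Qed.

Lemma nbhs_nrm V (v : V) (A : set V) :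
  nbhs v A <-> exists2 d, 0 < d & forall w, nrm (w - v) < d -> A w.
Proof.
split=> [/nbhs_ballP[e /= e0 eA]|[d d0 dA]].
  have eE : e = (complex.Re e)%:C.
    by move: e0; case: (e) => a b; rewrite ltcE /= => /andP[/eqP -> _].
  exists (complex.Re e); first by move: e0; rewrite eE ltcR.
  move=> w wv; apply: eA; rewrite -ball_normE /= -opprB normrN nrmE eE ltcR //.
apply/nbhs_ballP; exists d%:C; rewrite /= ?ltcR // => w.
by rewrite -ball_normE /= -opprB normrN nrmE ltcR => /dA.
Qed.

Lemma continuous_eps (V W : normedModType (C R)) (f : V -> W) v :
  {for v, continuous f} <-> forall e, 0 < e ->
    exists2 d, 0 < d & forall w, nrm (w - v) < d -> nrm (f w - f v) < e.
Proof.
split=> [cf e e0|h A /nbhs_nrm[e /h[d d0 dA] eA]].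
  suff /nbhs_nrm : nbhs v (fun w => nrm (f w - f v) < e) by [].
  by apply: (cf (fun y => nrm (y - f v) < e)); apply/nbhs_nrm; exists e.
suff : nbhs v (fun w => A (f w)) by [].
by apply/nbhs_nrm; exists d => // w /dA /eA.
Qed.

(** The weak inequality, free of division, holds at [z = c] too, so no punctured neighbourhood has
    to be carried along. *)
Lemma differentiable_eps (h : C R -> C R) c : differentiable h c <->
  exists l, forall e, 0 < e -> exists2 d, 0 < d &
    forall z, nrm (z - c) < d -> nrm (h z - h c - l * (z - c)) <= e * nrm (z - c).
Proof.
split=> [dh|[l hl]].
  have /derivable1_diffP/cvg_ex[l hl] := dh; exists l => e e0.
  have : nbhs (l : C R) (fun y : C R => nrm (y - l) < e).
    by apply/(nbhs_nrm (l : C R)); exists e.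
  move=> /hl; rewrite /nbhs /= /dnbhs /within /= => /(nbhs_nrm (0 : C R))[d d0 hd].
  exists d => // z zd; have [->|zc] := eqVneq z c.
    by rewrite !subrr mulr0 subr0 nrm0 mulr0.
  have := hd (z - c); rewrite subr0 => /(_ zd).
  rewrite subr_eq0 => /(_ zc); rewrite /GRing.scale /= mulr1 subrK => hz.
  have zc0 : z - c != 0 by rewrite subr_eq0.
  have -> : h z - h c - l * (z - c) = (z - c) * ((z - c)^-1 * (h z - h c) - l).
    by rewrite [RHS]mulrBr mulVKf // (mulrC l).
  by rewrite nrmM mulrC ler_wpM2r ?nrm_ge0 // ltW.
apply/derivable1_diffP; apply/cvg_ex; exists l => A /(nbhs_nrm (l : C R))[e e0 eA].
have [d d0 hd] := hl _ (divr_gt0 e0 (@ltr0n R 2)).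
rewrite /nbhs /= /dnbhs /within /=; apply/(nbhs_nrm (0 : C R)); exists d => // k; rewrite subr0 => kd k0.
apply: eA; rewrite -[h _ - _](subrK (l * k)) /GRing.scale /= mulr1.
have := hd (k + c); rewrite addrK => /(_ kd); rewrite (mulrC l) => hk.
rewrite mulrDr mulKf // addrK nrmM nrmV.
have k0' : 0 < nrm k by rewrite nrm_gt0.
rewrite ltr_pdivrMl //; apply: le_lt_trans hk _; rewrite [ltRHS]mulrC.
by rewrite ltr_pM2r // ltr_pdivrMr // ltr_pMr // ltr1n.
Qed.

End RealNorm.

(** * Bisection of squares and Goursat's lemma for dyadic Riemann sums *)

Section Squares.
Variable R : realType.
Implicit Types (e d s : R).

Lemma ReD (x y : C R) : complex.Re (x + y) = complex.Re x + complex.Re y.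
Proof. by case: x; case: y. Qed.

Lemma ImD (x y : C R) : complex.Im (x + y) = complex.Im x + complex.Im y.
Proof. by case: x; case: y. Qed.

(** [c] is the lower left corner, not the centre, so the quarters have corners [c] plus entries [0]
    or [s / 2]. *)
Definition square (c : C R) s : set (C R) := [set z |
  (0 <= complex.Re z - complex.Re c <= s) /\ (0 <= complex.Im z - complex.Im c <= s)].

Lemma squareE c s (z : C R) : square c s z <->
  exists x y, [/\ z = c + (x +i* y), 0 <= x <= s & 0 <= y <= s].
Proof.
split=> [[h1 h2]|[x [y [-> hx hy]]]]; last first.
  by split; rewrite ?ReD ?ImD /= addrAC subrr add0r.
exists (complex.Re z - complex.Re c), (complex.Im z - complex.Im c); split => //.
by case: z c {h1 h2} => [a b] [a' b'] /=; apply/eqP; rewrite eq_complex /= !subrKC !eqxx.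
Qed.

Lemma square_nrm c s (z w : C R) : square c s z -> square c s w ->
  nrm (z - w) <= 2 * s.
Proof.
move=> [/andP[h1 h2] /andP[h3 h4]] [/andP[k1 k2] /andP[k3 k4]].
apply: le_trans (nrm_ReIm _) _.
have eR : complex.Re (z - w) = complex.Re z - complex.Re w by case: (z); case: (w).
have eI : complex.Im (z - w) = complex.Im z - complex.Im w by case: (z); case: (w).
rewrite eR eI (_ : 2 * s = s + s); last by ring.
by apply: lerD; rewrite ler_norml; apply/andP; split; lra.
Qed.

(** If [P] failed on the large square, it would fail on a quarter, and so on; the nested squares
    shrink to a point, against the local hypothesis there. The later compactness arguments are
    instances of it. *)
Lemma square_ind (P : C R -> R -> Prop) (c0 : C R) (s0 : R) : 0 < s0 ->
  (forall c s, 0 < s -> P c (s / 2) -> P (c + (s / 2 +i* 0)) (s / 2) ->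
     P (c + (0 +i* (s / 2))) (s / 2) -> P (c + (s / 2 +i* (s / 2))) (s / 2) ->
     P c s) ->
  (forall z, square c0 s0 z -> exists2 d, 0 < d & forall c s, 0 < s < d ->
     square c s z -> square c s `<=` square c0 s0 -> P c s) ->
  P c0 s0.
Proof.
move=> s00 Psplit Ploc; apply: contrapT => nP.
pose bad (x : C R * R) := 0 < x.2 /\ ~ P x.1 x.2.
have /choice[f hf] (x : C R * R) : exists y : C R * R, bad x ->
    [/\ bad y, y.2 = x.2 / 2 & square y.1 y.2 `<=` square x.1 x.2].
  have [[x0 nPx]|nb] := pselect (bad x); last by exists x.
  have x20 : 0 < x.2 / 2 by rewrite divr_gt0.
  suff [a [b [ha hb nPy]]] : exists a b, [/\ 0 <= a <= x.2 / 2, 0 <= b <= x.2 / 2 &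
      ~ P (x.1 + (a +i* b)) (x.2 / 2)].
    exists (x.1 + (a +i* b), x.2 / 2) => _; split => //= z [].
    rewrite /square /= !ReD !ImD /= => h1 h2; split; lra.
  apply: contrapT => h; apply: nPx; have hz : (0 : R) <= 0 <= x.2 / 2 by rewrite lexx ltW.
  have hh : 0 <= x.2 / 2 <= x.2 / 2 by rewrite lexx ltW.
  apply: Psplit => //; apply: contrapT => nPy; apply: h.
  - by exists 0, 0; split => //; rewrite (_ : (0 +i* 0) = 0 :> C R) // addr0.
  - by exists (x.2 / 2), 0.
  - by exists 0, (x.2 / 2).
  - by exists (x.2 / 2), (x.2 / 2).
pose u n := iter n f (c0, s0).
have ub n : bad (u n) by elim: n => //= n IH; have [] := hf _ IH.
have us n : (u n).2 = s0 / 2 ^+ n.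
  elim: n => [|n IH]; first by rewrite expr0 divr1.
  by have [_ -> _] := hf _ (ub n); rewrite IH exprSr invfM mulrA.
have usub m n : square (u (m + n)%N).1 (u (m + n)%N).2 `<=` square (u m).1 (u m).2.
  elim: n => [|n IH]; first by rewrite addn0.
  rewrite addnS; apply: subset_trans IH.
  by have [_ _] := hf _ (ub (m + n)%N).
have corner n : square (u n).1 (u n).2 (u n).1.
  by have [h _] := ub n; rewrite /square /= !subrr lexx ltW.
pose SR := range (fun n => complex.Re (u n).1).
pose SI := range (fun n => complex.Im (u n).1).
have key m n : square (u m).1 (u m).2 (u n).1 \/ square (u n).1 (u n).2 (u m).1.
  case/orP: (leq_total m n) => /subnKC <-; [left|right]; apply: usub; exact: corner.
have bR n : ubound SR (complex.Re (u n).1 + (u n).2).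
  move=> _ [m _ <-]; have [s1 _] := ub n.
  by have [[/andP[h1 h2] _]|[/andP[h1 h2] _]] := key n m; lra.
have bI n : ubound SI (complex.Im (u n).1 + (u n).2).
  move=> _ [m _ <-]; have [s1 _] := ub n.
  by have [[_ /andP[h1 h2]]|[_ /andP[h1 h2]]] := key n m; lra.
(* The common point of the nested squares: by [key], each upper right corner bounds all the lower
   left corners. *)
pose z : C R := sup SR +i* sup SI.
have hz n : square (u n).1 (u n).2 z.
  have hR : complex.Re (u n).1 <= sup SR.
    by apply: ub_le_sup; [exists (complex.Re (u 0).1 + (u 0).2); exact: bR|exists n].
  have hI : complex.Im (u n).1 <= sup SI.
    by apply: ub_le_sup; [exists (complex.Im (u 0).1 + (u 0).2); exact: bI|exists n].
  have hR' : sup SR <= complex.Re (u n).1 + (u n).2.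
    by apply: ge_sup; [exists (complex.Re (u 0).1); exists 0|exact: bR].
  have hI' : sup SI <= complex.Im (u n).1 + (u n).2.
    by apply: ge_sup; [exists (complex.Im (u 0).1); exists 0|exact: bI].
  by split; rewrite /=; lra.
have [d d0 hd] := Ploc z (hz 0).
(* [upper_nthrootP] gives [s0 / d < 2 ^+ n], so the square of level [n] has side below [d]. *)
pose n := Num.bound (s0 / d).
have [un0 nPn] := ub n; apply: nPn; apply: hd => //; last exact: (usub 0 n).
rewrite un0 us ltr_pdivrMr ?exprn_gt0 // mulrC -ltr_pdivrMr //.
by rewrite -[X in _ < X]/(2 ^+ n); exact: upper_nthrootP.
Qed.

(** The Riemann sum at left endpoints, with [2 ^ n] nodes, of the integral over the unit
    interval. *)
Definition dyadic_avg n (g : R -> C R) : C R :=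
  (2 ^+ n)^-1 * \sum_(k < 2 ^ n) g (k%:R / 2 ^+ n).

Lemma dyadic_avg_split n g : dyadic_avg n.+1 g =
  (dyadic_avg n (fun t => g (t / 2)) + dyadic_avg n (fun t => g ((1 + t) / 2))) / 2.
Proof.
rewrite /dyadic_avg expnS mul2n -addnn big_split_ord /=.
have -> : \sum_(k < 2 ^ n) g (k%:R / 2 ^+ n.+1) = \sum_(k < 2 ^ n) g (k%:R / 2 ^+ n / 2).
  by apply: eq_bigr => k _; rewrite exprSr invfM mulrA.
have -> : \sum_(k < 2 ^ n) g ((2 ^ n + k)%:R / 2 ^+ n.+1) =
    \sum_(k < 2 ^ n) g ((1 + k%:R / 2 ^+ n) / 2).
  apply: eq_bigr => k _; rewrite natrD natrX mulrDl exprSr invfM !mulrA.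
  by rewrite divff ?expf_neq0 ?pnatr_eq0 // -mulrDl.
by rewrite exprSr invfM; ring.
Qed.

Lemma dyadic_avgD n g h :
  dyadic_avg n (fun t => g t + h t) = dyadic_avg n g + dyadic_avg n h.
Proof. by rewrite /dyadic_avg big_split mulrDr. Qed.

Lemma dyadic_avgM n a g :
  dyadic_avg n (fun t => a * g t) = a * dyadic_avg n g.
Proof. by rewrite /dyadic_avg -mulr_sumr mulrCA. Qed.

Lemma dyadic_node n (k : 'I_(2 ^ n)) : 0 <= (k%:R / 2 ^+ n : R) <= 1.
Proof.
rewrite divr_ge0 ?exprn_ge0 //= ler_pdivrMr ?exprn_gt0 // mul1r -natrX ler_nat.
exact: ltnW.
Qed.

Lemma eq_dyadic_avg n g h : (forall t, 0 <= t <= 1 -> g t = h t) ->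
  dyadic_avg n g = dyadic_avg n h.
Proof.
move=> gh; congr (_ * _); apply: eq_bigr => k _; apply: gh; exact: dyadic_node.
Qed.

Lemma dyadic_avgC n a : dyadic_avg n (fun=> a) = a.
Proof.
rewrite /dyadic_avg sumr_const card_ord -[a *+ _]mulr_natl natrX mulrA mulVf ?mul1r //.
by rewrite expf_neq0 // pnatr_eq0.
Qed.

Lemma dyadic_avg_le n g M : (forall t, 0 <= t <= 1 -> nrm (g t) <= M) ->
  nrm (dyadic_avg n g) <= M.
Proof.
move=> hg; rewrite nrmM nrmV nrmX.
have -> : nrm (2 : C R) = 2.
  by rewrite (_ : (2 : C R) = (2 : R)%:C) ?nrmR ?ger0_norm // rmorph_nat.
rewrite ler_pdivrMl ?exprn_gt0 //.
apply: le_trans (nrm_sum _ _) _.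
apply: (@le_trans _ _ (\sum_(k < 2 ^ n) M)).
  by apply: ler_sum => k _; apply: hg; exact: dyadic_node.
by rewrite sumr_const card_ord -[M *+ _]mulr_natl natrX.
Qed.

Lemma dyadic_avg_real n (b : R -> R) (a : R) : (forall t, 0 <= t <= 1 -> a <= b t) ->
  exists2 x, a <= x & dyadic_avg n (fun t => (b t)%:C) = x%:C.
Proof.
move=> hb; exists ((2 ^+ n)^-1 * \sum_(k < 2 ^ n) b (k%:R / 2 ^+ n)).
  rewrite ler_pdivlMl ?exprn_gt0 //.
  apply: (@le_trans _ _ (\sum_(k < 2 ^ n) a)).
    by rewrite sumr_const card_ord -[a *+ _]mulr_natl natrX.
  by apply: ler_sum => k _; apply: hb; exact: dyadic_node.
by rewrite rmorphM rmorph_sum fmorphV rmorphXn /= rmorph_nat.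
Qed.

(* Dyadic Riemann sums of the integral along the boundary of a square; they are
   exactly additive when the square is bisected, which is all that Goursat's
   argument needs of the integral. *)
Definition boundary_sum n (q : C R -> C R) c s : C R :=
  s%:C * (dyadic_avg n (fun t => q (c + ((s * t) +i* 0)))
    - dyadic_avg n (fun t => q (c + ((s * t) +i* s)))
    + 'i * (dyadic_avg n (fun t => q (c + (s +i* (s * t))))
    - dyadic_avg n (fun t => q (c + (0 +i* (s * t)))))).

(** A side at level [n.+1] consists of two half sides at level [n] with the same nodes, and each
    inner edge occurs twice with opposite signs. *)
Lemma boundary_sum_split n q c s : boundary_sum n.+1 q c s =
  boundary_sum n q c (s / 2) + boundary_sum n q (c + (s / 2 +i* 0)) (s / 2) +
  boundary_sum n q (c + (0 +i* (s / 2))) (s / 2) +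
  boundary_sum n q (c + (s / 2 +i* (s / 2))) (s / 2).
Proof.
pose H x y := dyadic_avg n (fun t => q (c + ((x + s / 2 * t) +i* y))).
pose V x y := dyadic_avg n (fun t => q (c + (x +i* (y + s / 2 * t)))).
have bE x y : boundary_sum n q (c + (x +i* y)) (s / 2) =
   (s / 2)%:C * (H x y - H x (y + s / 2) + 'i * (V (x + s / 2) y - V x y)).
  congr (_ * (_ - _ + 'i * (_ - _))); apply: eq_dyadic_avg => t _;
  by rewrite -addrA; congr (q (_ + _)); rewrite /GRing.add /= ?addr0.
have -> : boundary_sum n q c (s / 2) = boundary_sum n q (c + (0 +i* 0)) (s / 2).
  by rewrite (_ : (0 +i* 0) = 0 :> C R) // addr0.
rewrite !bE !add0r /boundary_sum !dyadic_avg_split.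
have hs : s / 2 + s / 2 = s by field.
have eH y : dyadic_avg n (fun t => q (c + (s * (t / 2) +i* y))) = H 0 y.
  by apply: eq_dyadic_avg => t _; congr (q (_ + (_ +i* _))); field.
have eH' y : dyadic_avg n (fun t => q (c + (s * ((1 + t) / 2) +i* y))) = H (s / 2) y.
  by apply: eq_dyadic_avg => t _; congr (q (_ + (_ +i* _))); field.
have eV x : dyadic_avg n (fun t => q (c + (x +i* (s * (t / 2))))) = V x 0.
  by apply: eq_dyadic_avg => t _; congr (q (_ + (_ +i* _))); field.
have eV' x : dyadic_avg n (fun t => q (c + (x +i* (s * ((1 + t) / 2))))) = V x (s / 2).
  by apply: eq_dyadic_avg => t _; congr (q (_ + (_ +i* _))); field.
rewrite !eH !eH' !eV !eV' hs rmorphM fmorphV /= rmorph_nat.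
move: (H 0 0) (H (s / 2) 0) (H 0 s) (H (s/2) s) (V 0 0) (V 0 (s / 2)) (V s 0) (V s (s / 2))
 (H 0 (s/2)) (H (s/2) (s/2)) (V (s/2) 0) (V (s/2) (s/2)) => *.
by ring.
Qed.

Lemma boundary_sumD n q q' c s : boundary_sum n (fun z => q z + q' z) c s =
  boundary_sum n q c s + boundary_sum n q' c s.
Proof. rewrite /boundary_sum !dyadic_avgD; ring. Qed.

Lemma boundary_sumM n a q c s : boundary_sum n (fun z => a * q z) c s =
  a * boundary_sum n q c s.
Proof. rewrite /boundary_sum !dyadic_avgM; ring. Qed.

Lemma eq_boundary_sum n q q' c s : 0 <= s ->
  (forall x y, 0 <= x <= s -> 0 <= y <= s -> [|| x == 0, x == s, y == 0 | y == s] ->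
     q (c + (x +i* y)) = q' (c + (x +i* y))) ->
  boundary_sum n q c s = boundary_sum n q' c s.
Proof.
move=> s0 qq'; have st t : 0 <= t <= 1 -> 0 <= s * t <= s.
  by move=> /andP[t0 t1]; rewrite mulr_ge0 //= ler_piMr.
congr (_ * (_ - _ + 'i * (_ - _))); apply: eq_dyadic_avg => t /st ht;
by apply: qq'; rewrite ?eqxx ?orbT ?lexx ?s0.
Qed.

Lemma boundary_sum_le n q c s M : 0 <= s ->
  (forall x y, 0 <= x <= s -> 0 <= y <= s -> [|| x == 0, x == s, y == 0 | y == s] ->
     nrm (q (c + (x +i* y))) <= M) ->
  nrm (boundary_sum n q c s) <= 4 * s * M.
Proof.
move=> s0 qM; have st t : 0 <= t <= 1 -> 0 <= s * t <= s.
  by move=> /andP[t0 t1]; rewrite mulr_ge0 //= ler_piMr.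
have -> : 4 * s * M = s * ((M + M) + 1 * (M + M)) by ring.
rewrite nrmM nrmR ger0_norm //; apply: ler_wpM2l => //.
apply: le_trans (nrmD _ _) _; apply: lerD.
  apply: le_trans (nrmD _ _) _; rewrite nrmN; apply: lerD;
  by apply: dyadic_avg_le => t /st ht; apply: qM; rewrite ?eqxx ?orbT ?lexx ?s0.
rewrite nrmM nrmi; apply: ler_wpM2l => //.
apply: le_trans (nrmD _ _) _; rewrite nrmN; apply: lerD;
by apply: dyadic_avg_le => t /st ht; apply: qM; rewrite ?eqxx ?orbT ?lexx ?s0.
Qed.

(** Opposite sides use the same nodes, so their averages differ by constants, [- b * 'i * s] and
    [b * s]; the factor ['i] on the second makes them cancel at every level. *)
Lemma boundary_sum_affine n (a b : C R) c s :
  boundary_sum n (fun z => a + b * z) c s = 0.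
Proof.
have e (x y : R -> R) : dyadic_avg n (fun t => a + b * (c + (x t +i* y t))) =
   a + b * (c + (dyadic_avg n (fun t => (x t)%:C) + 'i * dyadic_avg n (fun t => (y t)%:C))).
  rewrite -dyadic_avgM -dyadic_avgD -[in RHS](dyadic_avgC n c) -dyadic_avgD.
  rewrite -dyadic_avgM -[in RHS](dyadic_avgC n a) -dyadic_avgD.
  apply: eq_dyadic_avg => t _; rewrite [x t +i* y t]complexE //=.
rewrite /boundary_sum !e !dyadic_avgC rmorph0.
ring.
Qed.

(** The integral is never formed: its vanishing is expressed by sums that are eventually small. *)
Lemma goursat q c0 s0 : 0 < s0 ->
  (forall z, square c0 s0 z -> differentiable q z) ->
  forall e, 0 < e -> exists n0, forall n, (n0 <= n)%N ->
    nrm (boundary_sum n q c0 s0) <= e.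
Proof.
move=> s00 dq e e0.
(* A bound proportional to the area is additive over the four quarters. *)
suff : exists n0, forall n, (n0 <= n)%N ->
    nrm (boundary_sum n q c0 s0) <= e / s0 ^+ 2 * s0 ^+ 2.
  by rewrite divfK // expf_neq0 // gt_eqF.
have : 0 < e / s0 ^+ 2 by rewrite divr_gt0 // exprn_gt0.
move: (e / _) => {e0}e e0.
apply: (@square_ind (fun c s => exists n0, forall n, (n0 <= n)%N ->
    nrm (boundary_sum n q c s) <= e * s ^+ 2)) => //.
  move=> c s s1 [n1 h1] [n2 h2] [n3 h3] [n4 h4].
  exists (maxn (maxn n1 n2) (maxn n3 n4)).+1 => -[//|n].
  rewrite ltnS !geq_max => /andP[/andP[k1 k2] /andP[k3 k4]].
  rewrite boundary_sum_split.
  have -> : e * s ^+ 2 = e * (s / 2) ^+ 2 + e * (s / 2) ^+ 2 + e * (s / 2) ^+ 2 + e * (s / 2) ^+ 2.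
    by field.
  apply: le_trans (nrmD _ _) _; apply: lerD; last exact: h4.
  apply: le_trans (nrmD _ _) _; apply: lerD; last exact: h3.
  by apply: le_trans (nrmD _ _) _; apply: lerD; [exact: h1|exact: h2].
move=> z hz; have [l hl] := (differentiable_eps q z).1 (dq z hz).
(* [8] balances the perimeter [4 * s] and the bound [2 * s] for distances in the square. *)
have [d d0 hd] := hl _ (divr_gt0 e0 (@ltr0n R 8)).
exists (d / 2); first by rewrite divr_gt0.
move=> c s /andP[s1 sd] cz _; exists 0%N => n _.
have -> : boundary_sum n q c s = boundary_sum n (fun w => q w - q z - l * (w - z)) c s.
  rewrite -[RHS]addr0 -(boundary_sum_affine n (q z - l * z) l c s) -boundary_sumD.
  by apply: eq_boundary_sum => [|x y _ _ _]; [exact: ltW|ring].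
have -> : e * s ^+ 2 = 4 * s * (e / 8 * (2 * s)) by field.
apply: boundary_sum_le; first exact: ltW.
move=> x y hx hy _; have hw : square c s (c + (x +i* y)) by apply/squareE; exists x, y.
have hn := square_nrm hw cz.
apply: le_trans (hd _ _) _; first by apply: le_lt_trans hn _; lra.
by apply: ler_wpM2l => //; rewrite divr_ge0 // ltW.
Qed.

End Squares.

(** * Maximum principle on squares *)

Section MaximumPrinciple.
Variable R : realType.
Implicit Types (e d s r M : R) (f g : C R -> C R) (c z w : C R).

Lemma near_differentiable f g c : (exists2 d, 0 < d &
    forall z, nrm (z - c) < d -> f z = g z) ->
  differentiable f c -> differentiable g c.
Proof.
move=> [d d0 fg] /differentiable_eps[l hl]; apply/differentiable_eps; exists l => e e0.
have [d' d'0 hd] := hl _ e0; exists (Num.min d d'); first by rewrite lt_min d0.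
move=> z; rewrite lt_min => /andP[zd zd']; rewrite -!fg ?hd //.
by rewrite subrr nrm0.
Qed.

Lemma caratheodory f c : differentiable f c <->
  exists2 g, {for c, continuous g} & forall z, f z = f c + (z - c) * g z.
Proof.
split=> [/differentiable_eps[l hl]|[g /continuous_eps cg fg]].
  exists (fun z => if z == c then l else (f z - f c) / (z - c)); last first.
    move=> z; case: eqVneq => [->|zc]; first by rewrite subrr mul0r addr0.
    by rewrite mulrC divfK ?subr_eq0 // addrC subrK.
  apply/continuous_eps => e e0; have [d d0 hd] := hl _ (divr_gt0 e0 (@ltr0n R 2)).
  exists d => // z zd; rewrite eqxx; case: eqVneq => [_|zc].
    by rewrite subrr nrm0.
  have zc0 : z - c != 0 by rewrite subr_eq0.
  have zc1 : 0 < nrm (z - c) by rewrite nrm_gt0.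
  have -> : (f z - f c) / (z - c) - l = (f z - f c - l * (z - c)) / (z - c).
    by rewrite [RHS]mulrBl mulfK.
  rewrite nrmM nrmV ltr_pdivrMr //; apply: le_lt_trans (hd _ zd) _.
  by rewrite ltr_pM2r // ltr_pdivrMr // ltr_pMr // ltr1n.
apply/differentiable_eps; exists (g c) => e e0; have [d d0 hd] := cg _ e0.
exists d => // z zd; have -> : f z - f c - g c * (z - c) = (g z - g c) * (z - c).
  by rewrite fg; ring.
by rewrite nrmM ler_wpM2r ?nrm_ge0 // ltW // hd.
Qed.

Lemma slope_differentiable f g c w :
  (forall z, f z = f c + (z - c) * g z) -> w != c ->
  differentiable f w -> differentiable g w.
Proof.
move=> fg wc df.
have dw : differentiable (fun z => (f z - f c) * (z - c)^-1) w.
  apply: differentiableM; first by apply: differentiableB.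
  by apply: differentiableV; [apply: differentiableB|rewrite subr_eq0].
apply: near_differentiable dw; exists (nrm (w - c)); first by rewrite nrm_gt0 subr_eq0.
move=> z zw; have zc : z - c != 0.
  rewrite subr_eq0; apply: contraTneq zw => ->.
  by rewrite nrmB ltxx.
by rewrite fg [f c + _]addrC addrK mulrC mulKf.
Qed.

(** This removes poles: the factor [z - c] turns mere continuity at [c] into differentiability. *)
Lemma mulz_differentiable g c : {for c, continuous g} ->
  differentiable (fun z => (z - c) * g z) c.
Proof.
by move=> cg; apply/caratheodory; exists g => // z; rewrite subrr mul0r add0r.
Qed.

Lemma expr_differentiable f n z : differentiable f z ->
  differentiable (fun w => f w ^+ n) z.
Proof.
move=> df; elim: n => [|n IH]; first exact: differentiable_cst.
rewrite (_ : (fun w => f w ^+ n.+1) = f * (fun w => f w ^+ n)).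
  exact: differentiableM.
by apply/funext => w; rewrite exprS.
Qed.

(** The integral would be [2 * pi * 'i]. At corresponding nodes of parallel sides the values differ
    by ['i * k t] or [k t] with [k t >= r^-1], so nothing cancels and [4] is a lower bound at every
    level. *)
Lemma boundary_sum_pole n c r : 0 < r ->
  4 <= nrm (boundary_sum n (fun z => (z - c)^-1) (c - (r +i* r)) (2 * r)).
Proof.
move=> r0; pose k t := 2 * r / ((2 * t - 1) ^+ 2 * r ^+ 2 + r ^+ 2).
have den t : 0 < (2 * t - 1) ^+ 2 * r ^+ 2 + r ^+ 2.
  by apply: ltr_wpDl; rewrite ?exprn_gt0 // -exprMn sqr_ge0.
have [x xr xE] : exists2 x, r^-1 <= x & dyadic_avg n (fun t => (k t)%:C) = x%:C.
  apply: dyadic_avg_real => t /andP[t0 t1]; rewrite /k ler_pdivlMr // mulrC ler_pdivrMr //.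
  have h : (2 * t - 1) ^+ 2 <= 1 by rewrite -subr_ge0; nra.
  rewrite (_ : 2 * r * r = 1 * r ^+ 2 + r ^+ 2); last by ring.
  by rewrite lerD2r ler_wpM2r // sqr_ge0.
have den' t : (2 * r * t - r) ^+ 2 + r ^+ 2 != 0.
  by rewrite (_ : 2 * r * t - r = (2 * t - 1) * r) ?exprMn ?gt_eqF //; ring.
have inv (a b : R) : (a +i* b : C R)^-1 =
    (a / (a ^+ 2 + b ^+ 2) +i* (- b / (a ^+ 2 + b ^+ 2))).
  by rewrite {1}/GRing.inv /= mulNr.
have sh (a b : R) : c - (r +i* r) + (a +i* b) - c = ((a - r) +i* (b - r)).
  rewrite addrAC (addrAC c) subrr add0r.
  by apply/eqP; rewrite eq_complex /= !(addrC (- r)) !eqxx.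
have kE t : k t = 2 * r / ((2 * r * t - r) ^+ 2 + r ^+ 2).
  by rewrite /k -exprMn (_ : (2 * t - 1) * r = 2 * r * t - r) //; ring.
have dE t : (r ^+ 2 + (2 * r * t - r) ^+ 2) != 0 by rewrite addrC.
have r2 : 2 * r - r = r by ring.
rewrite /boundary_sum.
have -> : dyadic_avg n (fun t => (c - (r +i* r) + ((2 * r * t) +i* 0) - c)^-1) =
    dyadic_avg n (fun t => (c - (r +i* r) + ((2 * r * t) +i* (2 * r)) - c)^-1) +
    'i * x%:C.
  rewrite -xE -dyadic_avgM -dyadic_avgD; apply: eq_dyadic_avg => t _.
  rewrite !sh !inv kE r2 sub0r !sqrrN; apply/eqP; rewrite eq_complex /=.
  by apply/andP; split; apply/eqP; field; exact: den'.
have -> : dyadic_avg n (fun t => (c - (r +i* r) + ((2 * r) +i* (2 * r * t)) - c)^-1) =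
    dyadic_avg n (fun t => (c - (r +i* r) + (0 +i* (2 * r * t)) - c)^-1) + x%:C.
  rewrite -xE -dyadic_avgD; apply: eq_dyadic_avg => t _.
  rewrite !sh !inv kE r2 sub0r !sqrrN; apply/eqP; rewrite eq_complex /=.
  by apply/andP; split; apply/eqP; field; rewrite ?den' ?dE.
rewrite !(addrC _ (_ * x%:C)) addrK (addrC _ x%:C) addrK.
have -> : (2 * r)%:C * ('i * x%:C + 'i * x%:C) = 'i * (4 * (r * x))%:C :> C R.
  by rewrite !rmorphM /= !rmorph_nat; ring.
have rx : 1 <= r * x by rewrite -ler_pdivrMl // mulr1.
by rewrite nrmM nrmi mul1r nrmR ger0_norm; lra.
Qed.

(* The pole of [(f z - f c) ^+ 2 / (z - c)] at [c] is removable, with no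
   information on [f] beyond its first derivative, so Goursat applies to it. *)
Lemma maximum_principle5 f c r M : 0 < r -> 0 <= M ->
  (forall z, square (c - (r +i* r)) (2 * r) z -> differentiable f z) ->
  (forall z, square (c - (r +i* r)) (2 * r) z -> r <= nrm (z - c) -> nrm (f z) <= M) ->
  nrm (f c) <= 5 * M.
Proof.
move=> r0 M0 df fM; set Q := square (c - (r +i* r)) (2 * r) in df fM *.
have Qc : Q c.
  by rewrite /Q /square /= !ReD !ImD /=; split; apply/andP; split;
    case: (c) => a b /=; lra.
have [g cg fg] := (caratheodory f c).1 (df c Qc).
pose k z := (z - c) * (g z ^+ 2).
have dk z : Q z -> differentiable k z.
  move=> Qz; have [->|zc] := eqVneq z c.
    by apply: mulz_differentiable; apply: (continuousM cg cg).
  have dg := slope_differentiable fg zc (df _ Qz).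
  apply: differentiableM; first exact: differentiableB.
  exact: expr_differentiable.
have s0 : 0 < 2 * r by rewrite mulr_gt0.
have hb x y : 0 <= x <= 2 * r -> 0 <= y <= 2 * r ->
   [|| x == 0, x == 2 * r, y == 0 | y == 2 * r] ->
   Q (c - (r +i* r) + (x +i* y)) /\ r <= nrm (c - (r +i* r) + (x +i* y) - c).
  move=> hx hy hxy; split; first by apply/squareE; exists x, y.
  rewrite addrAC (addrAC c) subrr add0r.
  have [hR|hI] : `|x - r| = r \/ `|y - r| = r.
    case/or4P: hxy => /eqP ->; [left|left|right|right].
    - by rewrite sub0r normrN gtr0_norm.
    - by rewrite (_ : 2 * r - r = r) ?gtr0_norm //; ring.
    - by rewrite sub0r normrN gtr0_norm.
    - by rewrite (_ : 2 * r - r = r) ?gtr0_norm //; ring.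
  - by rewrite -{1}hR; apply: le_trans (Re_le _); rewrite ReD /= addrC.
  - by rewrite -{1}hI; apply: le_trans (Im_le _); rewrite ImD /= addrC.
set m := nrm (f c); have m0 : 0 <= m := nrm_ge0 _.
(* On the boundary, [f c ^+ 2 / (z - c)] is [k z + (2 * f c * f z - f z ^+ 2) / (z - c)]: Goursat
   makes the sum of the first term small, [M] controls the second, and [boundary_sum_pole] bounds
   the left side below. *)
have est e : 0 < e -> m ^+ 2 * 4 <= e + 4 * (2 * r) * ((M ^+ 2 + 2 * m * M) / r).
  move=> e0; have [n0 /(_ _ (leqnn n0)) hn] := goursat s0 dk e0.
  have : m ^+ 2 * 4 <= nrm (f c ^+ 2 * boundary_sum n0 (fun z => (z - c)^-1)
      (c - (r +i* r)) (2 * r)).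
    by rewrite nrmM nrmX; apply: ler_wpM2l; rewrite ?exprn_ge0 //; exact: boundary_sum_pole.
  move=> /le_trans; apply.
  rewrite -boundary_sumM.
  have -> : boundary_sum n0 (fun z => f c ^+ 2 * (z - c)^-1) (c - (r +i* r)) (2 * r) =
     boundary_sum n0 k (c - (r +i* r)) (2 * r) +
     boundary_sum n0 (fun z => (2 * f c * f z - f z ^+ 2) / (z - c))
       (c - (r +i* r)) (2 * r).
    rewrite -boundary_sumD; apply: eq_boundary_sum; first exact: ltW.
    move=> x y hx hy hxy; have [_] := hb x y hx hy hxy.
    move: (c - _ + _) => z rz; have zc : z - c != 0.
      by rewrite -nrm_gt0; apply: lt_le_trans rz.
    by rewrite /k (fg z); field.
  apply: le_trans (nrmD _ _) _; apply: lerD => //.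
  apply: boundary_sum_le; first exact: ltW.
  move=> x y hx hy hxy; have [Qz rz] := hb x y hx hy hxy.
  move: (c - _ + _) Qz rz => z Qz rz; have fz := fM z Qz rz.
  have zc : 0 < nrm (z - c) by apply: lt_le_trans rz.
  rewrite nrmM nrmV; apply: ler_pM; rewrite ?nrm_ge0 ?invr_ge0 ?nrm_ge0 //; last first.
    by rewrite lef_pV2 // posrE.
  rewrite addrC; apply: le_trans (nrmD _ _) _; rewrite nrmN nrmX !nrmM.
  have -> : nrm (2 : C R) = 2.
    by rewrite (_ : (2 : C R) = (2 : R)%:C) ?nrmR ?ger0_norm // rmorph_nat.
  apply: lerD; first by apply: lerXn2r; rewrite ?nnegrE ?nrm_ge0.
  by apply: ler_wpM2l => //; rewrite mulr_ge0.
have : m ^+ 2 * 4 <= 4 * (2 * r) * ((M ^+ 2 + 2 * m * M) / r).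
  by apply/ler_addgt0Pl.
rewrite (_ : 4 * (2 * r) * _ = 8 * (M ^+ 2 + 2 * m * M)); last by field; rewrite gt_eqF.
(* The inequality reads [m ^+ 2 <= 2 * M ^+ 2 + 4 * m * M]; hence [m] is at most [2 + sqrt 6] times
   [M], and [5] is the next integer. *)
by move=> h; rewrite leNgt; apply/negP => h5; nra.
Qed.

(** If [M < m], then [(m / M) ^+ n] exceeds any [K] by Bernoulli's inequality. Applied to powers of
    a function, this discards constant factors in estimates. *)
Lemma le_of_exprn (K m M : R) : 0 <= m -> 0 <= M ->
  (forall n, m ^+ n <= K * M ^+ n) -> m <= M.
Proof.
move=> m0 M0 h; rewrite leNgt; apply/negP => Mm.
have {}m0 : 0 < m by apply: le_lt_trans Mm.
have [M00|M00] := eqVneq M 0.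
  by have := h 1; rewrite M00 !expr1 mulr0 leNgt m0.
have M1 : 0 < M by rewrite lt_def M00.
have q1 : 1 < m / M by rewrite ltr_pdivlMr // mul1r.
have qn n : (m / M) ^+ n <= K by rewrite expr_div_n ler_pdivrMr ?exprn_gt0.
have bern n : 1 + n%:R * (m / M - 1) <= (m / M) ^+ n.
  elim: n => [|n IH]; first by rewrite mul0r addr0 expr0.
  rewrite exprS; apply: le_trans (ler_wpM2l _ IH); last by rewrite ltW // (lt_trans ltr01).
  rewrite -natr1; have : 0 <= n%:R * (m / M - 1) ^+ 2 by rewrite mulr_ge0 // sqr_ge0.
  by move: (m / M) => q; nra.
have q0 : 0 < m / M - 1 by rewrite subr_gt0.
pose n := Num.bound `|K / (m / M - 1)|.
have hn : K / (m / M - 1) < n%:R.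
  apply: le_lt_trans (ler_norm _) _; exact: archi_boundP.
have := le_trans (bern n) (qn n); rewrite leNgt => /negP; apply.
by move: hn; rewrite ltr_pdivrMr //; lra.
Qed.

Lemma maximum_principle f c r M : 0 < r -> 0 <= M ->
  (forall z, square (c - (r +i* r)) (2 * r) z -> differentiable f z) ->
  (forall z, square (c - (r +i* r)) (2 * r) z -> r <= nrm (z - c) -> nrm (f z) <= M) ->
  nrm (f c) <= M.
Proof.
move=> r0 M0 df fM; apply: (@le_of_exprn 5) => // [|n]; first exact: nrm_ge0.
rewrite -nrmX; apply: (@maximum_principle5 (fun z => f z ^+ n) c r) => //.
- by rewrite exprn_ge0.
- by move=> z /df dz; exact: expr_differentiable.
- by move=> z Qz rz; rewrite nrmX; apply: lerXn2r; rewrite ?nnegrE ?nrm_ge0 ?fM.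
Qed.

End MaximumPrinciple.

(** * Removable singularities, identity theorem, Liouville's theorem *)

Section OneVariable.
Variable R : realType.
Implicit Types (e d s r M : R) (f g : C R -> C R) (c z w : C R).

Definition disc c r : set (C R) := [set z | nrm (z - c) < r].

Lemma disc_center c r : 0 < r -> disc c r c.
Proof. by rewrite /disc /= subrr nrm0. Qed.

Lemma disc_disc c r z : disc c r z -> exists2 d, 0 < d & disc z d `<=` disc c r.
Proof.
move=> zr; exists (r - nrm (z - c)); first by rewrite subr_gt0.
move=> w; rewrite /disc /= => wz.
rewrite -(subrK z w) -addrA; apply: le_lt_trans (nrmD _ _) _.
by rewrite -ltrBrDr.
Qed.

Lemma punctured_point_real w d (s : seq (C R)) : 0 < d ->
  exists2 e, 0 < e < d & w + e%:C \notin s.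
Proof.
move=> d0; pose p (k : nat) : C R := w + (d / k.+2%:R)%:C.
have pinj : injective p.
  move=> i j /addrI /complexI /(mulfI (negbT (gt_eqF d0))) /invr_inj /eqP.
  by rewrite eqr_nat => /eqP[].
have : ~~ all (mem s) (map p (iota 0 (size s).+1)).
  apply/negP => /allP h; have := uniq_leq_size _ h.
  by rewrite map_inj_uniq // iota_uniq size_map size_iota ltnn => /(_ isT).
move=> /allPn[_ /mapP[k _ ->] ks]; exists (d / k.+2%:R) => //.
by rewrite divr_gt0 // ltr_pdivrMr ?ltr0n // ltr_pMr // ltr1n.
Qed.

Lemma punctured_point w d (s : seq (C R)) : 0 < d ->
  exists2 w', nrm (w' - w) < d & w' \notin s.
Proof.
move=> /(punctured_point_real w s)[e /andP[e0 ed] es]; exists (w + e%:C) => //.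
by rewrite addrC addKr nrmR gtr0_norm.
Qed.

Lemma slope_continuous f g c w :
  (forall z, f z = f c + (z - c) * g z) -> w != c ->
  {for w, continuous f} -> {for w, continuous g}.
Proof.
move=> fg wc cf.
have cw : {for w, continuous (fun z => (f z - f c) * (z - c)^-1)}.
  apply: (continuousM (s := fun z => f z - f c) (t := fun z => (z - c)^-1)).
    apply: (continuousB cf); exact: cst_continuous.
  apply: differentiable_continuous; apply: differentiableV; last by rewrite subr_eq0.
  exact: differentiableB.
have gE z : z != c -> g z = (f z - f c) * (z - c)^-1.
  by move=> zc; rewrite fg [f c + _]addrC addrK mulrC mulKf // subr_eq0.
apply/continuous_eps => e e0.
have [d d0 hd] := (continuous_eps _ _).1 cw _ e0.
have wc0 : 0 < nrm (w - c) by rewrite nrm_gt0 subr_eq0.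
exists (Num.min d (nrm (w - c))); first by rewrite lt_min d0.
move=> z; rewrite lt_min => /andP[zd zw]; rewrite !gE //; first exact: hd.
by apply: contraTneq zw => ->; rewrite nrmB ltxx.
Qed.

(** At the points of [s] only continuity is known. The fixed product of the [z - a], times [f ^+ n],
    is differentiable there, and its effect is lost as [n] grows. The square about [w] of half side
    [2 * r] stays within [4 * r] of [w], hence [5 * r] of [c], and its boundary at distance at least
    [r] from [c]. *)
Lemma max_disc (s : seq (C R)) f c r M : 0 < r -> 0 <= M ->
  (forall z, disc c (5 * r) z -> {for z, continuous f}) ->
  (forall z, disc c (5 * r) z -> z \notin s -> differentiable f z) ->
  (forall z, disc c (5 * r) z -> r <= nrm (z - c) -> nrm (f z) <= M) ->
  forall w, disc c r w -> nrm (f w) <= M.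
Proof.
move=> r0 M0 cf df fM.
have hyp w : disc c r w -> w \notin s -> nrm (f w) <= M.
  move=> wr ws; pose P (t : seq (C R)) z := \prod_(a <- t) (z - a).
  have dP t z : differentiable (P t) z.
    elim: t => [|a t IH].
      rewrite (_ : P [::] = cst 1); first exact: differentiable_cst.
      by apply/funext => x; rewrite /P big_nil.
    rewrite (_ : P (a :: t) = (fun x => x - a) * P t).
      by apply: differentiableM => //; exact: differentiableB.
    by apply/funext => x; rewrite /P big_cons.
  have sq z : square (w - (2 * r +i* (2 * r))) (2 * (2 * r)) z ->
      nrm (z - w) <= 4 * r.
    rewrite /square /= => -[h1 h2]; apply: le_trans (nrm_ReIm _) _.
    rewrite !ReD !ImD in h1 h2 *.
    move: h1 h2; case: (z) => a b; case: (w) => a' b' /= h1 h2.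
    have h3 : `|a - a'| <= 2 * r by rewrite ler_norml; lra.
    have h4 : `|b - b'| <= 2 * r by rewrite ler_norml; lra.
    lra.
  have sqd z : square (w - (2 * r +i* (2 * r))) (2 * (2 * r)) z -> disc c (5 * r) z.
    move=> /sq h; rewrite /disc /= -(subrK w z) -addrA.
    apply: le_lt_trans (nrmD _ _) _; rewrite (_ : 5 * r = 4 * r + r); last by ring.
    exact: ler_ltD.
  pose K := \prod_(a <- s) (4 * r + nrm (w - a)).
  have K0 : 0 <= K by apply: prodr_ge0 => a _; rewrite addr_ge0 ?nrm_ge0 // mulr_ge0 // ltW.
  have Pw : 0 < nrm (P s w).
    rewrite nrm_gt0 /P prodf_seq_neq0; apply/allP => a as_; rewrite /= subr_eq0.
    by apply: contraNneq ws => ->.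
  apply: (@le_of_exprn _ (K / nrm (P s w))) => //; first exact: nrm_ge0.
  move=> n; rewrite mulrAC ler_pdivlMr // -nrmX -nrmM.
  apply: (@maximum_principle _ (fun z => f z ^+ n * P s z) w (2 * r)).
  - by rewrite mulr_gt0.
  - by rewrite mulr_ge0 // exprn_ge0.
  - move=> z /sqd zd; have [zs|zs] := boolP (z \in s); last first.
      by apply: differentiableM => //; apply: expr_differentiable; exact: df.
    rewrite (_ : (fun z => _) = fun x => (x - z) * (f x ^+ n * P (rem z s) x)); last first.
      by apply/funext => x; rewrite /P (big_rem z zs) /= mulrCA.
    apply: mulz_differentiable.
    apply: (continuousM (s := fun x => f x ^+ n) (t := P (rem z s))); last first.
      exact: differentiable_continuous.
    apply: (@continuous_comp _ _ _ f (fun x : C R => x ^+ n)); first exact: cf.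
    by apply: differentiable_continuous; apply: (expr_differentiable (f := id)).
  - move=> z zq zr; rewrite nrmM nrmX mulrC; apply: ler_pM; rewrite ?nrm_ge0 ?exprn_ge0 ?nrm_ge0 //.
      rewrite /P nrm_prod; apply: ler_prod => a _; rewrite nrm_ge0 /=.
      by rewrite -{1}(subrK w z) -addrA; apply: le_trans (nrmD _ _) _; rewrite lerD2r sq.
    apply: lerXn2r; rewrite ?nnegrE ?nrm_ge0 //; apply: fM; first exact: sqd.
    have := nrmBr (z - w) (c - w); rewrite opprB addrA subrK (nrmB c w).
    by move: wr zr; rewrite /disc /=; lra.
(* The points of [s] are reached by continuity from points outside of it. *)
move=> w wr; apply/ler_addgt0Pr => e e0.
have wr5 : disc c (5 * r) w by move: wr; rewrite /disc /=; lra.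
have [d d0 hd] := (continuous_eps _ _).1 (cf w wr5) _ e0.
have [d' d'0 hd'] := disc_disc wr.
have [|w' ww' w's] := @punctured_point w (Num.min d d') s; first by rewrite lt_min d0.
move: ww'; rewrite lt_min => /andP[w'd w'd'].
have := hyp w' (hd' _ w'd') w's; have := hd _ w'd.
by have := nrmBr (f w) (f w'); rewrite nrmB; lra.
Qed.

(** The limit is the supremum of the lower cones [phi z - L * nrm (z - c)], as in McShane's
    extension of Lipschitz functions. *)
Lemma lipschitz_limit (phi : C R -> R) c r L : 0 < r -> 0 <= L ->
  (forall z w, 0 < nrm (z - c) < r -> 0 < nrm (w - c) < r ->
    `|phi z - phi w| <= L * nrm (z - w)) ->
  exists l, forall z, 0 < nrm (z - c) < r -> `|phi z - l| <= L * nrm (z - c).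
Proof.
move=> r0 L0 lip.
pose S := [set phi z - L * nrm (z - c) | z in [set z | 0 < nrm (z - c) < r]].
have [z0 z0d] : exists z0, 0 < nrm (z0 - c) < r.
  have [z h1 h2] := @punctured_point c r [:: c] r0; exists z; rewrite h1 andbT.
  by rewrite nrm_gt0 subr_eq0; move: h2; rewrite inE.
have ub z : 0 < nrm (z - c) < r -> ubound S (phi z + L * nrm (z - c)).
  move=> zr _ [w wr <-]; have := lip w z wr zr; rewrite ler_norml => /andP[_ h].
  have h2 : nrm (w - z) <= nrm (w - c) + nrm (z - c).
    by rewrite (nrmB z) -(subrK c w) -addrA; apply: le_trans (nrmD _ _) _; rewrite addrK.
  have := ler_wpM2l L0 h2; rewrite mulrDr; lra.
exists (sup S) => z zr; rewrite ler_norml; apply/andP; split.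
  rewrite lerBrDr addrC lerBlDr; apply: ge_sup; first by exists (phi z0 - L * nrm (z0 - c)); exists z0.
  exact: ub.
rewrite lerBlDl -lerBlDr; apply: ub_le_sup; last by exists z.
by exists (phi z0 + L * nrm (z0 - c)); exact: ub.
Qed.

(* Two applications of the maximum principle, to a difference quotient of [f]
   and to a difference of such quotients, show that the quotients at [c] are
   Lipschitz, hence converge. *)
Lemma removable_singularity f c r : 0 < r ->
  (forall z, disc c r z -> {for z, continuous f}) ->
  (forall z, disc c r z -> z != c -> differentiable f z) ->
  differentiable f c.
Proof.
rename r into r'; move=> r00 cf0 df0; pose M := nrm (f c) + 1.
have M0 : 0 <= M by rewrite addr_ge0 ?nrm_ge0.
have [d d0 hd] := (continuous_eps _ _).1 (cf0 c (disc_center c r00)) _ (@ltr01 R).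
pose r1 := Num.min d r'; have r10 : 0 < r1 by rewrite lt_min d0.
have [r r0 r5] : exists2 r : R, 0 < r & 5 * r = r1.
  by exists (r1 / 5); [rewrite divr_gt0|field].
have s1 z : disc c (5 * r) z -> nrm (z - c) < d by rewrite r5 /disc /= lt_min => /andP[].
have cf z : disc c (5 * r) z -> {for z, continuous f}.
  by rewrite r5 /disc /= lt_min => /andP[_ h]; exact: cf0.
have df z : disc c (5 * r) z -> z != c -> differentiable f z.
  by rewrite r5 /disc /= lt_min => /andP[_ h]; exact: df0.
have fM z : disc c (5 * r) z -> nrm (f z) <= M.
  move=> /s1 /hd h; have := nrmBr (f z) (f c); rewrite /M; lra.
have r5r z : disc c r z -> disc c (5 * r) z by rewrite /disc /=; lra.
(* [g w] is the slope of [f] based at [w], continuous at [w] itself; only at [w] and [c] is its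
   differentiability in doubt. *)
have slopes w : exists g, disc c r w -> w != c ->
   (forall z, f z = f w + (z - w) * g z) /\ {for w, continuous g}.
  have [[wr wc]|h] := pselect (disc c r w /\ w != c); last first.
    by exists f => wr wc; case: h.
  by have [g h1 h2] := (caratheodory f w).1 (df w (r5r _ wr) wc); exists g.
have {slopes} /choice[g hg] := slopes.
have gc w z : disc c r w -> w != c -> disc c (5 * r) z -> {for z, continuous (g w)}.
  move=> wr wc zr; have [h1 h2] := hg w wr wc.
  have [->//|zw] := eqVneq z w.
  exact: (slope_continuous h1 zw (cf z zr)).
have gd w z : disc c r w -> w != c -> disc c (5 * r) z -> z \notin [:: w; c] ->
    differentiable (g w) z.
  move=> wr wc zr; rewrite !inE negb_or => /andP[zw zc].
  have [h1 h2] := hg w wr wc; exact: (slope_differentiable h1 zw (df z zr zc)).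
have rw w z : disc c (r / 2) w -> r <= nrm (z - c) -> r / 2 <= nrm (z - w).
  move=> wr zr; have := nrmBr (z - c) (w - c).
  by rewrite opprB addrA subrK; move: wr; rewrite /disc /=; lra.
have rr w : disc c (r / 2) w -> disc c r w by rewrite /disc /=; lra.
pose L := 2 * M / (r / 2).
have L0 : 0 <= L.
  by apply: divr_ge0; [exact: mulr_ge0|apply: divr_ge0 => //; exact: ltW].
have gL w z : disc c (r / 2) w -> w != c -> disc c r z -> nrm (g w z) <= L.
  move=> wr wc; apply: (@max_disc [:: w; c] (g w) c r L r0 L0).
  - by move=> x; apply: gc => //; exact: rr.
  - by move=> x; apply: gd => //; exact: rr.
  move=> x xr xc; have xw := rw w x wr xc; have [h1 _] := hg w (rr _ wr) wc.
  have r2 : 0 < r / 2 by rewrite divr_gt0.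
  rewrite /L ler_pdivlMr //; apply: (@le_trans _ _ (nrm (g w x) * nrm (x - w))).
    by apply: ler_wpM2l => //; exact: nrm_ge0.
  rewrite mulrC -nrmM (_ : (x - w) * g w x = f x - f w); last by rewrite (h1 x); ring.
  apply: le_trans (nrmD _ _) _; rewrite nrmN mulr2n mulrDl mul1r.
  by apply: lerD; apply: fM => //; exact/r5r/rr.
have flip w z : disc c (r / 2) w -> w != c -> disc c r z ->
    nrm (f z - f w) <= L * nrm (z - w).
  move=> wr wc zr; have [h1 _] := hg w (rr _ wr) wc.
  by rewrite h1 addrC addKr nrmM mulrC ler_wpM2r ?nrm_ge0 // gL.
(* For [x] far from [w] and [w'], the difference [g w x - g w' x] is a term of size
   [2 * M * nrm (w - w')] over a product of two distances, plus [(f w' - f w) / (x - w')], bounded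
   by [flip]; these are the two summands of [L']. *)
pose L' := 2 * M / (r / 2) ^+ 2 + L / (r / 2).
have r2 : 0 < r / 2 by rewrite divr_gt0.
have L'0 : 0 <= L'.
  apply: addr_ge0; apply: divr_ge0 => //; [exact: mulr_ge0|exact/exprn_ge0/ltW|].
  exact: ltW.
have glip w w' : disc c (r / 2) w -> w != c -> disc c (r / 2) w' -> w' != c ->
    nrm (g w c - g w' c) <= L' * nrm (w - w').
  move=> wr wc wr' wc'.
  have [h1 _] := hg w (rr _ wr) wc; have [h2 _] := hg w' (rr _ wr') wc'.
  have B0 : 0 <= L' * nrm (w - w') by rewrite mulr_ge0 ?nrm_ge0.
  apply: (@max_disc [:: w; w'; c] (fun z => g w z - g w' z) c r _ r0 B0).
  - move=> x xr.
    exact: (continuousB (gc w x (rr _ wr) wc xr) (gc w' x (rr _ wr') wc' xr)).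
  - move=> x xr; rewrite !inE !negb_or => /and3P[xw xw' xc].
    by apply: differentiableB; apply: gd; rewrite ?inE ?negb_or ?xw ?xw' //; exact: rr.
  - move=> x xr xc; have xw := rw w x wr xc; have xw' := rw w' x wr' xc.
    have k1 : 0 < nrm (x - w) by apply: lt_le_trans xw.
    have k2 : 0 < nrm (x - w') by apply: lt_le_trans xw'.
    have n1 : x - w != 0 by rewrite -nrm_gt0.
    have n2 : x - w' != 0 by rewrite -nrm_gt0.
    have -> : g w x - g w' x = (f x - f w) * (w - w') / ((x - w) * (x - w')) +
        (f w' - f w) / (x - w').
      have e1 : g w x = (f x - f w) / (x - w) by rewrite (h1 x) addrC addKr mulrC mulKf.
      have e2 : g w' x = (f x - f w') / (x - w') by rewrite (h2 x) addrC addKr mulrC mulKf.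
      by rewrite e1 e2; field; rewrite n1 n2.
    apply: le_trans (nrmD _ _) _; rewrite /L' [leRHS]mulrDl; apply: lerD.
      rewrite !nrmM nrmV nrmM mulrAC; apply: ler_wpM2r; first exact: nrm_ge0.
      apply: ler_pM; rewrite ?nrm_ge0 // ?invr_ge0 ?mulr_ge0 ?nrm_ge0 //.
        apply: le_trans (nrmD _ _) _; rewrite nrmN mulr2n mulrDl mul1r.
        by apply: lerD; apply: fM => //; exact/r5r/rr.
      have h : (r / 2) ^+ 2 <= nrm (x - w) * nrm (x - w').
        by rewrite expr2; apply: ler_pM => //; exact: ltW.
      by rewrite lef_pV2 // posrE ?exprn_gt0 // mulr_gt0.
    rewrite nrmM nrmV [leRHS]mulrAC; apply: ler_pM; rewrite ?nrm_ge0 ?invr_ge0 ?nrm_ge0 //.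
      by rewrite (nrmB w); apply: flip => //; exact: rr.
    by rewrite lef_pV2 ?posrE.
  - exact: disc_center.
have [lR hR] : exists l, forall z, 0 < nrm (z - c) < r / 2 ->
    `|complex.Re (g z c) - l| <= L' * nrm (z - c).
  apply: lipschitz_limit => // z w /andP[z0 zr] /andP[w0 wr].
  rewrite nrm_gt0 subr_eq0 in z0; rewrite nrm_gt0 subr_eq0 in w0.
  have -> : complex.Re (g z c) - complex.Re (g w c) = complex.Re (g z c - g w c).
    by case: (g z c); case: (g w c).
  by apply: le_trans (Re_le _) _; exact: glip.
have [lI hI] : exists l, forall z, 0 < nrm (z - c) < r / 2 ->
    `|complex.Im (g z c) - l| <= L' * nrm (z - c).
  apply: lipschitz_limit => // z w /andP[z0 zr] /andP[w0 wr].
  rewrite nrm_gt0 subr_eq0 in z0; rewrite nrm_gt0 subr_eq0 in w0.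
  have -> : complex.Im (g z c) - complex.Im (g w c) = complex.Im (g z c - g w c).
    by case: (g z c); case: (g w c).
  by apply: le_trans (Im_le _) _; exact: glip.
apply/differentiable_eps; exists (lR +i* lI) => e e0.
pose L2 := 2 * L' + 1; have L20 : 0 < L2 by rewrite ltr_wpDl // mulr_ge0.
exists (Num.min (r / 2) (e / L2)); first by rewrite lt_min r2 divr_gt0.
move=> z; rewrite lt_min => /andP[zr ze]; have [->|zc] := eqVneq z c.
  by rewrite !subrr mulr0 subr0 nrm0 mulr0.
have zc0 : 0 < nrm (z - c) by rewrite nrm_gt0 subr_eq0.
have [h1 _] := hg z (rr _ zr) zc.
have -> : f z - f c - (lR +i* lI) * (z - c) = (g z c - (lR +i* lI)) * (z - c).
  by rewrite (h1 c); ring.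
rewrite nrmM ler_wpM2r ?nrm_ge0 //; apply: le_trans (nrm_ReIm _) _.
have -> : complex.Re (g z c - (lR +i* lI)) = complex.Re (g z c) - lR by case: (g z c).
have -> : complex.Im (g z c - (lR +i* lI)) = complex.Im (g z c) - lI by case: (g z c).
have hz : 0 < nrm (z - c) < r / 2 by rewrite zc0.
have := hR z hz; have := hI z hz; move: ze; rewrite ltr_pdivlMr // /L2.
by move: (nrm (z - c)) zc0 => x x0; nra.
Qed.

(** The slope is continuous at [c], which is therefore a removable singularity. Iterating this
    replaces the power series. *)
Lemma slope_holomorphic f c r : 0 < r ->
  (forall z, disc c r z -> differentiable f z) ->
  exists2 g, forall z, f z = f c + (z - c) * g z &
    forall z, disc c r z -> differentiable g z.
Proof.
move=> r0 df; have [g gc fg] := (caratheodory f c).1 (df c (disc_center c r0)).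
have dg z : disc c r z -> z != c -> differentiable g z.
  by move=> zr zc; exact: (slope_differentiable fg zc (df z zr)).
exists g; first exact: fg.
move=> z zr; have [->|zc] := eqVneq z c; last exact: (dg z zr zc).
apply: (removable_singularity r0 _ dg) => w wr.
have [->//|wc] := eqVneq w c.
by apply: differentiable_continuous; exact: dg.
Qed.

Lemma square_split c s z : square c s z -> exists a b : R,
  [/\ a = 0 \/ a = s / 2, b = 0 \/ b = s / 2 & square (c + (a +i* b)) (s / 2) z].
Proof.
move=> [h1 h2].
exists (if complex.Re z - complex.Re c <= s / 2 then 0 else s / 2).
exists (if complex.Im z - complex.Im c <= s / 2 then 0 else s / 2).
split; [by case: ifP; auto|by case: ifP; auto|].
rewrite /square /= !ReD !ImD /=; split;
  [case: (leP (complex.Re z - complex.Re c))|case: (leP (complex.Im z - complex.Im c))] => h; lra.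
Qed.

Lemma bounded_square f c s : 0 < s ->
  (forall z, square c s z -> {for z, continuous f}) ->
  exists2 M, 0 <= M & forall z, square c s z -> nrm (f z) <= M.
Proof.
move=> s0 cf.
apply: (@square_ind _ (fun c s => exists2 M, 0 <= M & forall z, square c s z -> nrm (f z) <= M)) => //.
  move=> c' s' s'0 [M1 M10 h1] [M2 M20 h2] [M3 M30 h3] [M4 M40 h4].
  exists (M1 + M2 + M3 + M4); first by rewrite !addr_ge0.
  move=> z /square_split[a [b [[->|->] [->|->] hz]]].
  - by move: hz; rewrite (_ : (0 +i* 0) = 0 :> C R) // addr0 => /h1; lra.
  - by have := h3 z hz; lra.
  - by have := h2 z hz; lra.
  - by have := h4 z hz; lra.
move=> z zs; have [d d0 hd] := (continuous_eps _ _).1 (cf z zs) _ (@ltr01 R).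
exists (d / 2); first by rewrite divr_gt0.
move=> c' s' /andP[s'0 s'd] zs' _; exists (nrm (f z) + 1); first by rewrite addr_ge0 ?nrm_ge0.
move=> w ws; have := hd w; have := square_nrm ws zs'; have := nrmBr (f w) (f z).
by move=> h1 h2 h3; have := h3 ltac:(lra); lra.
Qed.

(** The maximum principle for [u] gives [nrm (f w) <= M * (nrm (w - c) / p) ^+ m] for all [m]. With
    [p = r / 11], the disc of radius [5 * p] asked for by [max_disc] lies in a square within
    distance [10 * p] of [c], on which [f] is bounded. *)
Lemma flat_disc f c r : 0 < r -> (forall z, disc c r z -> differentiable f z) ->
  (forall m, exists2 u, forall z, disc c r z -> differentiable u z &
    forall z, f z = (z - c) ^+ m * u z) ->
  forall w, disc c (r / 11) w -> f w = 0.
Proof.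
move=> r0 df hu; have [p p0 rE] : exists2 p : R, 0 < p & r = 11 * p.
  by exists (r / 11); [rewrite divr_gt0|field].
have -> : r / 11 = p by rewrite rE; field.
have sq z : square (c - (5 * p +i* (5 * p))) (2 * (5 * p)) z -> disc c r z.
  rewrite /square /= => -[h1 h2]; apply: le_lt_trans (nrm_ReIm _) _.
  rewrite !ReD !ImD in h1 h2 *.
  move: h1 h2; case: (z) => a b; case: (c) => a' b' /= h1 h2.
  have h3 : `|a - a'| <= 5 * p by rewrite ler_norml; lra.
  have h4 : `|b - b'| <= 5 * p by rewrite ler_norml; lra.
  lra.
have sq' z : disc c (5 * p) z -> square (c - (5 * p +i* (5 * p))) (2 * (5 * p)) z.
  rewrite /disc /= => zr; rewrite /square /= !ReD !ImD.
  have := le_lt_trans (Re_le _) zr; have := le_lt_trans (Im_le _) zr.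
  case: (z) => a b; case: (c) => a' b' /=; rewrite !ltr_norml; lra.
have [M M0 hM] : exists2 M, 0 <= M & forall z, disc c (5 * p) z -> nrm (f z) <= M.
  have [|z /sq /df dz|M M0 hM] := @bounded_square f (c - (5 * p +i* (5 * p))) (2 * (5 * p)).
  - lra.
  - exact: differentiable_continuous.
  - by exists M => // z /sq' /hM.
move=> w wp; apply/eqP; rewrite -nrm_eq0; apply/negPn/negP => fw0.
have {}fw0 : 0 < nrm (f w) by rewrite lt_def fw0 nrm_ge0.
have : p <= nrm (w - c).
  apply: (@le_of_exprn _ (M / nrm (f w))); [exact: ltW|exact: nrm_ge0|].
  move=> m; have [u du fu] := hu m.
  have := @max_disc [::] u c p (M / p ^+ m) p0.
  move=> /(_ _ _ _ _ w wp) hw.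
  have {}hw : nrm (u w) <= M / p ^+ m.
    apply: hw.
    - by rewrite divr_ge0 // exprn_ge0 // ltW.
    - move=> z zp; apply: differentiable_continuous; apply: du.
      by move: zp; rewrite /disc /= rE; lra.
    - by move=> z zp _; apply: du; move: zp; rewrite /disc /= rE; lra.
    - move=> z zp zc; have := hM z zp; rewrite fu nrmM nrmX => h.
      rewrite ler_pdivlMr ?exprn_gt0 //; apply: le_trans h; rewrite mulrC.
      apply: ler_wpM2r; first exact: nrm_ge0.
      by apply: lerXn2r; rewrite ?nnegrE ?nrm_ge0 // ltW.
  rewrite mulrAC ler_pdivlMr // fu nrmM nrmX mulrCA mulrC.
  by apply: ler_wpM2r; rewrite ?exprn_ge0 ?nrm_ge0 // mulrC -ler_pdivlMr ?exprn_gt0.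
by move: wp; rewrite /disc /= ltNge => /negP.
Qed.

Lemma identity_disc f c r : 0 < r -> (forall z, disc c r z -> differentiable f z) ->
  (exists2 d, 0 < d & forall z, disc c d z -> f z = 0) ->
  forall w, disc c (r / 11) w -> f w = 0.
Proof.
move=> r0 df [d d0 f0]; apply: flat_disc => // m.
(* At [z = c] the quotient is [0] since [f c = 0], in accordance with its values near [c]. *)
exists (fun z => f z / (z - c) ^+ m) => [z zr|z].
  have [->|zc] := eqVneq z c.
    apply: (@near_differentiable _ (fun=> 0)); last exact: differentiable_cst.
    by exists d => // w wd; rewrite f0 ?mul0r.
  apply: differentiableM; first exact: df.
  apply: differentiableV; last by rewrite expf_neq0 // subr_eq0.
  by apply: expr_differentiable; exact: differentiableB.
have [->|zc] := eqVneq z c; last by rewrite mulrC divfK // expf_neq0 // subr_eq0.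
by rewrite f0 ?mul0r ?mulr0 //; exact: disc_center.
Qed.

(** Were all the successive slopes zero at [c], every power of [z - c] would divide [f], and
    [flat_disc] would apply. *)
Lemma zero_order f c r : 0 < r -> (forall z, disc c r z -> differentiable f z) ->
  (exists2 w, disc c (r / 11) w & f w != 0) ->
  exists m u, [/\ forall z, disc c r z -> differentiable u z,
    forall z, f z = (z - c) ^+ m * u z & u c != 0].
Proof.
move=> r0 df [w wr fw]; apply: contrapT => h.
case/eqP: fw; apply: (flat_disc r0 df) wr; elim=> [|m [u du fu]].
  by exists f => // z; rewrite mul1r.
have u0 : u c = 0.
  by apply/eqP/negPn/negP => u0; apply: h; exists m, u.
have [g ug dg] := slope_holomorphic r0 du.
by exists g => // z; rewrite fu ug u0 add0r exprSr mulrA.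
Qed.

(** The maximum principle on a disc so large that [f] is at most [e] on its outer annulus. *)
Lemma vanishing_entire f : (forall z, differentiable f z) ->
  (forall e, 0 < e -> exists K, forall z, K <= nrm z -> nrm (f z) <= e) ->
  forall z, f z = 0.
Proof.
move=> df h w; apply/eqP; rewrite -nrm_eq0 eq_le nrm_ge0 andbT.
apply/ler_addgt0Pr => e e0; rewrite add0r.
have [K hK] := h e e0; pose r := `|K| + nrm w + 1.
have r0 : 0 < r by rewrite ltr_wpDl // addr_ge0 ?nrm_ge0.
apply: (@max_disc [::] f 0 r) => //; first exact: ltW.
- by move=> z _; exact: differentiable_continuous.
- move=> z _; rewrite subr0 => rz; apply: hK; apply: le_trans rz.
  apply: le_trans (ler_norm _) _; rewrite /r -addrA lerDl addr_ge0 ?nrm_ge0 //.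
- rewrite /disc /= subr0 /r addrAC ltr_pwDl ?nrm_ge0 //; apply: ltr_wpDl => //.
Qed.

(** Passing to the slope at [0] lowers the exponent by one; at exponent [0] the slope tends to zero
    at infinity. *)
Lemma polynomial_growth f k K A : (forall z, differentiable f z) ->
  (forall z, K <= nrm z -> nrm (f z) <= A * nrm z ^+ k) ->
  exists p : {poly C R}, forall z, f z = p.[z].
Proof.
elim: k f K A => [|k IH] f K A df hf.
  have [g fg dg] := @slope_holomorphic f 0 1 ltr01 (fun z _ => df z).
  have dg' z : differentiable g z.
    have [->|z0] := eqVneq z 0; first by apply: dg; exact: disc_center.
    exact: (slope_differentiable fg z0).
  have g0 : forall z, g z = 0.
    apply: vanishing_entire => // e e0; pose B := `|A| + nrm (f 0).
    have B0 : 0 <= B by rewrite addr_ge0 ?nrm_ge0.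
    exists (`|K| + 1 + B / e) => z zK.
    have K0 : 0 <= `|K| by []; have Be : 0 <= B / e by rewrite divr_ge0 // ltW.
    have z0 : 0 < nrm z by apply: lt_le_trans zK; lra.
    have Kz : K <= nrm z by have := ler_norm K; lra.
    rewrite -(ler_pM2l z0) -nrmM.
    have -> : z * g z = f z - f 0 by rewrite (fg z); ring.
    apply: le_trans (nrmD _ _) _; rewrite nrmN -ler_pdivrMr //.
    have h1 := hf z Kz; rewrite expr0 mulr1 in h1.
    have h2 : B / e <= nrm z by lra.
    apply: le_trans h2; rewrite ler_pM2r ?invr_gt0 // /B lerD2r.
    exact: le_trans (ler_norm _).
  by exists (f 0)%:P => z; rewrite hornerC (fg z) g0 mulr0 addr0.
have [g fg dg] := @slope_holomorphic f 0 1 ltr01 (fun z _ => df z).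
have dg' z : differentiable g z.
  have [->|z0] := eqVneq z 0; first by apply: dg; exact: disc_center.
  exact: (slope_differentiable fg z0).
have [|p hp] := IH g (`|K| + 1) (`|A| + nrm (f 0)) dg'.
  move=> z zK; have K0 : 0 <= `|K| by [].
  have z1 : 1 <= nrm z by lra.
  have z0 : 0 < nrm z by lra.
  have Kz : K <= nrm z by have := ler_norm K; lra.
  rewrite -(ler_pM2l z0) -nrmM.
  have -> : z * g z = f z - f 0 by rewrite (fg z); ring.
  apply: le_trans (nrmD _ _) _; rewrite nrmN mulrCA -exprS mulrDl; apply: lerD.
    apply: le_trans (hf z Kz) _; apply: ler_wpM2r; [exact: exprn_ge0 (ltW z0)|exact: ler_norm].
  by rewrite ler_peMr ?nrm_ge0 // exprn_ege1.
exists ((f 0)%:P + 'X * p) => z.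
by rewrite !hornerE -hp (fg z) subr0.
Qed.

(** Connectedness of the plane by bisection: the four quarters share the point [m], so the
    alternatives holding on them agree. *)
Lemma clopen_plane (P : C R -> Prop) :
  (forall z, exists2 d, 0 < d &
    (forall w, disc z d w -> P w) \/ (forall w, disc z d w -> ~ P w)) ->
  forall z w, P z -> P w.
Proof.
move=> hP z w Pz; pose K := nrm z + nrm w + 1.
have K0 : 0 < K by rewrite ltr_wpDl // addr_ge0 ?nrm_ge0.
pose c : C R := (- K +i* - K).
have inK x : nrm x < K -> square c (2 * K) x.
  move=> xK; have := le_lt_trans (Re_le _) xK; have := le_lt_trans (Im_le _) xK.
  by rewrite /square /= !ltr_norml; lra.
have : (forall x, square c (2 * K) x -> P x) \/ (forall x, square c (2 * K) x -> ~ P x).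
  apply: (@square_ind _ (fun c s => (forall x, square c s x -> P x) \/
     (forall x, square c s x -> ~ P x))); first by rewrite mulr_gt0.
    move=> c' s s0 h1 h2 h3 h4; pose m := c' + (s / 2 +i* (s / 2)).
    have hs (a b : R) : a = 0 \/ a = s / 2 -> b = 0 \/ b = s / 2 ->
       square (c' + (a +i* b)) (s / 2) m.
      by move=> ha hb; rewrite /square /= !ReD !ImD /=; case: ha => ->; case: hb => ->; lra.
    have [m1 m2] : square c' (s / 2) m /\ square (c' + (s / 2 +i* 0)) (s / 2) m.
      by split; [have := hs 0 0; rewrite (_ : (0 +i* 0) = 0 :> C R) // addr0; apply; left|apply: hs; auto].
    have [m3 m4] : square (c' + (0 +i* (s / 2))) (s / 2) m /\ square (c' + (s / 2 +i* (s / 2))) (s / 2) m.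
      by split; apply: hs; auto.
    have [Pm|Pm] := pselect (P m); [left|right] => x /square_split[a [b [ha hb]]].
      case: h1 => [h1|/(_ _ m1)//]; case: h2 => [h2|/(_ _ m2)//].
      case: h3 => [h3|/(_ _ m3)//]; case: h4 => [h4|/(_ _ m4)//].
      case: ha => ->; case: hb => ->; [|exact: h3|exact: h2|exact: h4].
      by rewrite (_ : (0 +i* 0) = 0 :> C R) // addr0 => /h1.
    case: h1 => [/(_ _ m1)//|h1]; case: h2 => [/(_ _ m2)//|h2].
    case: h3 => [/(_ _ m3)//|h3]; case: h4 => [/(_ _ m4)//|h4].
    case: ha => ->; case: hb => ->; [|exact: h3|exact: h2|exact: h4].
    by rewrite (_ : (0 +i* 0) = 0 :> C R) // addr0 => /h1.
  move=> x _; have [d d0 hd] := hP x; exists (d / 2); first by rewrite divr_gt0.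
  move=> c' s /andP[s0 sd] xs _.
  by case: hd => hd; [left|right] => y ys; apply: hd;
    apply: le_lt_trans (square_nrm ys xs) _; lra.
case=> h; first by apply: h; apply: inK; rewrite /K; have := nrm_ge0 z; lra.
by case: (h z) => //; apply: inK; rewrite /K; have := nrm_ge0 w; lra.
Qed.

End OneVariable.

(** * A holomorphic map from the projective line is rational *)

Section HolomorphicLine.
Variables (R : realType) (n : nat).
Implicit Types (phi psi : C R -> proj_point R n) (y z w : C R) (i : 'I_n.+1).

Lemma mem_line_colinear (l : proj_point R n) (v w : 'rV[C R]_n.+1) :
  v != 0 -> v \in line l -> w \in line l -> exists a : C R, w = a *: v.
Proof.
by move=> v0 vl wl; move: wl; rewrite (lineE v0 vl) => /vlineP.
Qed.

Definition local_lift phi y := exists r (g : C R -> 'rV[C R]_n.+1), 0 < r /\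
  forall z, disc y r z -> [/\ forall i, differentiable (fun w => g w 0 i) z,
    g z != 0 & g z \in line (phi z)].

Definition locally_in_hyperplane phi i y := exists2 r : R, 0 < r &
  forall z, disc y r z -> forall u, u \in line (phi z) -> u 0 i = 0.

(** The ratio of the coordinates [i] and [i0] has at most a pole, of order the vanishing order [m]
    of coordinate [i0]. Quantifying over all [u] of the line frees the statement from the lift. *)
Lemma local_order phi i0 i y : local_lift phi y ->
  ~ locally_in_hyperplane phi i0 y ->
  exists (r : R) m (H : C R -> C R), [/\ 0 < r,
    forall z, disc y r z -> differentiable H z,
    forall z, disc y r z -> forall u, u \in line (phi z) ->
      (z - y) ^+ m * u 0 i = H z * u 0 i0 &
    forall z, disc y r z -> z != y -> forall u, u \in line (phi z) -> u != 0 ->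
      u 0 i0 != 0].
Proof.
move=> [r [g [r0 hg]]] nh.
have dg k z : disc y r z -> differentiable (fun w => g w 0 k) z.
  by move=> /hg[].
have [m [v [dv gv vy]]] : exists m v, [/\ forall z, disc y r z -> differentiable v z,
    forall z, g z 0 i0 = (z - y) ^+ m * v z & v y != 0].
  apply: (zero_order r0 (dg i0)); apply: contrapT => h; apply: nh.
  exists (r / 11); first by rewrite divr_gt0.
  move=> z zr u uz; have zr' : disc y r z.
    by apply: lt_trans zr _; rewrite ltr_pdivrMr // ltr_pMr // ltr1n.
  have [_ gz0 gz] := hg z zr'; have [a ->] := mem_line_colinear gz0 gz uz.
  rewrite mxE; have [->|g0] := eqVneq (g z 0 i0) 0; first by rewrite mulr0.
  by case: h; exists z.
have [r1 r10 v0] : exists2 r1 : R, 0 < r1 & forall z, disc y r1 z -> v z != 0.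
  have cv := differentiable_continuous (dv y (disc_center y r0)).
  have vy0 : 0 < nrm (v y) by rewrite nrm_gt0.
  have [d d0 hd] := (continuous_eps _ _).1 cv _ vy0.
  exists d => // z /hd; apply: contraTneq => ->.
  by rewrite sub0r nrmN ltxx.
have sub z : disc y (Num.min r r1) z -> disc y r z /\ v z != 0.
  by rewrite /disc /= lt_min => /andP[h1 /v0].
exists (Num.min r r1), m, (fun z => g z 0 i * (v z)^-1); split.
- by rewrite lt_min r0.
- move=> z /sub[zr vz]; apply: differentiableM; first exact: dg.
  by apply: differentiableV => //; exact: dv.
- move=> z /sub[zr vz] u uz; have [_ gz0 gz] := hg z zr.
  have [a ->] := mem_line_colinear gz0 gz uz.
  by rewrite !mxE gv; field.
- move=> z /sub[zr vz] zy u uz u0; have [_ gz0 gz] := hg z zr.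
  have [a uE] := mem_line_colinear gz0 gz uz; rewrite uE mxE gv.
  rewrite !mulf_neq0 // ?expf_neq0 ?subr_eq0 //.
  by apply: contraNneq u0 => a0; rewrite uE a0 scale0r.
Qed.

Lemma horner_growth (p : {poly C R}) : exists (A : R) k, 0 <= A /\
  forall z, 1 <= nrm z -> nrm p.[z] <= A * nrm z ^+ k.
Proof.
elim/poly_ind: p => [|p c [A [k [A0 hA]]]].
  by exists 0, 0%N; split => // z _; rewrite horner0 nrm0 mul0r.
exists (A + nrm c), k.+1; split; first by rewrite addr_ge0 ?nrm_ge0.
move=> z z1; rewrite hornerMXaddC mulrDl; apply: le_trans (nrmD _ _) _; apply: lerD.
  by rewrite nrmM exprSr mulrA ler_wpM2r ?nrm_ge0 // hA.
by rewrite ler_peMr ?nrm_ge0 // exprn_ege1.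
Qed.

Lemma horner_differentiable (p : {poly C R}) z : differentiable (horner p) z.
Proof.
elim/poly_ind: p => [|p c IH].
  rewrite (_ : horner 0 = cst 0); first exact: differentiable_cst.
  by apply/funext => x; rewrite horner0.
rewrite (_ : horner _ = (fun x => p.[x] * x) + cst c).
  by apply: differentiableD => //; exact: differentiableM.
by apply/funext => x; rewrite hornerMXaddC.
Qed.

Lemma eq_off_seq (s : seq (C R)) (f g : C R -> C R) z (r : R) : 0 < r ->
  {for z, continuous f} -> {for z, continuous g} ->
  (forall w, disc z r w -> w \notin s -> f w = g w) -> f z = g z.
Proof.
move=> r0 cf cg fg; apply/eqP; rewrite -subr_eq0 -nrm_eq0 eq_le nrm_ge0 andbT.
apply/ler_addgt0Pr => e e0; rewrite add0r.
have e2 : 0 < e / 2 by rewrite divr_gt0.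
have [d d0 hd] := (continuous_eps _ _).1 cf _ e2.
have [d' d'0 hd'] := (continuous_eps _ _).1 cg _ e2.
have [|w] := @punctured_point R z (Num.min r (Num.min d d')) s.
  by rewrite !lt_min r0 d0.
rewrite !lt_min => /and3P[wr wd wd'] wz.
have -> : f z - g z = (g w - g z) - (f w - f z) by rewrite (fg w wr wz); ring.
apply: le_trans (nrmD _ _) _; rewrite nrmN.
by have := hd _ wd; have := hd' _ wd'; lra.
Qed.

(** [psi] is [phi] in the coordinate at infinity, so together they live on the whole projective
    line. A polynomial [Q] cancels the poles of the ratio of coordinates, and [Q] times the ratio is
    entire of polynomial growth. *)
Lemma holomorphic_line_rational phi psi i0 i y0 :
  (forall y, local_lift phi y) -> local_lift psi 0 ->
  (forall t, t != 0 -> psi t = phi t^-1) ->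
  (exists2 u, u \in line (phi y0) & u 0 i0 != 0) ->
  exists P Q : {poly C R}, Q != 0 /\
    forall z u, u \in line (phi z) -> Q.[z] * u 0 i = P.[z] * u 0 i0.
Proof.
move=> lphi lpsi phipsi [u0 u0y u0i].
(* Lying locally in the hyperplane is open and closed in [y], and fails at [y0]. *)
have nH y : ~ locally_in_hyperplane phi i0 y.
  move=> hy; suff [r r0 /(_ y0 (disc_center y0 r0) u0 u0y)] : locally_in_hyperplane phi i0 y0.
    by apply/eqP.
  apply: clopen_plane hy => {}y.
  have [[r r0 hr]|nh] := pselect (locally_in_hyperplane phi i0 y).
    exists r => //; left => w /disc_disc[d d0 hd]; exists d => // z /hd; exact: hr.
  have [r [m [H [r0 _ _ hr]]]] := local_order i0 (lphi y) nh.
  exists r => //; right => w wr [d d0 hd].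
  have [d' d'0 hd'] := disc_disc wr.
  have [|z] := @punctured_point R w (Num.min d d') [:: y]; first by rewrite lt_min d0.
  rewrite lt_min inE => /andP[zd zd'] zy; have [v0 vz] := vpick_line (phi z).
  by have /eqP := hr z (hd' _ zd') zy _ vz v0; apply; exact: hd vz.
have nHpsi : ~ locally_in_hyperplane psi i0 0.
  move=> [r r0 hr].
  have [t tr] := @punctured_point R 0 r [:: 0] r0; rewrite inE subr0 in tr * => t0.
  apply: (nH t^-1).
  have ct : {for t^-1, continuous (fun x : C R => x^-1)}.
    by apply: inv_continuous; rewrite invr_eq0.
  have [d d0 hd] := (continuous_eps _ _).1 ct (r - nrm t) ltac:(by rewrite subr_gt0).
  have t'0 : 0 < nrm t^-1 by rewrite nrm_gt0 invr_eq0.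
  exists (Num.min d (nrm t^-1)); first by rewrite lt_min d0.
  move=> z; rewrite /disc /= lt_min => /andP[zd zt] u uz.
  have z0 : z != 0 by apply: contraTneq zt => ->; rewrite sub0r nrmN ltxx.
  apply: (hr z^-1); last by rewrite phipsi ?invr_eq0 // invrK.
  rewrite /disc /= subr0; have := hd z zd; rewrite invrK => h.
  by have := nrmBr z^-1 t; lra.
have [r' [m [H' [r'0 dH' hH' nz']]]] := local_order i lpsi nHpsi.
pose Loc (Q : {poly C R}) y := exists (r : R) (H : C R -> C R), [/\ 0 < r,
  forall z, disc y r z -> differentiable H z &
  forall z, disc y r z -> forall u, u \in line (phi z) -> Q.[z] * u 0 i = H z * u 0 i0].
have LocM Q Q' y : Loc Q y -> Loc (Q * Q') y.
  move=> [r [H [r0 dH hH]]]; exists r, (fun z => H z * Q'.[z]); split => //.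
    by move=> z zr; apply: differentiableM; [exact: dH|exact: horner_differentiable].
  by move=> z zr u uz; rewrite hornerM mulrAC hH // mulrAC.
(* Beyond [1 / r'] the inverse lies in the disc around infinity, where coordinate [i0] vanishes at
   most at infinity itself; so all the finite poles lie in the square of half side [K]. *)
pose K : R := 2 / r' + 2; have K0 : 0 < K by rewrite addr_gt0 // divr_gt0.
have [Q Q0 hQ] : exists2 Q : {poly C R}, Q != 0 &
    forall y, square (- K +i* - K) (2 * K) y -> Loc Q y.
  apply: (@square_ind R (fun c s => exists2 Q : {poly C R}, Q != 0 &
    forall y, square c s y -> Loc Q y)); first by rewrite mulr_gt0.
    move=> c s s0 [Q1 Q10 h1] [Q2 Q20 h2] [Q3 Q30 h3] [Q4 Q40 h4].
    exists (Q1 * Q2 * Q3 * Q4); first by rewrite !mulf_neq0.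
    move=> y /square_split[a [b [[->|->] [->|->] hy]]].
    - rewrite -!mulrA; apply/LocM/h1.
      by move: hy; rewrite (_ : (0 +i* 0) = 0 :> C R) // addr0.
    - by rewrite mulrAC (mulrC _ Q3); apply/LocM/h3.
    - by rewrite (mulrC Q1) -!mulrA; apply/LocM/h2.
    - by rewrite mulrC; apply/LocM/h4.
  move=> y _; have [r [k [H [r0 dH hH _]]]] := local_order i (lphi y) (nH y).
  exists (r / 2); first by rewrite divr_gt0.
  move=> c s /andP[s0 sr] ys _; exists (('X - y%:P) ^+ k).
    by rewrite expf_neq0 // polyXsubC_eq0.
  move=> w ws; have /disc_disc[d d0 hd] : disc y r w.
    by apply: le_lt_trans (square_nrm ws ys) _; lra.
  exists d, H; split => //; first by move=> z /hd /dH.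
  by move=> z /hd zr u uz; rewrite -hH // !hornerE.
have far z : 1 / r' < nrm z -> z != 0 /\ disc 0 r' z^-1.
  move=> zr; have z0 : 0 < nrm z by apply: lt_trans zr; rewrite divr_gt0.
  split; first by rewrite -nrm_gt0.
  by rewrite /disc /= subr0 nrmV -ltf_pV2 ?posrE ?invr_gt0 // invrK -div1r.
have nzfar z : 1 / r' < nrm z -> forall u, u \in line (phi z) -> u != 0 -> u 0 i0 != 0.
  move=> /far[z0 zr] u uz; apply: (nz' z^-1) => //; first by rewrite invr_eq0.
  by rewrite phipsi ?invr_eq0 // invrK.
have {}hQ y : Loc Q y.
  have [yK|yK] := ltP (nrm y) K.
    apply: hQ; have := le_lt_trans (Re_le _) yK; have := le_lt_trans (Im_le _) yK.
    by rewrite /square /= !ltr_norml; lra.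
  have yr : 1 / r' < nrm y.
    apply: lt_le_trans yK; rewrite /K; have : 0 < r'^-1 by rewrite invr_gt0.
    lra.
  have [r [g [r0 hg]]] := lphi y.
  have dg k z : disc y r z -> differentiable (fun w => g w 0 k) z by move=> /hg[].
  have [_ gy0 gy] := hg y (disc_center y r0); have gi := nzfar y yr _ gy gy0.
  have cg := differentiable_continuous (dg i0 y (disc_center y r0)).
  have gi0 : 0 < nrm (g y 0 i0) by rewrite nrm_gt0.
  have [d d0 hd] := (continuous_eps _ _).1 cg _ gi0.
  have sub z : disc y (Num.min r d) z -> disc y r z /\ g z 0 i0 != 0.
    rewrite /disc /= lt_min => /andP[-> /hd h]; split => //.
    by apply: contraTneq h => ->; rewrite sub0r nrmN ltxx.
  exists (Num.min r d), (fun z => Q.[z] * (g z 0 i * (g z 0 i0)^-1)); split.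
  - by rewrite lt_min r0.
  - move=> z /sub[zr gz]; apply: differentiableM; first exact: horner_differentiable.
    by apply: differentiableM; [exact: dg|apply: differentiableV; [exact: dg|]].
  - move=> z /sub[zr gz] u uz; have [_ gz0 gzl] := hg z zr.
    by have [a ->] := mem_line_colinear gz0 gzl uz; rewrite !mxE; field.
have /choice[rr /choice[HH hHH]] := hQ.
pose H z := HH z z.
(* The local functions agree off the zeros of coordinate [i0], hence everywhere by continuity: [H]
   is a single entire function. *)
have HE y z : disc y (rr y) z -> H z = HH y z.
  move=> zy; have [ry dHy hHy] := hHH y; have [rz dHz hHz] := hHH z.
  have [d d0 hd] := disc_disc zy.
  have [r1 [_ [_ [r10 _ _ nz]]]] := local_order i (lphi z) (nH z).
  apply: (@eq_off_seq [:: z] (HH z) (HH y) z (Num.min (rr z) (Num.min d r1))).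
  - by rewrite !lt_min rz d0.
  - exact/differentiable_continuous/dHz/disc_center.
  - exact/differentiable_continuous/dHy.
  move=> w; rewrite /disc /= !lt_min inE => /and3P[w1 w2 w3] wz.
  have [v0 vw] := vpick_line (phi w).
  apply: (mulIf (nz w w3 wz _ vw v0)).
  by rewrite -hHz // -hHy //; exact: hd.
have dH z : differentiable H z.
  have [rz dHz _] := hHH z.
  apply: near_differentiable (dHz z (disc_center z rz)).
  by exists (rr z) => // w wz; rewrite (HE z).
have hH z u : u \in line (phi z) -> Q.[z] * u 0 i = H z * u 0 i0.
  by move=> uz; have [rz _ h] := hHH z; apply: h => //; exact: disc_center.
have [P hP] : exists P : {poly C R}, forall z, H z = P.[z].
  have [A [k [A0 hA]]] := horner_growth Q.
  have cH' := differentiable_continuous (dH' 0 (disc_center 0 r'0)).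
  have [d d0 hd] := (continuous_eps _ _).1 cH' _ (@ltr01 R).
  apply: (@polynomial_growth R H (k + m) (K + 1 / d + 1) (A * (nrm (H' 0) + 1)) dH).
  move=> z zK; have d1 : 0 < 1 / d by rewrite divr_gt0.
  have r1 : 0 < 1 / r' by rewrite divr_gt0.
  have KE : K = 2 * (1 / r') + 2 by rewrite /K mul1r.
  have z1 : 1 <= nrm z by lra.
  have zr : 1 / r' < nrm z by lra.
  have zd : 1 / d < nrm z by lra.
  have [z0 z'r] := far z zr; have [v0 vz] := vpick_line (phi z).
  have vi := nzfar z zr _ vz v0.
  have e1 := hH z _ vz.
  have e2 := hH' z^-1 z'r (vpick (line (phi z))).
  rewrite phipsi ?invr_eq0 // invrK subr0 in e2; have {}e2 := e2 vz.
  (* The behaviour at infinity: the ratio is [z ^+ m] times a function holomorphic in [z^-1]. *)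
  have -> : H z = Q.[z] * z ^+ m * H' z^-1.
    apply: (mulIf vi); rewrite -e1 -[RHS]mulrA -e2 exprVn mulrA mulfK //.
    by rewrite expf_neq0.
  rewrite !nrmM nrmX exprD -mulrA (mulrACA A); apply: ler_pM; rewrite ?nrm_ge0 ?hA //.
    by rewrite mulr_ge0 ?nrm_ge0 ?exprn_ge0 ?nrm_ge0.
  rewrite mulrC; apply: ler_wpM2r; first by rewrite exprn_ge0 ?nrm_ge0.
  have : nrm (H' z^-1 - H' 0) < 1.
    apply: hd; rewrite subr0 nrmV -ltf_pV2 ?posrE ?invr_gt0 ?nrm_gt0 // invrK.
    by rewrite -div1r.
  by have := nrmBr (H' z^-1) (H' 0); lra.
by exists P, Q; split => // z u uz; rewrite hH // hP.
Qed.

End HolomorphicLine.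

(** * Functions rational in each of two variables are rational *)

Section SeparatelyRational.
Variable R : realType.
Implicit Types (r : R) (a b c : C R) (P Q : {poly C R}).

Lemma linear_kernel (K : fieldType) m n (f : {linear 'rV[K]_m -> 'rV[K]_n}) :
  (n < m)%N -> exists2 u, u != 0 & f u = 0.
Proof.
move=> nm; pose M := lin1_mx f.
have : kermx M != 0.
  rewrite -mxrank_eq0 mxrank_ker -lt0n subn_gt0.
  by apply: leq_ltn_trans nm; exact: rank_leq_col.
move=> /rowV0Pn[u /sub_kermxP uM u0]; exists u => //.
by rewrite -uM mul_rV_lin1.
Qed.

Lemma uniq_seq_or_covered (A : set (C R)) :
  (forall m, exists s : seq (C R), [/\ uniq s, size s = m & forall x, x \in s -> A x]) \/
  exists s : seq (C R), forall x, A x -> x \in s.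
Proof.
have [h|h] := pselect (exists s : seq (C R), forall x, A x -> x \in s); [by right|left].
elim=> [|m [s [us ss sA]]]; first by exists [::].
have [x Ax xs] : exists2 x, A x & x \notin s.
  apply: contrapT => h'; apply: h; exists s => x Ax; apply/negPn/negP => xs.
  by apply: h'; exists x.
exists (x :: s); split; rewrite /= ?xs ?ss // => y.
by rewrite inE => /orP[/eqP ->|/sA].
Qed.

(** If each [A e] had finitely many points in the disc, their complements on the real line through
    [c] would be open and dense, and by Baire some point of the disc would be in no [A e]. *)
Lemma disc_pigeonhole c r (A : nat -> set (C R)) : 0 < r ->
  (forall x, disc c r x -> exists e, A e x) ->
  exists e, forall m, exists s : seq (C R),
    [/\ uniq s, size s = m & forall x, x \in s -> disc c r x /\ A e x].
Proof.
move=> r0 cov; apply: contrapT => nh.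
have /choice[s hs] e : exists s : seq (C R), forall x, disc c r x /\ A e x -> x \in s.
  have [h|//] := uniq_seq_or_covered [set x | disc c r x /\ A e x].
  by case: nh; exists e.
pose F e : set R := [set t | c + t%:C \notin s e].
have : dense (\bigcap_e F e).
  apply: Baire => e; split.
    rewrite /F; elim: (s e) => [|x t IH].
      by rewrite (_ : [set _ | _] = setT); [exact: openT|apply/seteqP].
    have -> : [set t0 : R | c + t0%:C \notin x :: t] =
        [set t0 : R | c + t0%:C != x] `&` [set t0 : R | c + t0%:C \notin t].
      by apply/seteqP; split => u /=; rewrite inE negb_or => /andP.
    apply: openI => //; rewrite openE => u /= ux; apply/nbhs_ballP.
    exists (nrm (c + u%:C - x)); first by rewrite /= nrm_gt0 subr_eq0.
    move=> v; rewrite /ball /=; apply: contraTneq => <-.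
    rewrite opprD addrACA subrr add0r -rmorphB nrmR ltxx //.
  move=> O [t Ot] oO; have /nbhs_ballP[d /= d0 hd] : nbhs t O by apply: open_nbhs_nbhs.
  have [e' /andP[e'0 e'd] he] := punctured_point_real (c + t%:C) (s e) d0.
  exists (t + e'); split; last by rewrite /F /= rmorphD /= addrA.
  by apply: hd; rewrite /ball /= opprD addNKr normrN gtr0_norm.
move=> /(_ (ball (0 : R) r)).
have b0 : ball (0 : R) r !=set0 by exists 0; exact: ballxx.
have ob : open (ball (0 : R) r) by exact: ball_open.
move=> /(_ b0 ob) [t [tr tF]].
have cr : disc c r (c + t%:C).
  rewrite /disc /= addrC addKr nrmR; move: tr.
  by rewrite /ball /= sub0r normrN.
have [e Ae] := cov _ cr.
by have /negP := tF e I; apply; apply: hs.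
Qed.

(** [cq * P - cp * Q] has at most [K + e] coefficients and [K + e] zeros, so it is zero; off the
    roots of [Q] the claim follows, and at these roots by continuity. *)
Lemma rational_step (phi : C R -> C R) c r (cp cq P Q : {poly C R}) (s : seq (C R)) K e :
  (size cp <= K)%N -> (size cq <= K)%N -> (size P <= e)%N -> (size Q <= e)%N ->
  Q != 0 -> (forall z, disc c r z -> Q.[z] * phi z = P.[z]) ->
  (forall z, disc c r z -> {for z, continuous phi}) ->
  uniq s -> (K + e <= size s)%N ->
  (forall z, z \in s -> disc c r z /\ cq.[z] * phi z = cp.[z]) ->
  forall z, disc c r z -> cq.[z] * phi z = cp.[z].
Proof.
move=> sp sq sP sQ Q0 hQ cphi us ss hs.
have D0 : cq * P - cp * Q = 0.
  apply: (roots_geq_poly_eq0 (rs := s)) => //.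
    apply/allP => z /hs[zr e1]; rewrite rootE !hornerE -e1 -(hQ z zr).
    by rewrite mulrA mulrAC subrr.
  apply: leq_trans ss; apply: leq_trans (size_polyD _ _) _; rewrite size_polyN geq_max.
  by apply/andP; split; apply: leq_trans (size_polyMleq _ _) _;
    apply: leq_trans (leq_pred _) _; apply: leq_add.
have [rs QE] := closed_field_poly_normal Q.
move=> z /disc_disc[d d0 hd].
have zr : disc c r z by apply: hd; exact: disc_center.
apply: (@eq_off_seq _ rs (fun z => cq.[z] * phi z) (horner cp) z d) => //.
- apply: (continuousM (s := horner cq)); last exact: cphi.
  exact/differentiable_continuous/horner_differentiable.
- exact/differentiable_continuous/horner_differentiable.
move=> w /hd wr wrs; have Qw : Q.[w] != 0.
  by rewrite -rootE QE rootZ ?lead_coef_eq0 // root_prod_XsubC.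
apply: (mulfI Qw); rewrite mulrCA hQ //.
have := congr1 (fun p => p.[w]) D0; rewrite !hornerE => /eqP.
by rewrite subr_eq0 => /eqP ->; rewrite mulrC.
Qed.

(** Degree less than [K] in each variable separately, so that unknown coefficients are easy to count
    and grids detect zero. *)
Definition bipoly K (p : 'M[C R]_K) a b : C R :=
  \sum_(j < K) \sum_(k < K) p j k * a ^+ j * b ^+ k.

Definition bipoly_row K (p : 'M[C R]_K) a : {poly C R} :=
  \sum_(k < K) (\sum_(j < K) p j k * a ^+ j) *: 'X^k.

Lemma horner_bipoly_row K (p : 'M[C R]_K) a b :
  (bipoly_row p a).[b] = bipoly p a b.
Proof.
rewrite /bipoly exchange_big /bipoly_row horner_sum; apply: eq_bigr => k _.
by rewrite !hornerE mulr_suml.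
Qed.

Lemma size_bipoly_row K (p : 'M[C R]_K) a : (size (bipoly_row p a) <= K)%N.
Proof.
apply: leq_trans (size_sum _ _ _) _; apply/bigmax_leqP => k _.
by apply: leq_trans (size_scale_leq _ _) _; rewrite size_polyXn.
Qed.

Lemma bipolyT K (p : 'M[C R]_K) a b : bipoly p^T b a = bipoly p a b.
Proof.
rewrite /bipoly exchange_big; apply: eq_bigr => j _; apply: eq_bigr => k _.
by rewrite mxE mulrAC.
Qed.

Lemma bipolyD K (p q : 'M[C R]_K) a b : bipoly (p + q) a b = bipoly p a b + bipoly q a b.
Proof.
rewrite /bipoly -big_split; apply: eq_bigr => j _; rewrite -big_split.
by apply: eq_bigr => k _; rewrite mxE !mulrDl.
Qed.

Lemma bipolyZ K x (p : 'M[C R]_K) a b : bipoly (x *: p) a b = x * bipoly p a b.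
Proof.
rewrite /bipoly mulr_sumr; apply: eq_bigr => j _; rewrite mulr_sumr.
by apply: eq_bigr => k _; rewrite mxE !mulrA.
Qed.

Lemma coef_bipoly_row K (p : 'M[C R]_K) a (k : 'I_K) :
  (bipoly_row p a)`_k = \sum_(j < K) p j k * a ^+ j.
Proof.
rewrite coef_sum [LHS](bigD1 k) //= [X in _ + X]big1 ?addr0.
  by rewrite coefZ coefXn eqxx mulr1.
move=> i ik; rewrite coefZ coefXn (_ : (k == i :> nat) = false) ?mulr0 //.
by apply/negbTE; rewrite eq_sym.
Qed.

Lemma bipoly_eq0 K (p : 'M[C R]_K) (s t : seq (C R)) :
  uniq s -> uniq t -> (K <= size s)%N -> (K <= size t)%N ->
  (forall a b, a \in s -> b \in t -> bipoly p a b = 0) -> p = 0.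
Proof.
move=> us ut ss st h.
have row0 a : a \in s -> bipoly_row p a = 0.
  move=> sa; apply: (roots_geq_poly_eq0 (rs := t)) => //.
    by apply/allP => b tb; rewrite rootE horner_bipoly_row h.
  exact: leq_trans (size_bipoly_row _ _) st.
apply/matrixP => j k; rewrite mxE.
have c0 : \sum_(j < K) p j k *: 'X^j = 0 :> {poly C R}.
  apply: (roots_geq_poly_eq0 (rs := s)) => //.
    apply/allP => a sa; rewrite rootE horner_sum.
    rewrite (eq_bigr (fun j => p j k * a ^+ j)); last by move=> i _; rewrite !hornerE.
    by rewrite -coef_bipoly_row row0 // coef0.
  apply: leq_trans (size_sum _ _ _) _; apply/bigmax_leqP => i _.
  by apply: leq_trans (size_scale_leq _ _) _; rewrite size_polyXn (leq_trans _ ss).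
have := congr1 (fun q : {poly C R} => q`_j) c0.
rewrite coef0 coef_sum (bigD1 j) //= big1 ?addr0 => [|i ij].
  by rewrite coefZ coefXn eqxx mulr1.
rewrite coefZ coefXn (_ : (j == i :> nat) = false) ?mulr0 //.
by apply/negbTE; rewrite eq_sym.
Qed.

(** There are [2 * (3 * e) ^ 2] unknowns and [(4 * e) ^ 2] equations, and [18 > 16]. Moreover
    [3 * e + e = 4 * e] is the number of nodes that [rational_step] asks for. *)
Lemma interpolation (phi : C R -> C R -> C R) (s t : seq (C R)) e : (0 < e)%N ->
  size s = (4 * e)%N -> size t = (4 * e)%N ->
  exists p q : 'M[C R]_(3 * e), (p != 0 \/ q != 0) /\
    forall a b, a \in s -> b \in t -> bipoly q a b * phi a b = bipoly p a b.
Proof.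
move=> e0 ss st; set K := (3 * e)%N; set m := (4 * e)%N.
pose L (p q : 'M[C R]_K) : 'M[C R]_m := \matrix_(i, j)
  (bipoly q s`_i t`_j * phi s`_i t`_j - bipoly p s`_i t`_j).
pose f (u : 'rV[C R]_(K * K + K * K)) : 'rV[C R]_(m * m) :=
  mxvec (L (vec_mx (lsubmx u)) (vec_mx (rsubmx u))).
have lin : linear f.
  move=> x u v; rewrite /f -linearP; congr mxvec; apply/matrixP => i j.
  by rewrite !mxE !linearP /= !bipolyD !bipolyZ; ring.
pose fL := GRing.isLinear.Build _ _ _ _ _ lin.
pose fl : {linear _ -> _} := HB.pack f fL.
have [|u u0 fu] := linear_kernel fl.
  by rewrite /K /m; nia.
exists (vec_mx (lsubmx u)), (vec_mx (rsubmx u)); split.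
  have [h|] := eqVneq (vec_mx (lsubmx u)) 0; last by left.
  right; apply: contraNneq u0 => h'; rewrite -[u]hsubmxK.
  by rewrite -[lsubmx u]vec_mxK -[rsubmx u]vec_mxK h h' !linear0 row_mx0.
move=> a b sa tb.
have ia : (index a s < m)%N by rewrite /m -ss index_mem.
have jb : (index b t < m)%N by rewrite /m -st index_mem.
have : L (vec_mx (lsubmx u)) (vec_mx (rsubmx u)) = 0.
  by apply: (can_inj mxvecK); rewrite linear0; exact: fu.
move=> /matrixP /(_ (Ordinal ia) (Ordinal jb)); rewrite !mxE /= !nth_index //.
by move=> /eqP; rewrite subr_eq0 => /eqP.
Qed.

(* By Baire, infinitely many slices have a common degree bound; a ratio of
   bivariate polynomials fitted to [phi] on a large grid of such slices agrees
   with [phi] on each of them, and then everywhere. *)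
Lemma separately_rational (phi : C R -> C R -> C R) a0 b0 r : 0 < r ->
  (forall a, disc a0 r a -> exists P Q, Q != 0 /\
    forall b, disc b0 r b -> Q.[b] * phi a b = P.[b]) ->
  (forall b, disc b0 r b -> exists P Q, Q != 0 /\
    forall a, disc a0 r a -> Q.[a] * phi a b = P.[a]) ->
  (forall a b, disc a0 r a -> disc b0 r b -> {for b, continuous (phi a)}) ->
  (forall a b, disc a0 r a -> disc b0 r b -> {for a, continuous (phi^~ b)}) ->
  exists K (p q : 'M[C R]_K),
    (exists a b, [/\ disc a0 r a, disc b0 r b & bipoly q a b != 0]) /\
    forall a b, disc a0 r a -> disc b0 r b -> bipoly q a b * phi a b = bipoly p a b.
Proof.
move=> r0 hA hB cA cB.
pose A e : set (C R) := [set a | exists P Q, [/\ Q != 0, (size P <= e)%N, (size Q <= e)%N &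
    forall b, disc b0 r b -> Q.[b] * phi a b = P.[b]]].
pose B e : set (C R) := [set b | exists P Q, [/\ Q != 0, (size P <= e)%N, (size Q <= e)%N &
    forall a, disc a0 r a -> Q.[a] * phi a b = P.[a]]].
have [eA sA] : exists e, forall m, exists s : seq (C R),
    [/\ uniq s, size s = m & forall x, x \in s -> disc a0 r x /\ A e x].
  apply: disc_pigeonhole => // a /hA[P [Q [Q0 hQ]]].
  by exists (maxn (size P) (size Q)), P, Q; rewrite leq_maxl leq_maxr.
have [eB sB] : exists e, forall m, exists s : seq (C R),
    [/\ uniq s, size s = m & forall x, x \in s -> disc b0 r x /\ B e x].
  apply: disc_pigeonhole => // b /hB[P [Q [Q0 hQ]]].
  by exists (maxn (size P) (size Q)), P, Q; rewrite leq_maxl leq_maxr.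
pose e := (maxn eA eB).+1.
have AA a : A eA a -> A e a.
  move=> [P [Q [Q0 h1 h2 h]]]; exists P, Q; split => //.
    by rewrite (leq_trans h1) // leqW // leq_maxl.
  by rewrite (leq_trans h2) // leqW // leq_maxl.
have BB b : B eB b -> B e b.
  move=> [P [Q [Q0 h1 h2 h]]]; exists P, Q; split => //.
    by rewrite (leq_trans h1) // leqW // leq_maxr.
  by rewrite (leq_trans h2) // leqW // leq_maxr.
have [s [us ss hs]] := sA (4 * e)%N; have [t [ut st ht]] := sB (4 * e)%N.
have [//|p [q [pq hpq]]] := interpolation (e := e) phi _ ss st.
have Ke : (3 * e + e = 4 * e)%N by rewrite -mulSnr.
have rows a : a \in s -> forall b, disc b0 r b -> bipoly q a b * phi a b = bipoly p a b.
  move=> sa b br; have [ar /AA[P [Q [Q0 h1 h2 h]]]] := hs a sa.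
  rewrite -!horner_bipoly_row.
  apply: (rational_step (size_bipoly_row p a) (size_bipoly_row q a) h1 h2 Q0 h _ ut) => //.
  - by move=> z zr; exact: cA.
  - by rewrite Ke st.
  - by move=> z tz; rewrite !horner_bipoly_row hpq //; split => //; have [] := ht z tz.
(* On a column of bounded degree the nodes are its points on the [4 * e] rows where the relation is
   already known. *)
have cols b : disc b0 r b -> B eB b -> forall a, disc a0 r a -> bipoly q a b * phi a b = bipoly p a b.
  move=> br /BB[P [Q [Q0 h1 h2 h]]] a ar.
  rewrite -!(bipolyT _ a) -!horner_bipoly_row.
  apply: (rational_step (phi := phi^~ b) (size_bipoly_row p^T b)
    (size_bipoly_row q^T b) h1 h2 Q0 h _ us) => //.
  - by move=> z zr; exact: cB.
  - by rewrite Ke ss.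
  - move=> z sz; rewrite !horner_bipoly_row !bipolyT rows //; split => //.
    by have [] := hs z sz.
have all a b : disc a0 r a -> disc b0 r b -> bipoly q a b * phi a b = bipoly p a b.
  move=> ar br; have [P [Q [Q0 h]]] := hA a ar.
  (* The degrees on the row of [a] are arbitrary, but as many columns of bounded degree as needed
     are available as nodes. *)
  have [t' [ut' st' ht']] := sB (3 * e + maxn (size P) (size Q))%N.
  rewrite -!horner_bipoly_row.
  apply: (rational_step (size_bipoly_row p a) (size_bipoly_row q a)
     (leq_maxl _ _) (leq_maxr _ _) Q0 h _ ut') => //.
  - by move=> z zr; exact: cA.
  - by rewrite st'.
  - by move=> z /ht'[zr Bz]; rewrite !horner_bipoly_row; split => //; exact: cols.
exists (3 * e)%N, p, q; split => //.
(* If [q] vanished on the discs, so would [p] on the grid, and both matrices would be zero. *)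
apply: contrapT => nq.
have q0 a b : disc a0 r a -> disc b0 r b -> bipoly q a b = 0.
  by move=> ar br; apply/eqP/negPn/negP => h; apply: nq; exists a, b.
have s3 : (3 * e <= size s)%N by rewrite ss leq_mul2r orbT.
have t3 : (3 * e <= size t)%N by rewrite st leq_mul2r orbT.
have [] : q = 0 /\ p = 0.
  split; apply: (bipoly_eq0 us ut s3 t3) => a b /hs[ar _] /ht[br _]; first exact: q0.
  by rewrite -all // q0 // mul0r.
by move=> q00 p00; case: pq; rewrite ?q00 ?p00 eqxx.
Qed.

End SeparatelyRational.

(** * Maps between projective spaces and continuation of rational relations *)

Section ProjectiveMaps.
Variables (R : realType) (m n : nat).
Local Notation V := 'rV[C R]_m.+1.
Implicit Types (v w d : V) (O : set (proj_point R m)) (phi : proj_point R m -> proj_point R n).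

Lemma delta_neq0 : delta_mx 0 0 != 0 :> V.
Proof.
apply/eqP => /rowP /(_ 0); rewrite !mxE !eqxx => /eqP.
by rewrite oner_eq0.
Qed.

Definition point_of v : proj_point R m :=
  match @idP (v != 0) with ReflectT h => pt h | ReflectF _ => pt delta_neq0 end.

Lemma point_of_mem v : v != 0 -> v \in line (point_of v).
Proof. by rewrite /point_of; case: {-}_ / idP => // h _; exact: pt_mem. Qed.

Lemma point_ofE v (l : proj_point R m) : v != 0 -> v \in line l -> l = point_of v.
Proof. by move=> v0 vl; exact: (line_inj_in v0 vl (point_of_mem v0)). Qed.

Lemma point_ofZ (a : C R) v : a != 0 -> v != 0 -> point_of (a *: v) = point_of v.
Proof.
move=> a0 v0; symmetry; apply: point_ofE; first by rewrite scaler_eq0 negb_or a0.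
by rewrite memvZ // point_of_mem.
Qed.

Lemma coneE O v : cone O v <-> v != 0 /\ O (point_of v).
Proof.
split=> [[v0 [l Ol vl]]|[v0 Ov]]; split => //; first by rewrite -(point_ofE v0 vl).
by exists (point_of v) => //; exact: point_of_mem.
Qed.

(** [phi] is total but only its values on [O] count; the clause [cone O w] makes the cone of [O] a
    neighbourhood of each of its points. *)
Definition holomorphic_proj O phi := forall v, cone O v ->
  exists g : V -> 'rV[C R]_n.+1, \forall w \near v,
    [/\ forall i, differentiable (fun x => g x 0 i) w, g w != 0, cone O w &
      g w \in line (phi (point_of w))].

Lemma affine_differentiable v d (t : C R) : differentiable (fun t : C R => v + t *: d) t.
Proof.
by apply: differentiableD; [exact: differentiable_cst|exact: differentiableZl].
Qed.

Lemma near_comp (U U' : normedModType (C R)) (f : U -> U') x (P : U' -> Prop) :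
  {for x, continuous f} -> (\forall y \near f x, P y) -> \forall y \near x, P (f y).
Proof. by move=> cf; exact: cf. Qed.

Lemma lift_affine O phi v d t : holomorphic_proj O phi -> cone O (v + t *: d) ->
  local_lift (fun t => phi (point_of (v + t *: d))) t.
Proof.
move=> hphi Ov; have [g hg] := hphi _ Ov.
have ca := differentiable_continuous (affine_differentiable v d t).
have /nbhs_nrm[r r0 hr] := near_comp ca hg.
exists r, (fun z => g (v + z *: d)); split => // z /hr[dg g0 _ gl]; split => // i.
exact: (@differentiable_comp _ _ _ _ (fun z : C R => v + z *: d) (fun x => g x 0 i)).
Qed.

(* Near [v], the ratio of the homogeneous coordinates [i] and [i0] of [phi] is
   [p i / q i]. *)
Definition satisfies (p q : 'I_n.+1 -> V -> C R) (i0 : 'I_n.+1) phi v :=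
  \forall w \near v, w != 0 ->
    forall u, u \in line (phi (point_of w)) -> forall i, q i w * u 0 i = p i w * u 0 i0.

(** [e] is chosen before [p], [q] and [i0], which makes [satisfies] open and closed. The [k i]
    vanish near [v'] and, by the identity theorem on the complex line from [v'] to [x], at [x]. *)
Lemma satisfies_propagate O phi v : holomorphic_proj O phi -> cone O v ->
  exists2 e : R, 0 < e & forall p q i0,
    (forall i w, differentiable (p i) w) -> (forall i w, differentiable (q i) w) ->
    forall v' v'', nrm (v' - v) < e -> nrm (v'' - v) < e ->
    satisfies p q i0 phi v' -> satisfies p q i0 phi v''.
Proof.
move=> hphi Ov; have [g /nbhs_nrm[r r0 hg]] := hphi v Ov.
exists (r / 30); first by rewrite divr_gt0.
move=> p q i0 dp dq v' v'' hv' hv'' sat.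
pose k i w := q i w * g w 0 i - p i w * g w 0 i0.
have dk i w : nrm (w - v) < r -> differentiable (k i) w.
  move=> /hg[dg _ _ _]; apply: differentiableB; apply: differentiableM => //; exact: dg.
have k0 i x : nrm (x - v) < r / 30 -> k i x = 0.
  move=> xr; pose h (t : C R) := k i (v' + t *: (x - v')).
  have -> : k i x = h 1 by rewrite /h scale1r addrC subrK.
  have xv' : nrm (x - v') < r / 15.
    have -> : x - v' = (x - v) + - (v' - v) by rewrite opprB addrA subrK.
    by apply: le_lt_trans (nrmD _ _) _; rewrite nrmN; lra.
  have inr t : disc 0 12 t -> nrm (v' + t *: (x - v') - v) < r.
    rewrite /disc /= subr0 addrAC => t12; apply: le_lt_trans (nrmD _ _) _.
    rewrite nrmZ; have := nrm_ge0 t; have := nrm_ge0 (x - v').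
    move: (nrm t) (nrm (x - v')) t12 xv' => a b; nra.
  (* [12 / 11] exceeds [1], the parameter of [x], and [12 * (r / 15) + r / 30 < r] keeps the line in
     the domain of [g]. *)
  apply: (@identity_disc R h 0 12 (ltr0n _ 12)).
  - move=> t /inr tr; apply: (@differentiable_comp _ _ _ _ (fun t : C R => v' + t *: (x - v')) (k i)).
      exact: affine_differentiable.
    exact: dk.
  - have ca := differentiable_continuous (affine_differentiable v' (x - v') 0).
    have : \forall y \near (v' + 0 *: (x - v')), nrm (y - v) < r ->  k i y = 0.
      rewrite scale0r addr0; apply: filterS sat => y sy yr.
      have [_ g0 /coneE[y0 _] gl] := hg y yr.
      by apply/eqP; rewrite subr_eq0; apply/eqP; exact: sy.
    move=> /(near_comp ca) /nbhs_nrm[d d0 hd].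
    exists (Num.min d 12); first by rewrite lt_min d0 ltr0n.
    move=> t; rewrite /disc /= lt_min => /andP[td t12]; apply: hd => //.
    exact: inr.
  - rewrite /disc /= subr0 nrm1; lra.
apply/nbhs_nrm; exists (r / 30 - nrm (v'' - v)); first by rewrite subr_gt0.
move=> w wv w0 u uw i.
have wr : nrm (w - v) < r / 30.
  have -> : w - v = (w - v'') + (v'' - v) by rewrite addrA subrK.
  by apply: le_lt_trans (nrmD _ _) _; rewrite -ltrBrDr.
have [|_ g0 _ gl] := hg w; first by apply: lt_trans wr _; lra.
have [a ->] := mem_line_colinear g0 gl uw.
have /eqP := k0 i w wr; rewrite /k subr_eq0 !mxE => /eqP e.
by rewrite mulrCA e mulrCA.
Qed.

Lemma satisfiesZ (p q : 'I_n.+1 -> V -> C R) i0 phi v (a : C R) :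
  (forall i, exists k, forall (b : C R) w, p i (b *: w) = b ^+ k * p i w /\
     q i (b *: w) = b ^+ k * q i w) ->
  a != 0 -> satisfies p q i0 phi v -> satisfies p q i0 phi (a *: v).
Proof.
move=> hom a0 sat; have av : a^-1 *: (a *: v) = v by rewrite scalerA mulVf // scale1r.
have : {for a *: v, continuous (fun w => a^-1 *: w)} by exact: scaler_continuous.
move=> /near_comp; rewrite av => /(_ _ sat); apply: filterS => w hw w0 u uw i.
have aw0 : a^-1 *: w != 0 by rewrite scaler_eq0 negb_or invr_eq0 a0.
have := hw aw0 u; rewrite point_ofZ ?invr_eq0 // => /(_ uw i).
have [k hk] := hom i; have [-> ->] := hk a^-1 w; rewrite -!mulrA.
by apply: mulfI; rewrite expf_neq0 // invr_eq0.
Qed.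

End ProjectiveMaps.

(** * Lines close to a line contained in an open set *)

Section NearbyLines.
Variables (R : realType) (m : nat).
Local Notation V := 'rV[C R]_m.+1.
Implicit Types (O : set (proj_point R m)).

Lemma nrm_pair (U U' : normedModType (C R)) (x : U) (y : U') (d : R) :
  nrm x < d -> nrm y < d -> nrm (x, y) < d.
Proof.
move=> xd yd; rewrite -ltcR -nrmE prod_normE /= !nrmE.
by rewrite /Order.max; case: ifP => _; rewrite ltcR.
Qed.

Lemma tube O (G : C R * C R -> V) c (s : R) : 0 < s -> open O ->
  (forall x, differentiable G x) -> (forall w, cone O (G (w, 0))) ->
  exists2 d : R, 0 < d & forall e, nrm e < d -> forall w, square c s w -> cone O (G (w, e)).
Proof.
move=> s0; rewrite proj_openE => oO dG hG.
apply: (@square_ind R (fun c s => exists2 d : R, 0 < d & forall e, nrm e < d ->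
  forall w, square c s w -> cone O (G (w, e)))) => //.
  move=> c' s' _ [d1 d10 h1] [d2 d20 h2] [d3 d30 h3] [d4 d40 h4].
  exists (Num.min (Num.min d1 d2) (Num.min d3 d4)); first by rewrite !lt_min d10 d20 d30.
  move=> e; rewrite !lt_min => /andP[/andP[e1 e2] /andP[e3 e4]] w.
  move=> /square_split[a [b [[->|->] [->|->] hz]]]; [|exact: h3|exact: h2|exact: h4].
  by move: hz; rewrite (_ : (0 +i* 0) = 0 :> C R) // addr0; exact: h1.
move=> z _; have nz : nbhs (G (z, 0)) (cone O).
  by apply: open_nbhs_nbhs; split => //; exact: hG.
have /nbhs_nrm[d d0 hd] := near_comp (differentiable_continuous (dG (z, 0))) nz.
exists (d / 2); first by rewrite divr_gt0.
move=> c' s' /andP[s'0 s'd] zs _; exists d => // e ed w ws; apply: hd.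
apply: nrm_pair; last by rewrite /= subr0.
by apply: le_lt_trans (square_nrm ws zs) _; lra.
Qed.

(** Two closed unit discs, in the parameters [w / u] and [u / w], cover the projective line; [tube]
    applies to the corresponding affine families [G1] and [G2]. *)
Lemma nearby_lines O (a0 a1 a2 : V) : open O ->
  (forall u w : C R, (u != 0) || (w != 0) -> cone O (u *: a1 + w *: a2)) ->
  exists2 d : R, 0 < d & forall e : C R, nrm e < d -> forall u w : C R, (u != 0) || (w != 0) ->
    cone O (u *: a1 + w *: a2 + (e * u) *: a0).
Proof.
move=> oO hO.
have dfst x : differentiable (fst : C R * C R -> C R) x
  by apply: linear_differentiable => ?; exact: cvg_fst.
have dsnd x : differentiable (snd : C R * C R -> C R) x
  by apply: linear_differentiable => ?; exact: cvg_snd.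
pose sq (w : C R) := square (- 1 +i* - 1) 2 w.
have insq z : nrm z <= 1 -> sq z.
  move=> z1; have := le_trans (Re_le z) z1; have := le_trans (Im_le z) z1.
  by rewrite /sq /square /= !ler_norml; lra.
pose G1 (x : C R * C R) := a1 + x.1 *: a2 + x.2 *: a0.
pose G2 (x : C R * C R) := x.1 *: a1 + a2 + (x.2 * x.1) *: a0.
have [x|w|d1 d10 h1] := @tube O G1 (- 1 +i* - 1) 2 (ltr0n _ 2) oO.
- apply: differentiableD; last exact: differentiableZl.
  by apply: differentiableD; [exact: differentiable_cst|exact: differentiableZl].
- by have := hO 1 w; rewrite /G1 /= scale0r addr0 scale1r oner_eq0 => /(_ isT).
have [x|w|d2 d20 h2] := @tube O G2 (- 1 +i* - 1) 2 (ltr0n _ 2) oO.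
- apply: differentiableD; last by apply: differentiableZl; exact: differentiableM.
  by apply: differentiableD; [exact: differentiableZl|exact: differentiable_cst].
- by have := hO w 1; rewrite /G2 /= mul0r scale0r addr0 scale1r oner_eq0 orbT => /(_ isT).
have coneZ a v : a != 0 -> cone O v -> cone O (a *: v).
  move=> an /coneE[v0 Ov]; apply/coneE; split; first by rewrite scaler_eq0 negb_or an.
  by rewrite point_ofZ.
exists (Num.min d1 d2); first by rewrite lt_min d10.
move=> e; rewrite lt_min => /andP[e1 e2] u w uw.
have [wu|uw'] := leP (nrm w) (nrm u).
  have u0 : u != 0.
    rewrite -nrm_gt0 lt_def nrm_ge0 andbT; apply: contraTneq uw => u0.
    by move: wu; rewrite u0 -nrm_eq0 u0 eqxx /= -nrm_gt0 -leNgt.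
  have -> : u *: a1 + w *: a2 + (e * u) *: a0 = u *: G1 (u^-1 * w, e).
    by rewrite /G1 /= !scalerDr !scalerA mulVKf // (mulrC e).
  apply/coneZ/h1/insq => //.
  by rewrite nrmM nrmV ler_pdivrMl ?nrm_gt0 // mulr1.
have w0 : w != 0 by rewrite -nrm_gt0; apply: le_lt_trans uw'; exact: nrm_ge0.
have -> : u *: a1 + w *: a2 + (e * u) *: a0 = w *: G2 (w^-1 * u, e).
  by rewrite /G2 /= !scalerDr !scalerA mulVKf // mulrCA mulVKf // .
apply/coneZ/h2/insq => //.
by rewrite nrmM nrmV ler_pdivrMl ?nrm_gt0 // mulr1 ltW.
Qed.

End NearbyLines.

(** * From the lines of two pencils to homogeneous relations *)

Section RationalRelation.
Variables (R : realType) (n : nat).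
Local Notation V := 'rV[C R]_3.

Definition dual_coordinates (a0 a1 a2 : V) (c0 c1 c2 : V -> C R) :=
  [/\ forall v, [/\ differentiable c0 v, differentiable c1 v & differentiable c2 v],
      forall (x : C R) v, [/\ c0 (x *: v) = x * c0 v, c1 (x *: v) = x * c1 v &
        c2 (x *: v) = x * c2 v],
      forall v, v = c0 v *: a0 + c1 v *: a1 + c2 v *: a2 &
      forall s t y, [/\ c0 (s *: a0 + t *: a1 + y *: a2) = s,
        c1 (s *: a0 + t *: a1 + y *: a2) = t & c2 (s *: a0 + t *: a1 + y *: a2) = y]].

Lemma dual_coordinates_exist (a0 a1 a2 : V) :
  (forall s t y : C R, s *: a0 + t *: a1 + y *: a2 = 0 -> [/\ s = 0, t = 0 & y = 0]) ->
  exists c0 c1 c2, dual_coordinates a0 a1 a2 c0 c1 c2.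
Proof.
move=> free; pose B : 'M[C R]_3 := \matrix_(i < 3) nth 0 [:: a0; a1; a2] i.
have mulB (x : V) : x *m B = x 0 0 *: a0 + x 0 1 *: a1 + x 0 2 *: a2.
  rewrite mulmx_sum_row big_ord_recl big_ord_recl big_ord_recl big_ord0 !rowK /=.
  rewrite addr0 addrA.
  have -> : lift ord0 (lift ord0 ord0) = 2 :> 'I_3 by exact: val_inj.
  by have -> : lift ord0 ord0 = 1 :> 'I_3 by exact: val_inj.
have uB : B \in unitmx.
  rewrite -row_free_unit; apply: inj_row_free => x; rewrite mulB => /free[h0 h1 h2].
  apply/rowP => -[[|[|[|//]]] h]; rewrite mxE.
  - by rewrite -[RHS]h0 (_ : Ordinal h = 0) //; exact: val_inj.
  - by rewrite -[RHS]h1 (_ : Ordinal h = 1) //; exact: val_inj.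
  - by rewrite -[RHS]h2 (_ : Ordinal h = 2) //; exact: val_inj.
pose c (k : 'I_3) (v : V) : C R := (v *m invmx B) 0 k.
have dc k v : differentiable (c k) v.
  rewrite (_ : c k = \sum_(j < 3) (fun v : V => v 0 j * invmx B j k)).
    apply: differentiable_sum => j; apply: differentiableM; last exact: differentiable_cst.
    exact: differentiable_coord.
  by apply/funext => w; rewrite /c mxE fct_sumE.
exists (c 0), (c 1), (c 2); split.
- by move=> v; split; exact: dc.
- by move=> x v; rewrite /c -scalemxAl !mxE.
- by move=> v; rewrite -[in LHS](mulmxKV uB v) mulB.
- move=> s t y; pose x : V := \row_(i < 3) nth 0 [:: s; t; y] i.
  have -> : s *: a0 + t *: a1 + y *: a2 = x *m B by rewrite mulB !mxE.
  by rewrite /c mulmxK // !mxE.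
Qed.

Variables (a0 a1 a2 : V) (c0 c1 c2 : V -> C R).
Hypothesis coords : dual_coordinates a0 a1 a2 c0 c1 c2.

(** [bipoly p (c0 / c1) (c0 / c2)] with denominators cleared by [c1 ^+ K * c2 ^+ K]: a form of
    degree [2 * K], defined also where [c1] or [c2] vanishes. *)
Definition homogenized K (p : 'M[C R]_K) (v : V) : C R :=
  \sum_(j < K) \sum_(k < K)
     p j k * (c0 v ^+ (j + k) * c1 v ^+ (K - j) * c2 v ^+ (K - k)).

Lemma homogenizedE K (p : 'M[C R]_K) v : c1 v != 0 -> c2 v != 0 ->
  homogenized p v = c1 v ^+ K * c2 v ^+ K * bipoly p (c0 v / c1 v) (c0 v / c2 v).
Proof.
move=> v1 v2; rewrite /bipoly mulr_sumr; apply: eq_bigr => j _.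
rewrite mulr_sumr; apply: eq_bigr => k _.
have -> : c1 v ^+ K = c1 v ^+ (K - j) * c1 v ^+ j by rewrite -exprD subnK // ltnW.
have -> : c2 v ^+ K = c2 v ^+ (K - k) * c2 v ^+ k by rewrite -exprD subnK // ltnW.
rewrite !expr_div_n exprD; field.
by rewrite !expf_neq0.
Qed.

Lemma homogenizedZ K (p : 'M[C R]_K) (x : C R) v :
  homogenized p (x *: v) = x ^+ (K + K) * homogenized p v.
Proof.
have [_ lin _ _] := coords; have [h0 h1 h2] := lin x v.
rewrite /homogenized mulr_sumr; apply: eq_bigr => j _.
rewrite mulr_sumr; apply: eq_bigr => k _; rewrite h0 h1 h2 !exprMn.
have -> : x ^+ (K + K) = x ^+ (j + k) * x ^+ (K - j) * x ^+ (K - k).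
  by rewrite -!exprD; congr (_ ^+ _); have := ltn_ord j; have := ltn_ord k; lia.
ring.
Qed.

Lemma exp_diff (f : V -> C R) k v : differentiable f v ->
  differentiable (fun w => f w ^+ k) v.
Proof.
move=> df; elim: k => [|k IH]; first exact: differentiable_cst.
rewrite (_ : (fun w => f w ^+ k.+1) = f * (fun w => f w ^+ k)).
  exact: differentiableM.
by apply/funext => w; rewrite exprS.
Qed.

Lemma homogenized_diff K (p : 'M[C R]_K) v : differentiable (homogenized p) v.
Proof.
have [dc _ _ _] := coords; have [d0 d1 d2] := dc v.
rewrite (_ : homogenized p = \sum_(j < K) (\sum_(k < K) (fun v : V =>
   p j k * (c0 v ^+ (j + k) * c1 v ^+ (K - j) * c2 v ^+ (K - k))))).
  apply: differentiable_sum => j; apply: differentiable_sum => k.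
  apply: differentiableM; first exact: differentiable_cst.
  by apply: differentiableM; [apply: differentiableM|]; exact: exp_diff.
by apply/funext => w; rewrite fct_sumE; apply: eq_bigr => j _; rewrite fct_sumE.
Qed.

(** In the coordinates [a = c0 / c1] and [b = c0 / c2], the lines through [a2] and through [a1] are
    the slices with [a] constant and with [b] constant. For small parameters the whole line lies in
    [O], so the ratio of coordinates is rational on each slice. *)
Lemma rational_relation O (phi : proj_point R 2 -> proj_point R n) :
  open O -> holomorphic_proj O phi ->
  (forall u w : C R, (u != 0) || (w != 0) -> cone O (u *: a1 + w *: a2)) ->
  exists (p q : 'I_n.+1 -> V -> C R) i0, [/\
    forall i v, differentiable (p i) v /\ differentiable (q i) v,
    forall i, exists k, forall (b : C R) w, p i (b *: w) = b ^+ k * p i w /\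
     q i (b *: w) = b ^+ k * q i w,
    forall i, exists v, q i v != 0 &
    satisfies p q i0 phi (a1 + a2)].
Proof.
move=> oO hphi hO; have [dc lin cE cK] := coords.
pose u0 := a1 + a2; have u0O : cone O u0.
  by have := hO 1 1; rewrite !scale1r oner_eq0; exact.
have [g hg] := hphi u0 u0O.
have [i0 gi0] : exists i0, g u0 0 i0 != 0.
  have [_ g0 _ _] := nbhs_singleton hg.
  apply: contrapT => h; case/eqP: g0; apply/rowP => j; rewrite mxE; apply/eqP.
  by apply/negPn/negP => gj; apply: h; exists j.
have [r1 r10 hr1] : exists2 r1 : R, 0 < r1 & forall x, nrm (x - u0) < r1 ->
    [/\ forall i, differentiable (fun x => g x 0 i) x, g x 0 i0 != 0,
      cone O x & g x \in line (phi (point_of x))].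
  have [dg _ _ _] := nbhs_singleton hg.
  have ng : \forall y \near g u0 0 i0, y != 0.
    by apply: open_nbhs_nbhs; split => //; exact: open_neq0C.
  have := near_comp (differentiable_continuous (dg i0)) ng.
  move=> /(filterI hg) /nbhs_nrm[r r0 hr]; exists r; first exact: r0.
  by move=> x /hr[[h1 _ h2 h3] h4]; split; [exact: h1|exact: h4|exact: h2|exact: h3].
have [e e0 prop] := satisfies_propagate hphi u0O.
have [d1 d10 lines1] := nearby_lines a0 oO hO.
have [d2 d20 lines2] : exists2 d : R, 0 < d & forall e : C R, nrm e < d ->
    forall u w : C R, (u != 0) || (w != 0) ->
    cone O (u *: a2 + w *: a1 + (e * u) *: a0).
  by apply: nearby_lines => // u w uw; rewrite addrC; apply: hO; rewrite orbC.
pose N0 := nrm a0 + 1; pose N1 := nrm a1 + 1.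
have N00 : 0 < N0 by rewrite ltr_wpDl ?nrm_ge0.
have N10 : 0 < N1 by rewrite ltr_wpDl ?nrm_ge0.
(* [k] bounds how far [a] and [b] stray from [t], relative to [t]: [b / a] differs from [1] by at
   most [4 * k], and [k <= 1 / 2] keeps [a] away from [0]. *)
have [k [k0 k2 kr]] : exists k : R, [/\ 0 < k, k <= 1 / 2 & 8 * k * N1 <= r1].
  exists (Num.min (1 / 2) (r1 / (8 * N1))); split.
  - by rewrite lt_min !divr_gt0 // mulr_gt0.
  - by rewrite ge_min lexx.
  - rewrite (mulrC 8) -mulrA -ler_pdivlMr ?mulr_gt0 //.
    by rewrite ge_min lexx orbT.
(* The parameters are centred at [t], off [0], where both slices would be the given line; [t] is
   small so that the slices lie in [O] and [x a b] stays near [u0]. *)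
have [t [t0 [td1 td2 te tr]]] : exists t : R, 0 < t /\
    [/\ 4 * t <= d1, 4 * t <= d2, 4 * t * N0 <= e & 4 * t * N0 <= r1].
  pose M := Num.min (Num.min d1 d2) (Num.min e r1).
  have M0 : 0 < M by rewrite !lt_min d10 d20 e0.
  have [[m1 m2] [m3 m4]] : (M <= d1 /\ M <= d2) /\ (M <= e /\ M <= r1).
    by rewrite !ge_min !lexx !orbT.
  exists (M / (4 * N0)); split; first by rewrite divr_gt0 // mulr_gt0.
  have h1 : 4 * (M / (4 * N0)) * N0 = M by field; rewrite gt_eqF.
  have h2 : 4 * (M / (4 * N0)) <= M.
    rewrite -{2}h1; apply: ler_peMr; last by rewrite lerDr nrm_ge0.
    by rewrite mulr_ge0 // divr_ge0 ?mulr_ge0 // ltW.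
  by rewrite !h1; split => //; apply: le_trans h2 _.
pose A := disc (t%:C : C R) (k * t).
have kt0 : 0 < k * t by rewrite mulr_gt0.
have tC : nrm (t%:C : C R) = t by rewrite nrmR gtr0_norm.
have Ab x : A x -> t / 2 <= nrm x /\ nrm x <= 3 / 2 * t.
  rewrite /A /disc /= => xt; have := nrmBr (t%:C : C R) x; have := nrmBr x (t%:C : C R).
  rewrite (nrmB (t%:C : C R) x) tC; have : k * t <= 1 / 2 * t by rewrite ler_pM2r.
  by move=> h1 h2 h3; split; lra.
have A0 x : A x -> x != 0 by move=> /Ab[h _]; rewrite -nrm_gt0; lra.
have Ad1 x : A x -> nrm x < d1 by move=> /Ab[_ h]; lra.
have Ad2 x : A x -> nrm x < d2 by move=> /Ab[_ h]; lra.
(* The point with [c0 / c1 = a] and [c0 / c2 = b], normalized by [c2 = 1]. *)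
pose x (a b : C R) : V := b *: a0 + (b / a) *: a1 + a2.
have xr a b : A a -> A b -> nrm (x a b - u0) < r1.
  move=> Aa Ab'; have [h1 h2] := Ab a Aa; have [h3 h4] := Ab b Ab'.
  have -> : x a b - u0 = b *: a0 + ((b - a) / a) *: a1.
    by apply/rowP => j; rewrite !mxE; field; exact: A0.
  apply: le_lt_trans (nrmD _ _) _; rewrite !nrmZ ?nrmM nrmV.
  have h5 : nrm (b - a) < 2 * (k * t).
    have -> : b - a = (b - t%:C) + - (a - t%:C) by rewrite opprB addrA subrK.
    by apply: le_lt_trans (nrmD _ _) _; rewrite nrmN; move: Aa Ab'; rewrite /A /disc /=; lra.
  have h6 : nrm (b - a) / nrm a <= 4 * k.
    rewrite ler_pdivrMr; last by lra.
    have : 4 * k * (t / 2) <= 4 * k * nrm a by rewrite ler_wpM2l // mulr_ge0 // ltW.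
    lra.
  have h7 : nrm b * nrm a0 <= 3 / 2 * t * N0.
    by apply: ler_pM; rewrite ?nrm_ge0 // lerDl.
  have h8 : nrm (b - a) / nrm a * nrm a1 <= 4 * k * N1.
    by apply: ler_pM; rewrite ?nrm_ge0 ?divr_ge0 ?nrm_ge0 // lerDl.
  have h9 : 0 < t * N0 by rewrite mulr_gt0.
  lra.
pose f i a b := g (x a b) 0 i / g (x a b) 0 i0.
have rowE (a z : C R) : A a -> a *: a2 + z *: (a *: a0 + a1) = a *: x a z.
  by move=> /A0 an; apply/rowP => j; rewrite !mxE; field.
have colE (b z : C R) : A z -> b *: a1 + z *: (b *: a0 + a2) = z *: x z b.
  by move=> /A0 an; apply/rowP => j; rewrite !mxE; field.
have rows i a : A a -> exists P Q : {poly C R}, Q != 0 /\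
    forall b, A b -> Q.[b] * f i a b = P.[b].
  move=> Aa; have an := A0 a Aa.
  have [||s s0||P [Q [Q0 hPQ]]] := @holomorphic_line_rational R n
     (fun z => phi (point_of (a *: a2 + z *: (a *: a0 + a1))))
     (fun s => phi (point_of (a *: a0 + a1 + s *: (a *: a2)))) i0 i t%:C.
  - move=> y; apply: (lift_affine hphi).
    have := lines1 a (Ad1 a Aa) y a; rewrite an orbT => /(_ isT).
    by congr (cone O _); apply/rowP => j; rewrite !mxE; ring.
  - apply: (lift_affine hphi).
    have := lines1 a (Ad1 a Aa) 1 0; rewrite oner_eq0 => /(_ isT).
    by congr (cone O _); apply/rowP => j; rewrite !mxE; ring.
  - have -> : a *: a2 + s^-1 *: (a *: a0 + a1) = s^-1 *: (a *: a0 + a1 + s *: (a *: a2)).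
      by apply/rowP => j; rewrite !mxE; field.
    rewrite point_ofZ ?invr_eq0 //.
    have := lines1 a (Ad1 a Aa) 1 (s * a); rewrite oner_eq0 => /(_ isT) /coneE[h _].
    by move: h; congr (_ != 0); apply/rowP => j; rewrite !mxE; ring.
  - have At : A t%:C by exact: disc_center.
    have [_ gx /coneE[x0 _] gl] := hr1 _ (xr a _ Aa At).
    by exists (g (x a t%:C)); rewrite ?rowE // point_ofZ.
  exists P, Q; split => // b Ab'.
  have [_ gx /coneE[x0 _] gl] := hr1 _ (xr a b Aa Ab').
  have := hPQ b (g (x a b)); rewrite rowE // point_ofZ // => /(_ gl) e1.
  by rewrite /f mulrA e1 mulfK.
have cols i b : A b -> exists P Q : {poly C R}, Q != 0 /\
    forall a, A a -> Q.[a] * f i a b = P.[a].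
  move=> Ab'; have bn := A0 b Ab'.
  have [||s s0||P [Q [Q0 hPQ]]] := @holomorphic_line_rational R n
     (fun z => phi (point_of (b *: a1 + z *: (b *: a0 + a2))))
     (fun s => phi (point_of (b *: a0 + a2 + s *: (b *: a1)))) i0 i t%:C.
  - move=> y; apply: (lift_affine hphi).
    have := lines2 b (Ad2 b Ab') y b; rewrite bn orbT => /(_ isT).
    by congr (cone O _); apply/rowP => j; rewrite !mxE; ring.
  - apply: (lift_affine hphi).
    have := lines2 b (Ad2 b Ab') 1 0; rewrite oner_eq0 => /(_ isT).
    by congr (cone O _); apply/rowP => j; rewrite !mxE; ring.
  - have -> : b *: a1 + s^-1 *: (b *: a0 + a2) = s^-1 *: (b *: a0 + a2 + s *: (b *: a1)).
      by apply/rowP => j; rewrite !mxE; field.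
    rewrite point_ofZ ?invr_eq0 //.
    have := lines2 b (Ad2 b Ab') 1 (s * b); rewrite oner_eq0 => /(_ isT) /coneE[h _].
    by move: h; congr (_ != 0); apply/rowP => j; rewrite !mxE; ring.
  - have At : A t%:C by exact: disc_center.
    have [_ gx /coneE[x0 _] gl] := hr1 _ (xr _ b At Ab').
    by exists (g (x t%:C b)); rewrite ?colE // point_ofZ // A0.
  exists P, Q; split => // a Aa; have an := A0 a Aa.
  have [_ gx /coneE[x0 _] gl] := hr1 _ (xr a b Aa Ab').
  have := hPQ a (g (x a b)); rewrite colE // point_ofZ // => /(_ gl) e1.
  by rewrite /f mulrA e1 mulfK.
have crow i a b : A a -> A b -> {for b, continuous (f i a)}.
  move=> Aa Ab'; have [dg gx _ _] := hr1 _ (xr a b Aa Ab').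
  have dx : differentiable (x a) b.
    apply: differentiableD; last exact: differentiable_cst.
    apply: differentiableD; first exact: differentiableZl.
    by apply: differentiableZl; apply: differentiableM => //; exact: differentiable_cst.
  apply: differentiable_continuous.
  have dgx j : differentiable (fun b => g (x a b) 0 j) b.
    exact: (@differentiable_comp _ _ _ _ (x a) (fun x => g x 0 j)).
  by apply: differentiableM; [exact: dgx|apply: differentiableV; [exact: dgx|]].
have ccol i a b : A a -> A b -> {for a, continuous ((f i)^~ b)}.
  move=> Aa Ab'; have [dg gx _ _] := hr1 _ (xr a b Aa Ab').
  have dx : differentiable (x^~ b) a.
    apply: differentiableD; last exact: differentiable_cst.
    apply: differentiableD; first exact: differentiable_cst.
    apply: differentiableZl; apply: differentiableM; first exact: differentiable_cst.
    by apply: differentiableV => //; exact: A0.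
  apply: differentiable_continuous.
  have dgx j : differentiable (fun a => g (x a b) 0 j) a.
    exact: (@differentiable_comp _ _ _ _ (x^~ b) (fun x => g x 0 j)).
  by apply: differentiableM; [exact: dgx|apply: differentiableV; [exact: dgx|]].
have rat i : exists X : {K : nat & ('M[C R]_K * 'M[C R]_K)%type},
    (exists a b, [/\ A a, A b & bipoly (projT2 X).2 a b != 0]) /\
    forall a b, A a -> A b -> bipoly (projT2 X).2 a b * f i a b = bipoly (projT2 X).1 a b.
  have [K [p [q hpq]]] := separately_rational kt0 (rows i) (cols i) (crow i) (ccol i).
  by exists (existT _ K (p, q)).
have {rat} /choice[X hX] := rat.
pose p i := homogenized (projT2 (X i)).1; pose q i := homogenized (projT2 (X i)).2.
have dp i v : differentiable (p i) v by exact: homogenized_diff.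
have dq i v : differentiable (q i) v by exact: homogenized_diff.
exists p, q, i0; split => //.
- move=> i; exists (projT1 (X i) + projT1 (X i))%N => b w.
  by split; exact: homogenizedZ.
- move=> i; have [[a [b [Aa Ab' qab]]] _] := hX i.
  have an := A0 a Aa; have bn := A0 b Ab'.
  exists ((a * b) *: a0 + b *: a1 + a *: a2).
  have [e1 e2 e3] := cK (a * b) b a.
  have e4 : a * b / b = a by rewrite mulfK.
  have e5 : a * b / a = b by rewrite mulrAC mulfV ?mul1r.
  rewrite /q homogenizedE ?e2 ?e3 // e1 e4 e5.
  by rewrite !mulf_neq0 ?expf_neq0.
pose v := (t%:C : C R) *: a0 + a1 + a2.
have vE : v = (t%:C : C R) *: a0 + (1 : C R) *: a1 + (1 : C R) *: a2 by rewrite !scale1r.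
have [v0 v1 v2] := cK t%:C 1 1; rewrite -vE in v0 v1 v2.
have [dv0 dv1 dv2] := dc v.
(* The relation is checked around [v], where both parameters are near [t], and carried to [u0], at
   distance [t * nrm a0]. *)
apply: (prop p q i0 dp dq v u0); last 1 first.
- have nz : \forall y \near (1 : C R), y != 0.
    by apply: open_nbhs_nbhs; split; [exact: open_neq0C|exact: oner_neq0].
  have n1 : \forall w \near v, c1 w != 0.
    by move: nz; rewrite -v1; exact: (near_comp (differentiable_continuous dv1)).
  have n2 : \forall w \near v, c2 w != 0.
    by move: nz; rewrite -v2; exact: (near_comp (differentiable_continuous dv2)).
  have nA : \forall y \near (t%:C : C R), A y by apply/nbhs_nrm; exists (k * t).
  have n3 : \forall w \near v, A (c0 w / c1 w).
    have d3 : differentiable (fun w => c0 w * (c1 w)^-1) v.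
      by apply: differentiableM => //; apply: differentiableV => //; rewrite v1 oner_eq0.
    have e3 : c0 v * (c1 v)^-1 = t%:C by rewrite v0 v1 invr1 mulr1.
    by move: nA; rewrite -e3; exact: (near_comp (differentiable_continuous d3)).
  have n4 : \forall w \near v, A (c0 w / c2 w).
    have d3 : differentiable (fun w => c0 w * (c2 w)^-1) v.
      by apply: differentiableM => //; apply: differentiableV => //; rewrite v2 oner_eq0.
    have e3 : c0 v * (c2 v)^-1 = t%:C by rewrite v0 v2 invr1 mulr1.
    by move: nA; rewrite -e3; exact: (near_comp (differentiable_continuous d3)).
  apply: filterS (filterI (filterI n1 n2) (filterI n3 n4)) => w [[w1 w2] [Aa Ab']] w0 u uw i.
  set a := c0 w / c1 w in Aa; set b := c0 w / c2 w in Ab'.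
  have c0w : c0 w != 0 by apply: contraNneq (A0 _ Aa) => h; rewrite /a h mul0r.
  have xw : x a b = (c2 w)^-1 *: w.
    have -> : (c2 w)^-1 *: w = (c2 w)^-1 *: (c0 w *: a0 + c1 w *: a1 + c2 w *: a2).
      by rewrite -cE.
    apply/rowP => j; rewrite !mxE /a /b; field.
    by rewrite w1 w2 c0w.
  have [_ gx /coneE[x0 _] gl] := hr1 _ (xr a b Aa Ab').
  have g0 : g (x a b) != 0 by apply: row_neq0 gx.
  have [y ->] : exists y : C R, u = y *: g (x a b).
    by apply: mem_line_colinear g0 gl _; rewrite xw point_ofZ // invr_eq0.
  have [_ /(_ a b Aa Ab') h] := hX i.
  rewrite /p /q !homogenizedE // -/a -/b !mxE -h /f.
  by field.
- have -> : v - u0 = (t%:C : C R) *: a0.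
    by apply/rowP => j; rewrite !mxE; ring.
  rewrite nrmZ tC; have : t * nrm a0 <= t * N0 by rewrite ler_pM2l // lerDl.
  have : 0 < t * N0 by rewrite mulr_gt0.
  lra.
- by rewrite subrr nrm0.
Qed.

End RationalRelation.

(** * Restriction of a form to a line *)

Section LinePolynomial.
Variables (R : realType) (n : nat).
Local Notation V := 'rV[C R]_n.+1.
Implicit Types (F : mpoly n.+1 (C R)) (v w b : V).

Lemma evalpE F v :
  evalp F v = \sum_(m <- msupp F) mcoeff m F * \prod_i v 0 i ^+ (m i).
Proof. by rewrite /evalp mevalE. Qed.

Lemma evalp_differentiable F v : differentiable (evalp F) v.
Proof.
have dX k (i : 'I_n.+1) : differentiable (fun x : V => x 0 i ^+ k) v.
  elim: k => [|k IH]; first exact: differentiable_cst.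
  rewrite (_ : (fun x : V => x 0 i ^+ k.+1) = (fun x : V => x 0 i) * (fun x : V => x 0 i ^+ k)).
    by apply: differentiableM; [exact: differentiable_coord|].
  by apply/funext => x; rewrite exprS.
have dP (s : seq 'I_n.+1) (m : multinom n.+1) :
    differentiable (fun x : V => \prod_(i <- s) x 0 i ^+ (m i)) v.
  elim: s => [|i s IH].
    rewrite (_ : (fun x : V => _) = cst 1); first exact: differentiable_cst.
    by apply/funext => x; rewrite big_nil.
  rewrite (_ : (fun x : V => _) = (fun x : V => x 0 i ^+ (m i)) * (fun x : V => \prod_(i <- s) x 0 i ^+ (m i))).
    exact: differentiableM.
  by apply/funext => x; rewrite big_cons.
have dS (s : seq (multinom n.+1)) :
    differentiable (fun x : V => \sum_(m <- s) mcoeff m F * \prod_i x 0 i ^+ (m i)) v.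
  elim: s => [|m s IH].
    rewrite (_ : (fun x : V => _) = cst 0); first exact: differentiable_cst.
    by apply/funext => x; rewrite big_nil.
  rewrite (_ : (fun x : V => _) = (fun x : V => mcoeff m F * \prod_i x 0 i ^+ (m i)) +
      (fun x : V => \sum_(m <- s) mcoeff m F * \prod_i x 0 i ^+ (m i))).
    apply: differentiableD => //; apply: differentiableM; first exact: differentiable_cst.
    exact: dP.
  by apply/funext => x; rewrite big_cons.
rewrite (_ : evalp F = fun x : V => \sum_(m <- msupp F) mcoeff m F * \prod_i x 0 i ^+ (m i)).
  exact: dS.
by apply/funext => x; rewrite evalpE.
Qed.

Lemma evalpZ F d (a : C R) v : F \is ishomog1 d mdeg ->
  evalp F (a *: v) = a ^+ d * evalp F v.
Proof.
move=> /dhomogP hF; rewrite !evalpE mulr_sumr; apply: eq_big_seq => m /hF md.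
rewrite mulrCA; congr (_ * _).
rewrite (eq_bigr (fun i => a ^+ (m i) * v 0 i ^+ (m i))); last first.
  by move=> i _; rewrite mxE exprMn.
by rewrite big_split /= -expr_sum -mdegE md.
Qed.

Lemma mderiv_homog F d i : F \is ishomog1 d.+1 mdeg ->
  mderiv i F \is ishomog1 d mdeg.
Proof.
move=> /dhomogP hF; apply/dhomogP => m; rewrite mcoeff_msupp mcoeff_deriv => h.
have e : mdeg (mnm_add m (mnm1 i)) = d.+1.
  by apply: hF; rewrite mcoeff_msupp; apply: contraNneq h => ->; rewrite mul0rn.
have : (mdeg m).+1 = d.+1 by rewrite -e mdegD mdeg1 addn1.
by case.
Qed.

Definition dir_deriv F b v : C R := \sum_i b 0 i * evalp (mderiv i F) v.

Lemma dir_deriv_differentiable F b v : differentiable (dir_deriv F b) v.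
Proof.
rewrite (_ : dir_deriv F b = \sum_i (fun v => b 0 i * evalp (mderiv i F) v)).
  apply: differentiable_sum => i; apply: differentiableM; first exact: differentiable_cst.
  exact: evalp_differentiable.
by apply/funext => w; rewrite fct_sumE.
Qed.

Lemma dir_derivZ F d b (a : C R) v : F \is ishomog1 d.+1 mdeg ->
  dir_deriv F b (a *: v) = a ^+ d * dir_deriv F b v.
Proof.
move=> hF; rewrite /dir_deriv mulr_sumr; apply: eq_bigr => i _.
by rewrite (evalpZ a v (mderiv_homog i hF)) mulrCA.
Qed.

Definition line_poly F w b : {poly C R} :=
  mmap polyC (fun i => (w 0 i)%:P + (b 0 i) *: 'X) F.

Lemma line_polyE F w b : line_poly F w b = \sum_(m <- msupp F)
  (mcoeff m F)%:P * \prod_i ((w 0 i)%:P + (b 0 i) *: 'X) ^+ (m i).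
Proof. by []. Qed.

Lemma horner_line_poly F w b y : (line_poly F w b).[y] = evalp F (w + y *: b).
Proof.
rewrite line_polyE evalpE horner_sum; apply: eq_bigr => m _.
rewrite hornerM hornerC horner_prod; congr (_ * _); apply: eq_bigr => i _.
by rewrite horner_exp !hornerE !mxE (mulrC y).
Qed.

Lemma deriv_line_poly F w b :
  deriv (line_poly F w b) = \sum_i b 0 i *: line_poly (mderiv i F) w b.
Proof.
pose Pr F := deriv (line_poly F w b) = \sum_i b 0 i *: line_poly (mderiv i F) w b.
have PrD F1 F2 : Pr F1 -> Pr F2 -> Pr (F1 + F2).
  rewrite /Pr /line_poly => h1 h2; rewrite rmorphD derivD h1 h2 -big_split.
  by apply: eq_bigr => i _; rewrite mderivD rmorphD scalerDr.
have PrM F1 F2 : Pr F1 -> Pr F2 -> Pr (F1 * F2).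
  rewrite /Pr /line_poly => h1 h2; rewrite rmorphM derivM h1 h2.
  rewrite mulr_suml mulr_sumr -big_split; apply: eq_bigr => i _.
  by rewrite mderivM rmorphD !rmorphM /= scalerDr -!scalerAl -!scalerAr.
have PrC c : Pr (mpolyC _ c).
  rewrite /Pr /line_poly mmapC derivC big1 // => i _.
  by rewrite mderivC mmap0 scaler0.
have PrX k : Pr (mpolyX _ (mnm1 k)).
  rewrite /Pr /line_poly mmapX mmap1U derivD derivC add0r derivZ derivX.
  rewrite (bigD1 k) //= big1 ?addr0 => [|i ik].
    rewrite mderivX mnm1E eqxx scale1r (_ : mnm_sub _ _ = mnm0).
      by rewrite mpolyX0 rmorph1.
    by apply/mnmP => j; rewrite mnmBE mnm0E subnn.
  by rewrite mderivX mnm1E eq_sym (negbTE ik) scale0r mmap0 scaler0.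
suff : Pr F by [].
rewrite [F]mpolyE; elim/big_ind: _ => [||m _].
- by have := PrC 0; rewrite mpolyC0.
- exact: PrD.
rewrite -mul_mpolyC; apply: (PrM); first exact: PrC.
rewrite mpolyXE_id; elim/big_ind: _ => [||i _]; [exact: (PrC 1)|exact: (PrM)|].
elim: (m i) => [|k IH]; first exact: (PrC 1).
by rewrite exprS; apply: (PrM); [exact: PrX|].
Qed.

Lemma horner_deriv_line_poly F w b y :
  (deriv (line_poly F w b)).[y] = dir_deriv F b (w + y *: b).
Proof.
rewrite deriv_line_poly horner_sum; apply: eq_bigr => i _.
by rewrite hornerZ horner_line_poly.
Qed.

(** Unlike for [lead_coef], [c = 0] is allowed, so products and sums raise no question of
    non-vanishing. *)
Definition top_coef (p : {poly C R}) (a : nat) (c : C R) :=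
  (size p <= a.+1)%N /\ p`_a = c.

Lemma top_coefM (p q : {poly C R}) (a b' : nat) (c c' : C R) : top_coef p a c ->
  top_coef q b' c' -> top_coef (p * q) (a + b') (c * c').
Proof.
move=> [sp pa] [sq qb]; split.
  by apply: leq_trans (size_polyMleq _ _) _; lia.
rewrite coefM (bigD1 (inord a)) //= inordK ?ltnS ?leq_addr //.
rewrite addKn pa qb big1 ?addr0 // => j ja.
have {}ja : (j : nat) != a.
  apply: contraNneq ja => e; apply/eqP/val_inj.
  by rewrite /= inordK // ltnS leq_addr.
have [ltja|] := ltnP j a.
  rewrite [X in _ * X]nth_default ?mulr0 //; apply: leq_trans sq _.
  by lia.
rewrite leq_eqVlt eq_sym (negbTE ja) /= => ltaj.
by rewrite nth_default ?mul0r // (leq_trans sp).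
Qed.

Lemma line_poly_top F d w b : F \is ishomog1 d mdeg ->
  top_coef (line_poly F w b) d (evalp F b).
Proof.
move=> /dhomogP hF.
have lin i : top_coef ((w 0 i)%:P + (b 0 i) *: 'X) 1 (b 0 i).
  split.
    apply: leq_trans (size_polyD _ _) _; rewrite geq_max.
    rewrite (leq_trans (size_polyC_leq1 _)) //=.
    by rewrite (leq_trans (size_scale_leq _ _)) // size_polyX.
  by rewrite coefD coefC coefZ coefX /= add0r mulr1.
have linX i k : top_coef (((w 0 i)%:P + (b 0 i) *: 'X) ^+ k) k (b 0 i ^+ k).
  elim: k => [|k IH]; first by split; rewrite ?expr0 ?size_poly1 ?coef1.
  by have := top_coefM (lin i) IH; rewrite -!exprS add1n.
have prodX (s : seq 'I_n.+1) (m : multinom n.+1) :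
   top_coef (\prod_(i <- s) ((w 0 i)%:P + (b 0 i) *: 'X) ^+ (m i))
     (\sum_(i <- s) m i) (\prod_(i <- s) b 0 i ^+ (m i)).
  elim: s => [|i s IH]; first by rewrite !big_nil; split; rewrite ?size_poly1 ?coef1.
  by rewrite !big_cons; apply: top_coefM.
rewrite line_polyE evalpE.
have : {in msupp F, forall m, top_coef ((mcoeff m F)%:P *
   \prod_i ((w 0 i)%:P + (b 0 i) *: 'X) ^+ (m i)) d (mcoeff m F * \prod_i b 0 i ^+ (m i))}.
  move=> m /hF md; have <- : (\sum_(i < n.+1) m i)%N = d by rewrite -mdegE.
  rewrite -[X in top_coef _ X]add0n; apply: top_coefM; last exact: prodX.
  by split; [exact: size_polyC_leq1|rewrite coefC].
elim: (msupp F) => [|m s IH] h.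
  by rewrite !big_nil; split; rewrite ?size_poly0 ?coef0.
rewrite !big_cons; have [s1 c1] := h m (mem_head _ _).
have [|s2 c2] := IH; first by move=> x xs; apply: h; rewrite inE xs orbT.
split; last by rewrite coefD c1 c2.
by apply: leq_trans (size_polyD _ _) _; rewrite geq_max s1.
Qed.

Lemma line_factor F d w b : F \is ishomog1 d mdeg -> evalp F b != 0 ->
  exists2 rs : seq (C R), size rs = d &
    line_poly F w b = evalp F b *: \prod_(z <- rs) ('X - z%:P).
Proof.
move=> hF Fb; have [sp pd] := line_poly_top w b hF.
have sE : size (line_poly F w b) = d.+1.
  apply/eqP; rewrite eqn_leq sp /=; rewrite ltnNge; apply/negP => h.
  by case/eqP: Fb; rewrite -pd nth_default.
have [rs pE] := closed_field_poly_normal (line_poly F w b).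
have lc : lead_coef (line_poly F w b) = evalp F b by rewrite lead_coefE sE.
exists rs; last by rewrite {1}pE lc.
have := sE; rewrite pE size_scale ?lc // size_prod_XsubC => -[].
by [].
Qed.

End LinePolynomial.

(** * Projection of an open and closed part of a curve from a point off the curve *)

Section CurveSheets.
Variables (R : realType) (n d : nat).
Local Notation V := 'rV[C R]_n.+1.
Variables (F : mpoly n.+1 (C R)) (E : V -> Prop) (b : V).
Hypothesis hF : F \is ishomog1 d mdeg.
Hypothesis Fb : evalp F b != 0.
Hypothesis hE : forall v, v != 0 -> evalp F v = 0 -> exists2 e : R, 0 < e &
  forall v', nrm (v' - v) < e -> evalp F v' = 0 -> (E v' <-> E v).

(** [hE] makes [E] open and closed on the curve [F = 0]; the sheet is the part of the curve that it
    cuts out. *)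
Definition sheet v := evalp F v = 0 /\ E v.

Lemma not_sheet_near v : v != 0 -> ~ sheet v ->
  exists2 e : R, 0 < e & forall v', nrm (v' - v) < e -> ~ sheet v'.
Proof.
move=> v0 ns; have [Fv|Fv] := eqVneq (evalp F v) 0.
  have [e e0 he] := hE v0 Fv; exists e => // v' v'e [Fv' Ev'].
  by apply: ns; split => //; apply/(he v' v'e Fv').
have Fv0 : 0 < nrm (evalp F v) by rewrite nrm_gt0.
have [e e0 he] := (continuous_eps _ _).1
  (differentiable_continuous (evalp_differentiable F v)) _ Fv0.
exists e => // v' /he h [Fv' _]; move: h.
by rewrite Fv' sub0r nrmN ltxx.
Qed.

(** For large [y], [evalp F (w + y *: b)] is [y ^+ d * evalp F (b + y^-1 *: w)], whose last factor
    is close to [evalp F b]. *)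
Lemma root_bound w0 : exists2 K : R, 0 < K & forall w y, nrm (w - w0) < 1 ->
  evalp F (w + y *: b) = 0 -> nrm y <= K.
Proof.
have Fb0 : 0 < nrm (evalp F b) by rewrite nrm_gt0.
have [e e0 he] := (continuous_eps _ _).1
  (differentiable_continuous (evalp_differentiable F b)) _ Fb0.
have K0 : 0 < (nrm w0 + 1) / e by rewrite divr_gt0 // ltr_wpDl ?nrm_ge0.
exists ((nrm w0 + 1) / e) => // w y ww Fw; rewrite leNgt; apply/negP => yK.
have y0 : 0 < nrm y by apply: lt_trans yK.
have yn : y != 0 by rewrite -nrm_gt0.
have : evalp F (y *: (b + y^-1 *: w)) = 0.
  by rewrite scalerDr scalerA mulfV // scale1r addrC.
rewrite (evalpZ _ _ hF) => /eqP; rewrite mulf_eq0 expf_eq0 (negbTE yn) andbF /= => /eqP h.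
have := he (b + y^-1 *: w); rewrite h sub0r nrmN ltxx addrC addrA addNr add0r.
rewrite nrmZ nrmV => hh; suff : false by []; apply: hh.
rewrite ltr_pdivrMl // mulrC; move: yK; rewrite ltr_pdivrMr // => yK.
have := nrmBr w w0; rewrite mulrC in yK; rewrite mulrC; lra.
Qed.

(** Bisection runs over a square of [y] that contains all the roots: near a [y] that is no root over
    [w0], there is none over nearby [w]. *)
Lemma sheet_roots_near w0 (p : R) : (forall y : C R, w0 + y *: b != 0) -> 0 < p ->
  exists2 e : R, 0 < e & forall w y, nrm (w - w0) < e -> sheet (w + y *: b) ->
    exists2 r, sheet (w0 + r *: b) & nrm (y - r) < p.
Proof.
move=> w0b p0; have [K K0 hK] := root_bound w0.
pose P y w := sheet (w + y *: b) -> exists2 r, sheet (w0 + r *: b) & nrm (y - r) < p.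
have [e e0 he] : exists2 e : R, 0 < e & forall w, nrm (w - w0) < e ->
    forall y, square (- K +i* - K) (2 * K) y -> P y w.
  apply: (@square_ind R (fun c s => exists2 e : R, 0 < e & forall w, nrm (w - w0) < e ->
    forall y, square c s y -> P y w)); first by rewrite mulr_gt0.
    move=> c s _ [d1 d10 h1] [d2 d20 h2] [d3 d30 h3] [d4 d40 h4].
    exists (Num.min (Num.min d1 d2) (Num.min d3 d4)); first by rewrite !lt_min d10 d20 d30.
    move=> w; rewrite !lt_min => /andP[/andP[e1 e2] /andP[e3 e4]] y.
    move=> /square_split[a [b' [[->|->] [->|->] hz]]]; [|exact: h3|exact: h2|exact: h4].
    by move: hz; rewrite (_ : (0 +i* 0) = 0 :> C R) // addr0; exact: h1.
  move=> z _; have [sz|nz] := pselect (sheet (w0 + z *: b)).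
    exists (p / 2); first by rewrite divr_gt0.
    move=> c s /andP[s0 sp] zs _; exists 1 => // w _ y ys _; exists z => //.
    by apply: le_lt_trans (square_nrm ys zs) _; lra.
  have [e e0 he] := not_sheet_near (w0b z) nz.
  pose N := nrm b + 1; have N0 : 0 < N by rewrite ltr_wpDl ?nrm_ge0.
  exists (e / (4 * N)); first by rewrite divr_gt0 // mulr_gt0.
  move=> c s /andP[s0 se] zs _; exists (e / 2); first by rewrite divr_gt0.
  move=> w we y ys sy; case: (he _ _ sy).
  have -> : w + y *: b - (w0 + z *: b) = (w - w0) + (y - z) *: b.
    by apply/rowP => j; rewrite !mxE; ring.
  apply: le_lt_trans (nrmD _ _) _; rewrite nrmZ.
  have h1 : nrm (y - z) * nrm b <= 2 * s * N.
    by apply: ler_pM; rewrite ?nrm_ge0 ?square_nrm ?lerDl //; exact: square_nrm ys zs.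
  move: se; rewrite ltr_pdivlMr ?mulr_gt0 // => se; lra.
exists (Num.min e 1); first by rewrite lt_min e0 ltr01.
move=> w y; rewrite lt_min => /andP[we w1] sy; apply: (he w we) => //.
have yK : nrm y <= K by apply: hK w1 _; case: sy.
have := le_trans (Re_le _) yK; have := le_trans (Im_le _) yK.
by rewrite /square /= !ler_norml; lra.
Qed.

Lemma prod_le_exp (s : seq (C R)) (f : C R -> R) (p : R) : 0 <= p ->
  (forall z, z \in s -> p <= f z) -> p ^+ size s <= \prod_(z <- s) f z.
Proof.
move=> p0; elim: s => [|z s IH] h; first by rewrite big_nil.
rewrite big_cons exprS; apply: ler_pM => //; first exact: exprn_ge0.
  by apply: h; rewrite mem_head.
by apply: IH => x xs; apply: h; rewrite inE xs orbT.
Qed.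

Lemma prod_ge_exp (s : seq (C R)) (f : C R -> R) (p : R) : 0 <= p ->
  (forall z, z \in s -> 0 <= f z <= p) -> \prod_(z <- s) f z <= p ^+ size s.
Proof.
move=> p0; elim: s => [|z s IH] h; first by rewrite big_nil.
have /andP[f0 fp] := h z (mem_head _ _).
have hs x : x \in s -> 0 <= f x <= p by move=> xs; apply: h; rewrite inE xs orbT.
rewrite big_cons exprS; apply: ler_pM => //; last exact: IH.
by rewrite big_seq; apply: prodr_ge0 => x /hs/andP[].
Qed.

Lemma root_mem w (rs : seq (C R)) y :
  line_poly F w b = evalp F b *: \prod_(z <- rs) ('X - z%:P) ->
  (y \in rs) = (evalp F (w + y *: b) == 0).
Proof.
by move=> pE; rewrite -horner_line_poly -rootE pE rootZ // root_prod_XsubC.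
Qed.

(** [evalp F (w + r *: b)] is small and equals [evalp F b] times the product of the [r - z] over the
    [d] roots, so some root is near [r]; it lies in [E] because [E] is locally constant on the
    curve. *)
Lemma sheet_root_persists w0 r (p : R) : (forall y : C R, w0 + y *: b != 0) -> 0 < p ->
  sheet (w0 + r *: b) ->
  exists2 e : R, 0 < e & forall w, nrm (w - w0) < e ->
    exists2 y, sheet (w + y *: b) & nrm (y - r) < p.
Proof.
move=> w0b p0 [Fr Er]; have [e e0 he] := hE (w0b r) Fr.
pose N := nrm b + 1; have N0 : 0 < N by rewrite ltr_wpDl ?nrm_ge0.
have [q [q0 qp qe]] : exists q : R, [/\ 0 < q, q <= p & 2 * q * N <= e].
  exists (Num.min p (e / (2 * N))); split.
  - by rewrite lt_min p0 divr_gt0 // mulr_gt0.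
  - by rewrite ge_min lexx.
  - rewrite mulrAC mulrC -ler_pdivlMr ?mulr_gt0 //.
    by rewrite ge_min lexx orbT.
have c0 : 0 < nrm (evalp F b) * q ^+ d by rewrite mulr_gt0 ?nrm_gt0 // exprn_gt0.
have [e' e'0 he'] := (continuous_eps _ _).1
  (differentiable_continuous (evalp_differentiable F (w0 + r *: b))) _ c0.
exists (Num.min e' (e / 2)); first by rewrite lt_min e'0 divr_gt0.
move=> w; rewrite lt_min => /andP[we' we].
have := he' (w + r *: b); rewrite Fr subr0 opprD addrACA subrr addr0 => /(_ we').
rewrite -horner_line_poly; have [rs sr pE] := line_factor w hF Fb.
rewrite pE hornerZ nrmM ltr_pM2l ?nrm_gt0 // horner_prod nrm_prod -{1}sr.
rewrite ltNge => /negP h.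
have [z zrs zr] : exists2 z, z \in rs & nrm (z - r) < q.
  apply: contrapT => h'; apply: h; apply: prod_le_exp; first exact: ltW.
  move=> z zrs; rewrite hornerXsubC nrmB leNgt; apply/negP => zr; apply: h'.
  by exists z.
have Fz : evalp F (w + z *: b) = 0 by apply/eqP; rewrite -(root_mem z pE).
exists z; last by apply: lt_le_trans zr qp.
split => //; apply/(he _ _ Fz) => //.
have -> : w + z *: b - (w0 + r *: b) = (w - w0) + (z - r) *: b.
  by apply/rowP => j; rewrite !mxE; ring.
apply: le_lt_trans (nrmD _ _) _; rewrite nrmZ.
have : nrm (z - r) * nrm b <= q * N.
  by apply: ler_pM; rewrite ?nrm_ge0 ?lerDl // ltW.
lra.
Qed.

(** Only points of the sheet are counted: the line may meet the rest of the curve anywhere. *)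
Definition single_simple_root w := exists y, [/\ sheet (w + y *: b),
  forall y', sheet (w + y' *: b) -> y' = y & dir_deriv F b (w + y *: b) != 0].

Lemma dir_deriv_near (w0 : V) (r : C R) (c : R) : 0 < c ->
  exists2 e : R, 0 < e & forall (w : V) (y : C R),
  nrm (w - w0) < e -> nrm (y - r) < e ->
  nrm (dir_deriv F b (w + y *: b) - dir_deriv F b (w0 + r *: b)) < c.
Proof.
move=> c0; have [e e0 he] := (continuous_eps _ _).1
  (differentiable_continuous (dir_deriv_differentiable F b (w0 + r *: b))) _ c0.
pose N := nrm b + 1; have N0 : 0 < N by rewrite ltr_wpDl ?nrm_ge0.
exists (Num.min (e / 2) (e / (2 * N))); first by rewrite lt_min !divr_gt0 // mulr_gt0.
move=> w y; rewrite !lt_min => /andP[w1 _] /andP[_]; rewrite ltr_pdivlMr ?mulr_gt0 // => y1.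
apply: he; have -> : w + y *: b - (w0 + r *: b) = (w - w0) + (y - r) *: b.
  by apply/rowP => j; rewrite !mxE; ring.
apply: le_lt_trans (nrmD _ _) _; rewrite nrmZ.
have : nrm (y - r) * nrm b <= nrm (y - r) * N by rewrite ler_wpM2l ?nrm_ge0 ?lerDl.
lra.
Qed.

Lemma dir_deriv_factor w (rs : seq (C R)) y :
  line_poly F w b = evalp F b *: \prod_(z <- rs) ('X - z%:P) -> y \in rs ->
  dir_deriv F b (w + y *: b) = evalp F b * \prod_(z <- rem y rs) (y - z).
Proof.
move=> pE yrs; rewrite -horner_deriv_line_poly pE (big_rem y yrs) /=.
rewrite derivZ derivM derivXsubC mul1r !hornerE subrr mul0r addr0.
by rewrite horner_prod; congr (_ * _); apply: eq_bigr => z _; rewrite hornerXsubC.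
Qed.

(** A second root [y'] of the sheet would also be near [r]; the derivative at [y], a product over
    the other roots, would contain the small factor [y - y'], against its lower bound [c]. *)
Lemma single_simple_root_open w0 : (forall y : C R, w0 + y *: b != 0) ->
  single_simple_root w0 ->
  exists2 e : R, 0 < e & forall w, nrm (w - w0) < e -> single_simple_root w.
Proof.
move=> w0b [r [sr ur dr]].
have [c c0 cE] : exists2 c : R, 0 < c & nrm (dir_deriv F b (w0 + r *: b)) = c + c.
  exists (nrm (dir_deriv F b (w0 + r *: b)) / 2); first by rewrite divr_gt0 // nrm_gt0.
  exact: splitr.
have far (t1 t2 t3 : R) : t1 - t2 <= t3 -> t3 < c -> t1 = c + c -> c < t2 by lra.
have [K K0 hK] := root_bound w0.
have [e1 e10 he1] := dir_deriv_near w0 r c0.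
have big : forall w y, nrm (w - w0) < e1 -> nrm (y - r) < e1 ->
    c < nrm (dir_deriv F b (w + y *: b)).
  move=> w y we ye; have := he1 w y we ye.
  move=> h2; apply: (far _ _ _ _ h2 cE).
  by rewrite [leRHS]nrmB; exact: nrmBr.
have K1 : 1 <= 2 * K + 1 by lra.
(* [M] bounds the remaining factors, each at most [2 * K]; the [+ 1] makes the base at least [1], so
   the exponent may be raised to [d]. *)
have [M M0 ME] : exists2 M : R, 0 < M & M = nrm (evalp F b) * (2 * K + 1) ^+ d.
  exists (nrm (evalp F b) * (2 * K + 1) ^+ d) => //.
  by rewrite mulr_gt0 ?nrm_gt0 // exprn_gt0 //; exact: lt_le_trans ltr01 K1.
have [p [p0 pe pM]] : exists p : R, [/\ 0 < p, p <= e1 & 2 * p * M <= c].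
  exists (Num.min e1 (c / (2 * M))); split.
  - by rewrite lt_min e10 divr_gt0 // mulr_gt0.
  - by rewrite ge_min lexx.
  - rewrite mulrAC mulrC -ler_pdivlMr ?mulr_gt0 //.
    by rewrite ge_min lexx orbT.
have [e2 e20 he2] := sheet_roots_near w0b p0.
have [e3 e30 he3] := sheet_root_persists w0b p0 sr.
exists (Num.min (Num.min e1 1) (Num.min e2 e3)); first by rewrite !lt_min e10 e20 e30 ltr01.
move=> w; rewrite !lt_min => /andP[/andP[w1 w1'] /andP[w2 w3]].
have near y : sheet (w + y *: b) -> nrm (y - r) < p.
  by move=> /(he2 w y w2)[r' /ur ->].
have [y sy yr] := he3 w w3.
exists y; split; [exact: sy| |]; last first.
  by rewrite -nrm_gt0; apply: lt_trans (big w y w1 (lt_le_trans yr pe)).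
move=> y' sy'; apply/eqP/negPn/negP => yy'; have y'r := near y' sy'.
have [rs srs pE] := line_factor w hF Fb.
have yrs : y \in rs by rewrite (root_mem y pE); case: sy => ->.
have y'rs : y' \in rs by rewrite (root_mem y' pE); case: sy' => ->.
have y'rem : y' \in rem y rs by move: y'rs; rewrite (perm_mem (perm_to_rem yrs)) inE (negbTE yy').
have := big w y w1 (lt_le_trans yr pe).
rewrite (dir_deriv_factor pE yrs) (big_rem y' y'rem) /= ltNge => /negP; apply.
rewrite !nrmM nrm_prod.
have h1 : nrm (y - y') <= 2 * p.
  have -> : y - y' = (y - r) - (y' - r) by rewrite opprB addrA subrK.
  by apply: le_trans (nrmD _ _) _; rewrite nrmN; lra.
have h2 : \prod_(z <- rem y' (rem y rs)) nrm (y - z) <= (2 * K + 1) ^+ d.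
  apply: le_trans (prod_ge_exp (p := 2 * K + 1) _ _) _; first by lra.
    move=> z /mem_rem /mem_rem zrs; rewrite nrm_ge0 /=.
    have yK : nrm y <= K by apply: hK w1' _; case: sy.
    have zK : nrm z <= K by apply: hK w1' _; apply/eqP; rewrite -(root_mem z pE).
    by apply: le_trans (nrmD _ _) _; rewrite nrmN; lra.
  apply: ler_weXn2l; first exact: K1.
  by rewrite -srs (size_rem y'rem) (size_rem yrs) (leq_trans (leq_pred _) (leq_pred _)).
apply: le_trans pM; rewrite ME [leRHS]mulrCA.
apply: ler_wpM2l; first exact: nrm_ge0.
apply: (ler_pM _ _ h1 h2); first exact: nrm_ge0.
by rewrite big_seq; apply: prodr_ge0 => z _; exact: nrm_ge0.
Qed.

(** Two roots in the limit would persist as two. The root stays simple because a root of the curve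
    close to [r] would be in [E], hence in the sheet: the other roots stay away from [r]. *)
Lemma single_simple_root_closed w0 : (forall y : C R, w0 + y *: b != 0) ->
  (forall e : R, 0 < e -> exists2 w, nrm (w - w0) < e & single_simple_root w) ->
  single_simple_root w0.
Proof.
move=> w0b lim.
have [r sr] : exists r, sheet (w0 + r *: b).
  have [e e0 he] := sheet_roots_near w0b (@ltr01 R).
  have [w we [y [sy _ _]]] := lim e e0.
  by have [r sr _] := he w y we sy; exists r.
have ur r' : sheet (w0 + r' *: b) -> r' = r.
  move=> sr'; apply/eqP/negPn/negP => rr'.
  have p0 : 0 < nrm (r' - r) / 2 by rewrite divr_gt0 // nrm_gt0 subr_eq0.
  have [e1 e10 h1] := sheet_root_persists w0b p0 sr.
  have [e2 e20 h2] := sheet_root_persists w0b p0 sr'.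
  have [|w] := lim (Num.min e1 e2); first by rewrite lt_min e10.
  rewrite lt_min => /andP[w1 w2] [y [_ uy _]].
  have [y1 /uy -> h3] := h1 w w1; have [y2 /uy -> h4] := h2 w w2.
  have : nrm (r' - r) <= nrm (y - r) + nrm (y - r').
    have -> : r' - r = (y - r) - (y - r') by ring.
    by apply: le_trans (nrmD _ _) _; rewrite nrmN.
  lra.
exists r; split => //; apply/negP => /eqP dr.
have [Fr Er] := sr; have [e e0 he] := hE (w0b r) Fr.
pose N := nrm b + 1; have N0 : 0 < N by rewrite ltr_wpDl ?nrm_ge0.
pose p := e / (2 * N); have p0 : 0 < p by rewrite divr_gt0 // mulr_gt0.
have pN : 2 * p * N = e by rewrite /p; field; rewrite gt_eqF.
(* A lower bound for the derivative at [s]: [d.-1] factors [s - z], each of norm at least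
   [p / 2]. *)
have c0 : 0 < nrm (evalp F b) * (p / 2) ^+ d.-1.
  by rewrite mulr_gt0 ?nrm_gt0 // exprn_gt0 // divr_gt0.
have [e1 e10 he1] := dir_deriv_near w0 r c0.
have q0 : 0 < Num.min e1 (p / 2) by rewrite lt_min e10 divr_gt0.
have [e2 e20 he2] := sheet_roots_near w0b q0.
have [|w] := lim (Num.min (e / 2) (Num.min e1 e2)); first by rewrite !lt_min e10 e20 divr_gt0.
rewrite !lt_min => /and3P[w0e w1 w2] [s [ss us ds]].
have [r' /ur ->] := he2 w s w2 ss; rewrite lt_min => /andP[s1 s2].
have [rs srs pE] := line_factor w hF Fb.
have sin : s \in rs by rewrite (root_mem s pE); case: ss => ->.
have := he1 w s w1 s1; rewrite dr subr0 (dir_deriv_factor pE sin) nrmM ltNge => /negP; apply.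
apply: ler_wpM2l; first exact: nrm_ge0.
rewrite nrm_prod -srs -(size_rem sin); apply: prod_le_exp; first by rewrite divr_ge0 // ltW.
move=> z zrem; have zrs := mem_rem zrem.
have zs : z != s.
  apply: contraNneq ds => zs; rewrite (dir_deriv_factor pE sin) (big_rem z zrem) /= zs.
  by rewrite subrr mul0r mulr0.
have Fz : evalp F (w + z *: b) = 0 by apply/eqP; rewrite -(root_mem z pE).
have zr : p <= nrm (z - r).
  rewrite leNgt; apply/negP => zr; case/eqP: zs; apply: us; split => //.
  apply/(he _ _ Fz) => //.
  have -> : w + z *: b - (w0 + r *: b) = (w - w0) + (z - r) *: b.
    by apply/rowP => j; rewrite !mxE; ring.
  apply: le_lt_trans (nrmD _ _) _; rewrite nrmZ.
  have : nrm (z - r) * nrm b <= p * N by apply: ler_pM; rewrite ?nrm_ge0 ?lerDl // ltW.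
  lra.
have := nrmBr (z - r) (s - r); rewrite opprB addrA subrK (nrmB z s) => h.
by apply: le_trans h; rewrite lerBrDr; apply: le_trans zr; rewrite [leRHS]splitr lerD2l ltW.
Qed.

End CurveSheets.

(** * First-order expansion of a form and of a branch of its zero set *)

Lemma eq_le_nrm (R : realType) (V : normedModType (C R)) (x y : V) : x = y -> nrm x <= nrm y.
Proof. by move->. Qed.

Lemma differential_eps (R : realType) (V : normedModType (C R)) (f : V -> C R) v :
  differentiable f v -> forall e : R, 0 < e -> exists2 r : R, 0 < r &
    forall h, nrm h < r -> nrm (f (v + h) - f v - 'd f v h) <= e * nrm h.
Proof.
move=> df e e0.
have e0' : 0 < (e%:C : C R) by rewrite ltcR.
have [_ /landau.eqaddoP /(_ _ e0') /nbhs_nrm[r r0 hr]] := (diff_locallyP _ _).1 df.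
exists r => // h hh; have := hr h; rewrite subr0 => /(_ hh) /=.
rewrite !nrmE -rmorphM lecR => le; apply: le_trans le; apply: eq_le_nrm => /=.
by rewrite !fctE /= (addrC h) opprD addrA.
Qed.

Section LinearApproximation.
Variables (R : realType) (n : nat) (F : mpoly n.+1 (C R)).
Local Notation V := 'rV[C R]_n.+1.

Lemma differential_evalp (v h : V) : 'd (evalp F) v h = dir_deriv F h v.
Proof.
set p := line_poly F v h; have pE := horner_line_poly F v h.
have [s sE] : exists s, p = p.[0]%:P + 'X * s.
  have /factor_theorem[s sE] : root (p - p.[0]%:P) 0 by rewrite rootE !hornerE subrr.
  by exists s; rewrite mulrC -['X]subr0 -polyC0 -sE addrC subrK.
have <- : s.[0] = dir_deriv F h v.
  have := horner_deriv_line_poly F v h 0; rewrite scale0r addr0 => <-.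
  by rewrite -/p sE derivD derivC add0r derivM derivX mul1r !hornerE.
apply/esym/eqP; rewrite -subr_eq0 -nrm_eq0 eq_le nrm_ge0 andbT.
apply/ler_addgt0Pr => e e0; rewrite add0r.
have e2 : 0 < e / 2 by rewrite divr_gt0.
pose N := nrm h + 1; have N0 : 0 < N by rewrite ltr_wpDl ?nrm_ge0.
have eN : 0 < e / 2 / N by rewrite divr_gt0.
have [r r0 hr] := differential_eps (evalp_differentiable F v) eN.
have [q q0 hq] := (continuous_eps _ _).1 (differentiable_continuous (horner_differentiable s 0)) _ e2.
pose a := Num.min (r / N) q / 2.
have m0 : 0 < Num.min (r / N) q by rewrite lt_min q0 divr_gt0.
have a0 : 0 < a by rewrite divr_gt0.
have am : a < Num.min (r / N) q by rewrite /a; lra.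
move: am; rewrite lt_min => /andP[ar aq].
have at_ : nrm (a%:C : C R) = a by rewrite nrmR gtr0_norm.
have := hr (a%:C *: h); rewrite linearZ /= -pE.
have -> : evalp F v = p.[0] by rewrite pE scale0r addr0.
rewrite -/p.
have -> : p.[a%:C] - p.[0] = a%:C * s.[a%:C] by rewrite {1}sE !hornerE addrAC subrr add0r.
rewrite nrmZ at_ -mulrBr nrmM at_ => le1.
have : nrm (s.[a%:C] - 'd (evalp F) v h) <= e / 2.
  rewrite -(ler_pM2l a0); apply: le_trans (le1 _) _.
    apply: le_lt_trans (_ : a * N < r); last by rewrite -ltr_pdivlMr.
    by rewrite ler_wpM2l ?lerDl // ltW.
  rewrite mulrCA; apply: ler_wpM2l; first exact: ltW.
  rewrite mulrAC ler_pdivrMr //; apply: ler_wpM2l; first exact: ltW.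
  by rewrite lerDl.
have := hq a%:C; rewrite subr0 at_ => /(_ aq).
have -> : s.[0] - 'd (evalp F) v h = (s.[a%:C] - 'd (evalp F) v h) - (s.[a%:C] - s.[0]) by ring.
move=> h1 h2; apply: le_trans (nrmD _ _) _; rewrite nrmN; lra.
Qed.

Lemma dir_derivD b b' (v : V) : dir_deriv F (b + b') v = dir_deriv F b v + dir_deriv F b' v.
Proof. by rewrite /dir_deriv -big_split; apply: eq_bigr => i _; rewrite mxE mulrDl. Qed.

Lemma dir_deriv_scale a b (v : V) : dir_deriv F (a *: b) v = a * dir_deriv F b v.
Proof. by rewrite /dir_deriv mulr_sumr; apply: eq_bigr => i _; rewrite mxE mulrA. Qed.

(* The implicit function theorem, for a branch already known to be continuous. *)
Lemma implicit_differentiable (b b1 : V) (p : C R -> V) (s : C R -> C R) x : 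
  {for x, continuous s} -> (forall z, p z = p x + (z - x) *: b1) ->
  (forall z, evalp F (p z + s z *: b) = 0) -> dir_deriv F b (p x + s x *: b) != 0 ->
  differentiable s x.
Proof.
move=> cs pE Fs; set w := p x + s x *: b => Bw.
set B := dir_deriv F b w in Bw *; set A := dir_deriv F b1 w.
have B0 : 0 < nrm B by rewrite nrm_gt0.
pose N := nrm b1 + nrm b + 1.
have N0 : 0 < N by rewrite ltr_wpDl ?addr_ge0 ?nrm_ge0.
have approx e : 0 < e -> exists2 r : R, 0 < r & forall z, nrm (z - x) < r ->
    nrm ((z - x) * A + (s z - s x) * B) <= e * (nrm (z - x) + nrm (s z - s x)).
  move=> e0; have eN : 0 < e / N by rewrite divr_gt0.
  have [r r0 hr] := differential_eps (evalp_differentiable F w) eN.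
  have rN : 0 < r / (2 * N) by rewrite divr_gt0 // mulr_gt0.
  have [q q0 hq] := (continuous_eps _ _).1 cs _ rN.
  exists (Num.min q (r / (2 * N))); first by rewrite lt_min q0.
  move=> z; rewrite lt_min => /andP[/hq zq zr].
  have hz : nrm ((z - x) *: b1 + (s z - s x) *: b) <= N * (nrm (z - x) + nrm (s z - s x)).
    apply: le_trans (nrmD _ _) _; rewrite !nrmZ mulrDr !(mulrC N).
    by apply: lerD; apply: ler_wpM2l; rewrite ?nrm_ge0 // /N; have := nrm_ge0 b;
      have := nrm_ge0 b1; lra.
  have := hr ((z - x) *: b1 + (s z - s x) *: b).
  rewrite differential_evalp dir_derivD !dir_deriv_scale -/A -/B.
  have -> : w + ((z - x) *: b1 + (s z - s x) *: b) = p z + s z *: b.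
    by rewrite (pE z) /w; apply/rowP => j; rewrite !mxE; ring.
  rewrite !Fs subrr sub0r nrmN => h; apply: le_trans (h _) _.
    apply: le_lt_trans hz _; move: zq zr; rewrite !ltr_pdivlMr ?mulr_gt0 //; lra.
  rewrite mulrAC ler_pdivrMr // -mulrA (mulrC _ N); apply: ler_wpM2l => //; exact: ltW.
(* With [e] half of [nrm B], the term in [s z - s x] is absorbed by the left side, which gives a
   Lipschitz bound at [x]. *)
have [r1 r10 h1] : exists2 r : R, 0 < r & forall z, nrm (z - x) < r ->
    nrm (s z - s x) <= (2 * nrm A / nrm B + 1) * nrm (z - x).
  have [r r0 hr] := approx (nrm B / 2) (divr_gt0 B0 (ltr0n _ 2)).
  exists r => // z /hr hz.
  have : nrm (s z - s x) * nrm B <= nrm ((z - x) * A + (s z - s x) * B) + nrm (z - x) * nrm A.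
    rewrite -!nrmM -(nrmN ((z - x) * A)); apply: le_trans (nrmD _ _).
    by apply: eq_le_nrm; ring.
  move=> hz'; rewrite -(ler_pM2l B0).
  have -> : nrm B * ((2 * nrm A / nrm B + 1) * nrm (z - x)) =
      2 * (nrm A * nrm (z - x)) + nrm B * nrm (z - x) by field; rewrite gt_eqF.
  move: hz hz'; rewrite mulrDr (mulrC (nrm (s z - s x))) (mulrC (nrm (z - x))).
  by move: (nrm A * _) (nrm ((z - x) * A + _)) => t1 t2; lra.
pose K := 2 * nrm A / nrm B + 1.
have K0 : 0 < K by rewrite ltr_wpDl // divr_ge0 ?mulr_ge0 ?nrm_ge0.
apply/differentiable_eps; exists (- (A / B)) => e e0.
have K1 : 0 < 1 + K by rewrite addr_gt0.
have e'0 : 0 < e * nrm B / (1 + K) by rewrite divr_gt0 ?mulr_gt0 // addr_gt0.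
have [r r0 hr] := approx _ e'0.
exists (Num.min r r1); first by rewrite lt_min r0.
move=> z; rewrite lt_min => /andP[/hr zr /h1 zr1].
have -> : s z - s x - - (A / B) * (z - x) = ((z - x) * A + (s z - s x) * B) / B by field.
rewrite nrmM nrmV ler_pdivrMr //; apply: le_trans zr _.
rewrite -!mulrA ler_pM2l // mulrCA mulrC -mulrA mulrA ler_pdivrMr //.
move: zr1; rewrite -/K; move: (nrm (s z - s x)) (nrm (z - x)) => a c; nra.
Qed.

End LinearApproximation.

(** * No sheet of degree one on a curve of degree at least two *)

Section SingleSheet.
Variables (R : realType) (n d : nat).
Local Notation V := 'rV[C R]_n.+1.
Variables (F : mpoly n.+1 (C R)) (E : V -> Prop) (b0 b1 b : V).
Hypothesis hF : F \is ishomog1 d.+2 mdeg.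
Hypothesis Fb : evalp F b != 0.
Hypothesis hE : forall v, v != 0 -> evalp F v = 0 -> exists2 e : R, 0 < e &
  forall v', nrm (v' - v) < e -> evalp F v' = 0 -> (E v' <-> E v).
Hypothesis EZ : forall a v, a != 0 -> v != 0 -> E v -> E (a *: v).
Hypothesis free : forall s t y : C R, s *: b0 + t *: b1 + y *: b = 0 -> s = 0 /\ t = 0.

Local Notation sheet := (sheet F E).

Lemma off_center s t y : (s != 0) || (t != 0) -> s *: b0 + t *: b1 + y *: b != 0.
Proof. by apply: contraTneq => /free[-> ->]; rewrite eqxx. Qed.

(** The property is open and closed along the complex line from [b1] to [b0 + x *: b1], which
    contains no multiple of [b]. *)
Lemma single_simple_root_everywhere x :
  single_simple_root F E b b1 -> single_simple_root F E b (b0 + x *: b1).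
Proof.
move=> T1; pose dd := b0 + (x - 1) *: b1; pose w (z : C R) : V := b1 + z *: dd.
have wE z y : w z + y *: b = z *: b0 + (1 + z * (x - 1)) *: b1 + y *: b.
  by rewrite /w /dd; apply/rowP => j; rewrite !mxE; ring.
have wb z y : w z + y *: b != 0.
  rewrite wE; apply: off_center; have [->|//] := eqVneq z 0.
  by rewrite mul0r addr0 oner_eq0.
have -> : b0 + x *: b1 = w 1 by rewrite /w /dd; apply/rowP => j; rewrite !mxE; ring.
have ww z z' : nrm (w z' - w z) <= nrm (z' - z) * (nrm dd + 1).
  have -> : w z' - w z = (z' - z) *: dd by apply/rowP => j; rewrite !mxE; ring.
  by rewrite nrmZ ler_wpM2l ?nrm_ge0 // lerDl.
have N0 : 0 < nrm dd + 1 by rewrite ltr_wpDl ?nrm_ge0.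
have wd z e z' : disc z (e / (nrm dd + 1)) z' -> nrm (w z' - w z) < e.
  by rewrite /disc /= ltr_pdivlMr // => h; exact: le_lt_trans (ww z z') h.
have T0 : single_simple_root F E b (w 0) by rewrite /w scale0r addr0.
move: T0; apply: (@clopen_plane R (fun z => single_simple_root F E b (w z))) => z.
have [Tz|nTz] := pselect (single_simple_root F E b (w z)).
  have [e e0 he] := single_simple_root_open hF Fb hE (wb z) Tz.
  exists (e / (nrm dd + 1)); first by rewrite divr_gt0.
  by left => z' /wd /he.
have [e e0 he] : exists2 e : R, 0 < e & forall w', nrm (w' - w z) < e -> ~ single_simple_root F E b w'.
  apply: contrapT => h; apply: nTz; apply: (single_simple_root_closed hF Fb hE (wb z)).
  move=> e e0; apply: contrapT => h'; apply: h; exists e => // w' we Tw'.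
  by apply: h'; exists w'.
exists (e / (nrm dd + 1)); first by rewrite divr_gt0.
by right => z' /wd /he.
Qed.

(** The degree [d.+2] enters through the derivative, homogeneous of degree [d.+1 >= 1], which makes
    [g] unbounded at infinity. *)
Lemma no_single_simple_sheet : ~ (sheet b1 /\ dir_deriv F b b1 != 0 /\
  forall y, sheet (b1 + y *: b) -> y = 0).
Proof.
have far (c t1 t2 t3 : R) : t1 - t2 <= t3 -> t3 < c -> t1 = c + c -> c <= t2 by lra.
move=> [sb1 [db1 ub1]].
have T1 : single_simple_root F E b b1.
  exists 0; rewrite scale0r addr0; split => //; exact: ub1.
have /choice[s hs] x := @single_simple_root_everywhere x T1.
pose p (x : C R) : V := b0 + x *: b1.
have pb x y : p x + y *: b != 0.
  by rewrite /p -[b0]scale1r; apply: off_center; rewrite oner_eq0.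
have ss x : sheet (p x + s x *: b) by have [] := hs x.
have us x y : sheet (p x + y *: b) -> y = s x by have [_ + _] := hs x; exact.
have pE x z : p z = p x + (z - x) *: b1 by apply/rowP => j; rewrite !mxE; ring.
have N0 : 0 < nrm b1 + 1 by rewrite ltr_wpDl ?nrm_ge0.
have cs x : {for x, continuous s}.
  apply/continuous_eps => e e0.
  have [r r0 hr] := sheet_roots_near hF Fb hE (pb x) e0.
  exists (r / (nrm b1 + 1)); first by rewrite divr_gt0.
  move=> z; rewrite ltr_pdivlMr // => zx.
  have [|y /us ->//] := hr (p z) (s z) _ (ss z).
  rewrite (pE x z) addrC addKr nrmZ; apply: le_lt_trans zx.
  by rewrite ler_wpM2l ?nrm_ge0 // lerDl.
pose g x := dir_deriv F b (p x + s x *: b).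
have g0 x : g x != 0 by have [] := hs x.
have ds x : differentiable s x.
  apply: (@implicit_differentiable _ _ F b b1 p) => //; last exact: g0.
  by move=> z; have [] := ss z.
have dg x : differentiable g x.
  apply: (@differentiable_comp _ _ _ _ (fun x => p x + s x *: b) (dir_deriv F b)).
    apply: differentiableD; first exact: affine_differentiable.
    exact: differentiableZl.
  exact: dir_deriv_differentiable.
have dg1 x : differentiable (fun x => (g x)^-1) x by exact: differentiableV.
have b1b y : b1 + y *: b != 0.
  by have := @off_center 0 1 y; rewrite scale0r add0r scale1r oner_eq0 orbT; exact.
have [c c0 cE] : exists2 c : R, 0 < c & nrm (dir_deriv F b b1) = c + c.
  exists (nrm (dir_deriv F b b1) / 2); first by rewrite divr_gt0 // nrm_gt0.
  exact: splitr.
have [e1 e10 he1] := dir_deriv_near F b b1 0 c0.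
have [e2 e20 he2] := sheet_roots_near hF Fb hE b1b e10.
have M0 : 0 < nrm b0 + 1 by rewrite ltr_wpDl ?nrm_ge0.
(* Divided by [x], the sheet point over [p x] lies over [b1 + x^-1 *: b0], close to [b1]. As [0] is
   the only sheet root over [b1], [s x / x] is small, and the derivative there has at least half of
   its norm at [b1]. *)
have growth : exists K : R, forall x, K <= nrm x -> c * nrm x <= nrm (g x).
  exists (Num.max 1 ((nrm b0 + 1) / Num.min e1 e2)) => x.
  have m0 : 0 < Num.min e1 e2 by rewrite lt_min e10.
  rewrite ge_max ler_pdivrMr // => /andP[x1 xb].
  have x0 : 0 < nrm x by apply: lt_le_trans x1.
  have xn : x != 0 by rewrite -nrm_gt0.
  pose w := b1 + x^-1 *: b0; pose y := x^-1 * s x.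
  have wy : p x + s x *: b = x *: (w + y *: b).
    by rewrite /w /y /p !scalerDr !scalerA mulVKf // mulfV // scale1r (addrC b0).
  have wb : nrm (w - b1) < Num.min e1 e2.
    rewrite /w addrC addKr nrmZ nrmV ltr_pdivrMl //.
    by apply: lt_le_trans xb; rewrite ltrDl.
  move: wb; rewrite lt_min => /andP[wb1 wb2].
  have sy : sheet (w + y *: b).
    have -> : w + y *: b = x^-1 *: (p x + s x *: b) by rewrite wy scalerA mulVf // scale1r.
    have [Fx Ex] := ss x; split; last by apply: EZ => //; rewrite invr_eq0.
    by rewrite (evalpZ _ _ hF) Fx mulr0.
  have [r' /ub1 -> ye] := he2 w y wb2 sy.
  have := he1 w y wb1 ye; rewrite scale0r addr0 => hc.
  have gE : nrm (g x) = nrm x ^+ d.+1 * nrm (dir_deriv F b (w + y *: b)).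
    by rewrite /g wy (dir_derivZ _ _ _ hF) nrmM nrmX.
  rewrite gE mulrC; apply: ler_pM; rewrite ?nrm_ge0 ?(ltW c0) //.
    by rewrite exprS ler_peMr ?nrm_ge0 // exprn_ege1.
  apply: (far _ _ _ _ _ hc cE); rewrite [leRHS]nrmB; exact: nrmBr.
have [K hK] := growth.
have : (g 0)^-1 = 0.
  apply: (vanishing_entire dg1) => e e0; exists (Num.max K (1 / (c * e))) => x.
  rewrite ge_max => /andP[/hK h1]; rewrite ler_pdivrMr ?mulr_gt0 // => h2.
  have gx : 0 < nrm (g x) by rewrite nrm_gt0.
  rewrite nrmV -[leLHS]mul1r ler_pdivrMr //; apply: le_trans h2 _.
  by rewrite mulrA (mulrC (nrm x)) (mulrC _ e) ler_wpM2l // ltW.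
by move/eqP; rewrite invr_eq0 (negbTE (g0 0)).
Qed.

End SingleSheet.

(** * The two restrictions of a map on the glued surface *)

Section SideRestriction.
Variables (R : realType) (m n : nat).
Local Notation Pm := (projective_space R m).
Local Notation Pn := (projective_space R n).
Variables (V W U : set Pm) (oV : open V) (oW : open W) (hU : clopen_part (V `&` W) U).
Local Notation S := (glue_along oV oW hU).
Variable f : S -> Pn.

Definition copy_of b (l : Pm) (bl : side V W b l) : copies V W :=
  existT _ b (exist _ l (mem_set bl)).

(** Read on the projective space itself, the two copies of [f] can be compared; off the side the
    value is arbitrary. *)
Definition restriction b (l : Pm) : Pn :=
  match pselect (side V W b l) with
  | left bl => f (\pi_(glued V W U) (copy_of bl))
  | right _ => point_of 0
  end.

Lemma restriction_pi (p : copies V W) :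
  restriction (projT1 p) (copy_point p) = f (\pi_(glued V W U) p).
Proof.
rewrite /restriction; case: pselect => [bl|[]]; last exact: copy_side.
congr f; apply/eqmodP; by rewrite /= /glue_rel !eqxx.
Qed.

Lemma restriction_eq l : U l -> restriction false l = restriction true l.
Proof.
move=> Ul; have [sU _ _] := hU; have [Vl Wl] := sU l Ul.
rewrite (restriction_pi (@copy_of false l Vl)) (restriction_pi (@copy_of true l Wl)).
by congr f; apply/eqmodP; rewrite /= /glue_rel eqxx (mem_set Ul) orbT.
Qed.

Lemma restriction_inj l : injective f -> V l -> W l ->
  restriction false l = restriction true l -> U l.
Proof.
move=> fi Vl Wl.
rewrite (restriction_pi (@copy_of false l Vl)) (restriction_pi (@copy_of true l Wl)).
by move=> /fi /eqmodP; rewrite /= /glue_rel eqxx /= => /set_mem.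
Qed.

Lemma restriction_holomorphic b : holomorphic f ->
  holomorphic_proj (side V W b) (restriction b).
Proof.
move=> [fc fh] v /coneE[v0 bv].
set x := \pi_(glued V W U) (copy_of bv).
have [i il] := proj_cover (point_of v).
have [k kl] := proj_cover (f x).
pose c : chart S 'rV_m := @glued_chart R m Pm V W U _ b (affine_chart R i).
pose c' : chart Pn 'rV_n := affine_chart R k.
have ac : atlas c by exists b, (affine_chart R i); split => //; exists i.
have ac' : atlas c' by exists k.
have [g gE dg] := fh c c' ac ac'.
pose D := chart_dom c `&` f @^-1` chart_dom c'.
have oD : open D.
  have oc : open (chart_dom c) by have [] := atlas_chart ac.
  have oc' : open (chart_dom c') by have [] := atlas_chart ac'.
  by apply: (openI oc); apply: open_comp oc' => y _; exact: fc.
have := dev_open oV oW oD; rewrite proj_openE => oO.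
(* The lift is the local expression [g] of [f] in affine charts, completed by a coordinate [1]. *)
exists (fun w => homog_coord k (g (inhom i w))).
have nv : nbhs v (cone (@glue_proj R m Pm V W U @` D)).
  apply: open_nbhs_nbhs; split => //; apply/coneE; split => //.
  exists x; last by rewrite /x dev_pi.
  split => //; exists (copy_of bv) => //.
apply: filterS nv => w /coneE[w0 [t [ct c't] tw]].
have [p [pb cp] tE] := ct.
have wl := point_of_mem w0.
have wp : point_of w = copy_point p by rewrite -tw tE dev_pi.
have wi : w 0 i != 0 by apply/(proj_domE i w0 wl); rewrite wp.
have cE : c t = inhom i w by rewrite -(proj_chartE i w0 wl) -tw.
have dgw : differentiable g (inhom i w) by apply: dg; exists t.
have [u ul uk] := c't.
have gw : g (inhom i w) = inhom k u.
  by rewrite -cE gE // /c' (proj_chartE k (row_neq0 uk) ul).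
split.
- move=> j; apply: (@differentiable_comp _ _ _ _ (fun w => homog_coord k (g (inhom i w))) (fun u => u 0 j)).
    apply: (@differentiable_comp _ _ _ _ (fun w => g (inhom i w)) (homog_coord k)); last exact: hom_diff.
    by apply: (@differentiable_comp _ _ _ _ (inhom i) g) => //; exact: inhom_diff.
  exact: differentiable_coord.
- by apply: (@row_neq0 _ _ _ k); rewrite hom_i oner_eq0.
- by apply/coneE; split => //; rewrite wp -pb; exact: copy_side.
- have -> : restriction b (point_of w) = f t by rewrite wp -pb restriction_pi -tE.
  by rewrite gw hom_inhom // memvZ.
Qed.

End SideRestriction.

(** * Tangents of plane curves and comparison of relations *)

Section PlaneGeometry.
Variable R : realType.

Lemma zero_locusE n d (F : mpoly n.+1 (C R)) v : F \is ishomog1 d mdeg -> v != 0 ->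
  zero_locus F (point_of v) <-> evalp F v = 0.
Proof.
move=> hF v0; split=> [h|Fv w]; first by apply: h; exact: point_of_mem.
rewrite (lineE v0 (point_of_mem v0)) => /vlineP[a ->].
by rewrite (evalpZ _ _ hF) Fv mulr0.
Qed.

Lemma evalp_linear n (G : mpoly n.+1 (C R)) v b (y : C R) : G \is ishomog1 1 mdeg ->
  evalp G (v + y *: b) = evalp G v + y * evalp G b.
Proof.
move=> hG; have [sp p1] := line_poly_top v b hG.
rewrite -horner_line_poly -p1 (horner_coef_wide _ sp) !big_ord_recl big_ord0 /=.
by rewrite expr0 expr1 mulr1 addr0 -horner_coef0 horner_line_poly scale0r addr0 mulrC.
Qed.

Lemma dir_deriv_linear n (G : mpoly n.+1 (C R)) v b : G \is ishomog1 1 mdeg ->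
  dir_deriv G b v = evalp G b.
Proof.
move=> hG; have [sp p1] := line_poly_top v b hG.
rewrite -[v]addr0 -(scale0r b) -horner_deriv_line_poly horner_coef0 coef_deriv mulr1n.
exact: p1.
Qed.

(** Euler's relation, from [evalp F (v + y *: v) = (1 + y) ^+ d * evalp F v]. *)
Lemma dir_deriv_radial n d (F : mpoly n.+1 (C R)) v : F \is ishomog1 d mdeg ->
  evalp F v = 0 -> dir_deriv F v v = 0.
Proof.
move=> hF Fv; have pE : line_poly F v v = evalp F v *: (1 + 'X) ^+ d.
  rewrite line_polyE evalpE scaler_suml; move: hF => /dhomogP hF.
  apply: eq_big_seq => m /hF md; rewrite mul_polyC -scalerA; congr (_ *: _).
  rewrite (eq_bigr (fun i => (v 0 i ^+ m i)%:P * (1 + 'X) ^+ m i)) => [|i _].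
    by rewrite big_split /= -rmorph_prod -expr_sum -mdegE md mul_polyC.
  by rewrite -mul_polyC polyC_exp -exprMn mulrDr mulr1.
rewrite -{2}[v]addr0 -(scale0r v) -horner_deriv_line_poly pE Fv scale0r derivC.
by rewrite horner0.
Qed.

Lemma gradientE n (F : mpoly n.+1 (C R)) v b : (gradient F v *m b^T) 0 0 = dir_deriv F b v.
Proof. by rewrite mxE; apply: eq_bigr => i _; rewrite !mxE mulrC. Qed.

Lemma col_mx_free n (u0 u1 : 'rV[C R]_n) :
  (forall s t, s *: u0 + t *: u1 = 0 -> s = 0 /\ t = 0) -> row_free (col_mx u0 u1).
Proof.
move=> fr; apply: inj_row_free => x.
rewrite -[x]hsubmxK mul_row_col (mx11_scalar (lsubmx x)) (mx11_scalar (rsubmx x)).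
rewrite !mul_scalar_mx => /fr[-> ->].
by rewrite !raddf0 row_mx0.
Qed.

Lemma independent_points n (l l' : proj_point R n) u u' : l != l' ->
  u != 0 -> u' != 0 -> u \in line l -> u' \in line l' ->
  forall s t, s *: u + t *: u' = 0 -> s = 0 /\ t = 0.
Proof.
move=> ll' u0 u'0 ul u'l' s t st.
have [t0|tn] := eqVneq t 0.
  split => //; move: st; rewrite t0 scale0r addr0 => /eqP.
  by rewrite scaler_eq0 (negbTE u0) orbF => /eqP.
case/eqP: ll'; apply: (line_inj_in u'0) => //.
have -> : u' = - (t^-1 * s) *: u.
  rewrite scaleNr -scalerA; apply/eqP; rewrite -subr_eq0 opprK addrC.
  by rewrite -[X in _ + X](scalerK tn) -scalerDr st scaler0.
by rewrite memvZ.
Qed.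

Lemma mulmx_tr_col0 n (x y u v : 'rV[C R]_n) :
  (x *m u^T) 0 0 = 0 -> (x *m v^T) 0 0 = 0 ->
  (y *m u^T) 0 0 = 0 -> (y *m v^T) 0 0 = 0 -> col_mx x y *m (col_mx u v)^T = 0.
Proof.
have zero (A : 'M[C R]_1) : A 0 0 = 0 -> A = 0.
  by move=> A0; apply/matrixP => i j; rewrite !ord1 A0 mxE.
move=> /zero h1 /zero h2 /zero h3 /zero h4.
by rewrite tr_col_mx mul_col_mx !mul_mx_row h1 h2 h3 h4 row_mx0 col_mx0.
Qed.

(** Both gradients kill [u0], and that of [G] kills [u1]. If that of [F] killed [u1] too, two
    matrices of rank [2] would have product zero in dimension [3]. *)
Lemma transversal_dir_deriv d (F G : mpoly 3 (C R)) u0 u1 (c : C R) :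
  F \is ishomog1 d mdeg -> G \is ishomog1 1 mdeg ->
  row_free (col_mx (gradient F u0) (gradient G u0)) ->
  (forall s t, s *: u0 + t *: u1 = 0 -> s = 0 /\ t = 0) ->
  evalp F u0 = 0 -> evalp G u0 = 0 -> evalp G u1 = 0 -> c != 0 ->
  dir_deriv F (u0 + c *: u1) u0 != 0.
Proof.
move=> hF hG fr ind Fu0 Gu0 Gu1 c0; apply/negP => /eqP.
rewrite dir_derivD dir_deriv_scale (dir_deriv_radial hF Fu0) add0r => /eqP.
rewrite mulf_eq0 (negbTE c0) /= => /eqP Fu1.
have /mulmx0_rank_max : col_mx (gradient F u0) (gradient G u0) *m (col_mx u0 u1)^T = 0.
  apply: mulmx_tr_col0; rewrite gradientE.
  - exact: dir_deriv_radial hF Fu0.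
  - exact: Fu1.
  - by rewrite (dir_deriv_linear _ _ hG).
  - by rewrite (dir_deriv_linear _ _ hG).
by rewrite mxrank_tr (eqP fr) (eqP (col_mx_free ind)).
Qed.

(** A holomorphic function that vanishes near [z] vanishes along the complex line from [z] to
    [v0]. *)
Lemma dense_nonzero n (q : 'rV[C R]_n.+1 -> C R) v0 z (e : R) :
  (forall v, differentiable q v) -> q v0 != 0 -> 0 < e ->
  exists2 v, nrm (v - z) < e & q v != 0.
Proof.
move=> dq qv0 e0; apply: contrapT => h; case/eqP: qv0.
pose k (t : C R) := q (z + t *: (v0 - z)).
have -> : q v0 = k 1 by rewrite /k scale1r addrC subrK.
apply: (@identity_disc R k 0 12 (ltr0n _ 12)).
- by move=> t _; apply: (@differentiable_comp _ _ _ _ (fun t : C R => z + t *: (v0 - z)) q).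
- have ca := differentiable_continuous (affine_differentiable z (v0 - z) 0).
  have : \forall y \near (z + 0 *: (v0 - z)), q y = 0.
    rewrite scale0r addr0; apply/nbhs_nrm; exists e => // y ye.
    by apply/eqP/negPn/negP => qy; apply: h; exists y.
  move=> /(near_comp ca) /nbhs_nrm[r r0 hr].
  by exists r => // t; exact: hr.
- rewrite /disc /= subr0 nrm1; lra.
Qed.

Lemma near_neq0 (U : normedModType (C R)) (k : U -> C R) z :
  differentiable k z -> k z != 0 -> \forall w \near z, k w != 0.
Proof.
move=> dk kz; apply: (@near_comp _ _ _ k z (fun y => y != 0) (differentiable_continuous dk)).
by apply: open_nbhs_nbhs; split => //; exact: open_neq0C.
Qed.

(** Some [q i] may vanish at [z], where the relation then says little. Points with [q a] and [q b]
    non-zero are dense near [z]; there the minors of the two lifts vanish, hence also at [z]. *)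
Lemma satisfies_agree m n (O O' : set (proj_point R m))
    (phi phi' : proj_point R m -> proj_point R n)
    (p q : 'I_n.+1 -> 'rV[C R]_m.+1 -> C R) i0 z :
  holomorphic_proj O phi -> holomorphic_proj O' phi' -> cone O z -> cone O' z ->
  (forall i v, differentiable (q i) v) -> (forall i, exists v, q i v != 0) ->
  satisfies p q i0 phi z -> satisfies p q i0 phi' z -> phi (point_of z) = phi' (point_of z).
Proof.
move=> hphi hphi' Oz O'z dq qn sat sat'.
have [g hg] := hphi z Oz; have [g' hg'] := hphi' z O'z.
have [dg g0 _ gl] := nbhs_singleton hg; have [dg' g'0 _ gl'] := nbhs_singleton hg'.
have minor a b : g z 0 a * g' z 0 b = g z 0 b * g' z 0 a.
  pose k w := g w 0 a * g' w 0 b - g w 0 b * g' w 0 a.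
  apply/eqP; rewrite -subr_eq0; apply/negPn/negP => kz.
  have dk : differentiable k z.
    by apply: differentiableB; apply: differentiableM; (exact: dg || exact: dg').
  have : \forall w \near z, k w != 0.
    exact: near_neq0 dk kz.
  move=> kn; have [r1 r10 h1] := (nbhs_nrm z _).1 kn.
  have [r2 r20 h2] := (nbhs_nrm z _).1 hg; have [r3 r30 h3] := (nbhs_nrm z _).1 hg'.
  have [r4 r40 h4] := (nbhs_nrm z _).1 sat; have [r5 r50 h5] := (nbhs_nrm z _).1 sat'.
  have r0 : 0 < Num.min r1 (Num.min (Num.min r2 r3) (Num.min r4 r5)).
    by rewrite !lt_min r10 r20 r30 r40.
  set r := Num.min _ _ in r0.
  have [va qva] := qn a; have [vb qvb] := qn b.
  have [v vz qav] := dense_nonzero z (dq a) qva r0.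
  have [r' r'0 hr'] : exists2 e : R, 0 < e & forall w, nrm (w - v) < e -> q a w != 0.
    by apply/nbhs_nrm; exact: near_neq0 (dq a v) qav.
  have rr : 0 < Num.min r' (r - nrm (v - z)) by rewrite lt_min r'0 subr_gt0.
  have [w] := dense_nonzero v (dq b) qvb rr.
  rewrite lt_min => /andP[/hr' qaw wv] qbw.
  have wz : nrm (w - z) < r.
    have -> : w - z = (w - v) + (v - z) by rewrite addrA subrK.
    by apply: le_lt_trans (nrmD _ _) _; rewrite -ltrBrDr.
  move: wz; rewrite /r !lt_min => /and3P[/h1/negP kw /andP[/h2[_ _ /coneE[w0 _] wl] /h3[_ _ _ wl']]].
  move=> /andP[/h4 s /h5 s'].
  have sa := s w0 _ wl a; have sb := s w0 _ wl b.
  have sa' := s' w0 _ wl' a; have sb' := s' w0 _ wl' b.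
  apply: kw; rewrite /k subr_eq0; apply/eqP/(mulfI (mulf_neq0 qaw qbw)).
  rewrite [LHS]mulrACA sa sb'.
  have -> : q a w * q b w * (g w 0 b * g' w 0 a) = (q b w * g w 0 b) * (q a w * g' w 0 a).
    by ring.
  by rewrite sb sa'; ring.
have [b gb] : exists b, g' z 0 b != 0.
  apply: contrapT => h; case/eqP: g'0; apply/rowP => j; rewrite mxE.
  by apply/eqP/negPn/negP => vj; apply: h; exists j.
have gE : g z = (g z 0 b / g' z 0 b) *: g' z.
  apply/rowP => a; rewrite mxE mulrAC -minor mulfK //.
by apply: (line_inj_in g0) => //; rewrite gE memvZ.
Qed.

Lemma satisfies_along m n (O : set (proj_point R m)) (phi : proj_point R m -> proj_point R n)
    (p q : 'I_n.+1 -> 'rV[C R]_m.+1 -> C R) i0 v w t :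
  holomorphic_proj O phi ->
  (forall i x, differentiable (p i) x) -> (forall i x, differentiable (q i) x) ->
  (forall t : C R, cone O (v + t *: w)) ->
  satisfies p q i0 phi v -> satisfies p q i0 phi (v + t *: w).
Proof.
move=> hphi dp dq Ovw sat.
have : satisfies p q i0 phi (v + 0 *: w) by rewrite scale0r addr0.
apply: (@clopen_plane R (fun t => satisfies p q i0 phi (v + t *: w))) => z.
have [e e0 he] := satisfies_propagate hphi (Ovw z).
have ca := differentiable_continuous (affine_differentiable v w z).
have /(near_comp ca) /nbhs_nrm[r r0 hr] : \forall x \near v + z *: w, nrm (x - (v + z *: w)) < e.
  by apply/nbhs_nrm; exists e.
exists r => //; have [sz|nsz] := pselect (satisfies p q i0 phi (v + z *: w)).
  left => x /hr xe; apply: (he _ _ _ dp dq _ _ _ xe sz).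
  by rewrite subrr nrm0.
right => x /hr xe sx; apply: nsz; apply: (he _ _ _ dp dq _ _ xe _ sx).
by rewrite subrr nrm0.
Qed.

(** The line meets the curve in at most [d] points, so one of [d.+1] points of the line is off the
    curve. *)
Lemma pencil_point d (F G : mpoly 3 (C R)) (P : 'I_d -> projective_space R 2) u0 u1 :
  F \is ishomog1 d mdeg -> G \is ishomog1 1 mdeg ->
  range P = zero_locus F `&` zero_locus G ->
  (forall s t, s *: u0 + t *: u1 = 0 -> s = 0 /\ t = 0) ->
  evalp G u0 = 0 -> evalp G u1 = 0 -> exists c, evalp F (u0 + c *: u1) != 0.
Proof.
move=> hF hG hP ind Gu0 Gu1; apply: contrapT => h.
have Fc c : evalp F (u0 + c *: u1) = 0.
  by apply/eqP/negPn/negP => Fc; apply: h; exists c.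
have nz c : u0 + c *: u1 != 0.
  by apply/eqP => /esym; rewrite -{1}[u0]scale1r => /esym /ind[/eqP]; rewrite oner_eq0.
have /choice[h' hh'] : forall k : 'I_d.+1, exists j, P j = point_of (u0 + (k : nat)%:R *: u1).
  move=> k; have : range P (point_of (u0 + (k : nat)%:R *: u1)).
    rewrite hP; split; first by apply/(zero_locusE hF (nz _)); exact: Fc.
    by apply/(zero_locusE hG (nz _)); rewrite evalp_linear // Gu0 Gu1 mulr0 addr0.
  by move=> [j _ <-]; exists j.
suff /leq_card : injective h' by rewrite !card_ord ltnn.
move=> k k' kk'; have /esym e := hh' k; rewrite kk' hh' in e.
have := point_of_mem (nz (k : nat)%:R); rewrite e.
rewrite (lineE (nz (k' : nat)%:R) (point_of_mem (nz _))) => /vlineP[a aE].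
have : (1 - a) *: u0 + ((k : nat)%:R - a * (k' : nat)%:R) *: u1 = 0.
  rewrite !scalerBl scale1r addrACA aE scalerDr scalerA -opprD subrr. by [].
move=> /ind[/eqP]; rewrite subr_eq0 => /eqP <-; rewrite mul1r => /eqP.
by rewrite subr_eq0 eqr_nat => /eqP /ord_inj.
Qed.

End PlaneGeometry.

(** * The contradiction on the glued surface *)

Theorem proposition4p1 (R : realType) (d : nat) (hd : (1 < d)%N)
    (F G : mpoly 3 (C R)) (P : 'I_d -> projective_space R 2)
    (V0 W0 : set (projective_space R 2))
    (hF : smooth_plane_curve d F) (hG : plane_line G)
    (hFG : transversal_curves F G)
    (P_inj : injective P)
    (hP : range P = zero_locus F `&` zero_locus G)
    (hV0 : tubular_neighborhood (zero_locus F) V0)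
    (hW0 : tubular_neighborhood (zero_locus G) W0)
    (hU : component_points (V0 `&` W0) P) :
  ~ algebraizable
      (glue_along (tubular_open hV0) (tubular_open hW0)
         (component_clopen (Ordinal (ltnW hd))
            (openI (tubular_open hV0) (tubular_open hW0)) hU)).
Proof.
set j0 := Ordinal _; set oV := tubular_open hV0; set oW := tubular_open hW0.
set cU := component_clopen _ _ _.
move=> [n [_ [f [_ [fhol _ finj _] _]]]].
have [F1 _] := hF; have [G1 _] := hG; have [_ VF _] := hV0; have [_ WG _] := hW0.
pose phi b := restriction f b.
have hphi b : holomorphic_proj (side V0 W0 b) (phi b) by exact: restriction_holomorphic.
have coneV v : v != 0 -> evalp F v = 0 -> cone V0 v.
  by move=> v0 Fv; apply/coneE; split => //; apply/VF/(zero_locusE F1 v0).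
have coneW v : v != 0 -> evalp G v = 0 -> cone W0 v.
  by move=> v0 Gv; apply/coneE; split => //; apply/WG/(zero_locusE G1 v0).
have Pu j : exists u, [/\ u != 0, u \in line (P j), evalp F u = 0 & evalp G u = 0].
  have [u0 ul] := vpick_line (P j); exists (vpick (line (P j))).
  have : range P (P j) by exists j.
  by rewrite hP => -[FP GP]; split => //; [exact: FP|exact: GP].
have PVW j : (V0 `&` W0) (P j).
  have : range P (P j) by exists j.
  by rewrite hP => -[/VF ? /WG ?].
pose j1 : 'I_d := Ordinal hd.
have [u0 [u0n u0P Fu0 Gu0]] := Pu j0; have [u1 [u1n u1P Fu1 Gu1]] := Pu j1.
have ind : forall s t, s *: u0 + t *: u1 = 0 -> s = 0 /\ t = 0.
  apply: (@independent_points _ _ (P j0) (P j1)) => //.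
  by rewrite (inj_eq P_inj).
have Gpl s t : evalp G (s *: u0 + t *: u1) = 0.
  rewrite evalp_linear // (evalpZ _ _ G1) Gu0 Gu1; ring.
(* Were [G] zero everywhere, its gradient would vanish and transversality would fail at [u0]. *)
have [a0 Ga0] : exists a, evalp G a != 0.
  apply: contrapT => h; have G0 a : evalp G a = 0.
    by apply/eqP/negPn/negP => Ga; apply: h; exists a.
  have g0 : gradient G u0 = 0.
    apply/rowP => i; have := dir_deriv_linear u0 (delta_mx 0 i) G1.
    rewrite G0 /dir_deriv (bigD1 i) //= big1 => [|k ki].
      by rewrite !mxE !eqxx mul1r addr0.
    by rewrite mxE (negbTE ki) andbF mul0r.
  have := hFG u0 u0n Fu0 Gu0; rewrite g0 /row_free -addsmxE addsmx0 => /eqP r2.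
  by have := rank_leq_row (gradient F u0); rewrite r2.
have free s t y : s *: a0 + t *: u0 + y *: u1 = 0 -> [/\ s = 0, t = 0 & y = 0].
  move=> e; have := Gpl t y.
  have -> : t *: u0 + y *: u1 = 0 + (- s) *: a0.
    by rewrite add0r scaleNr; apply/eqP; rewrite -subr_eq0 opprK addrC addrA e.
  rewrite evalp_linear // -(scale0r u0) (evalpZ _ _ G1) Gu0 mulr0 add0r => /eqP.
  rewrite mulf_eq0 (negbTE Ga0) orbF oppr_eq0 => /eqP s0.
  by move: e; rewrite s0 scale0r add0r => /ind[-> ->].
(* The second and third basis vectors add up to [u0], since [rational_relation] yields its relation
   at [a1 + a2]. *)
have [c0 [c1 [c2 coords]]] : exists c0 c1 c2, dual_coordinates a0 (u0 - u1) u1 c0 c1 c2.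
  apply: dual_coordinates_exist => s t y e.
  have [|-> -> ty] := free s t (y - t).
    by rewrite -e; apply/rowP => i; rewrite !mxE; ring.
  by move: ty; rewrite subr0.
have lineW u w : (u != 0) || (w != 0) -> cone W0 (u *: (u0 - u1) + w *: u1).
  have -> : u *: (u0 - u1) + w *: u1 = u *: u0 + (w - u) *: u1.
    by apply/rowP => i; rewrite !mxE; ring.
  move=> uw; apply: coneW; last exact: Gpl.
  apply/eqP => /ind[u_0 /eqP]; rewrite u_0 subr0 => w_0.
  by move: uw; rewrite u_0 w_0 eqxx.
have [p [q [i0 [dpq hom qn sat]]]] := rational_relation coords oW (hphi true) lineW.
have dp i v : differentiable (p i) v by have [] := dpq i v.
have dq i v : differentiable (q i) v by have [] := dpq i v.
have satW0 : satisfies p q i0 (phi true) u0 by rewrite subrK in sat.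
have U0 : connected_component (V0 `&` W0) (P j0) (P j0) by exact: connected_component_refl.
have satV0 : satisfies p q i0 (phi false) u0.
  have [_ oU _] := cU; rewrite proj_openE in oU.
  have nU : nbhs u0 (cone (connected_component (V0 `&` W0) (P j0))).
    by apply: open_nbhs_nbhs; split => //; split => //; exists (P j0).
  apply: filterS2 satW0 nU => w hw /coneE[_ Uw] w0 u ul i; apply: (hw w0) => //.
  by rewrite /phi -(restriction_eq f Uw).
pose E := satisfies p q i0 (phi false).
have hE v : v != 0 -> evalp F v = 0 -> exists2 e : R, 0 < e &
    forall v', nrm (v' - v) < e -> evalp F v' = 0 -> (E v' <-> E v).
  move=> v0 Fv; have [e e0 he] := satisfies_propagate (hphi false) (coneV v v0 Fv).
  have vv : nrm (v - v) < e by rewrite subrr nrm0.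
  exists e; first exact: e0.
  move=> v' v'e _; split; first exact: (he p q i0 dp dq v' v v'e vv).
  exact: (he p q i0 dp dq v v' vv v'e).
have EZ a v : a != 0 -> v != 0 -> E v -> E (a *: v) by move=> a_0 _; exact: satisfiesZ.
(* The centre [b] is taken on the line [G = 0], so that roots over [u0] are points of this line, and
   off the curve. *)
have [c Fc] := pencil_point F1 G1 hP ind Gu0 Gu1.
have cn : c != 0 by apply: contraNneq Fc => ->; rewrite scale0r addr0 Fu0.
pose b := u0 + c *: u1; have dFb : dir_deriv F b u0 != 0.
  exact: (transversal_dir_deriv F1 G1 (hFG u0 u0n Fu0 Gu0)).
(* The root [0] over [u0] is simple by transversality; it cannot be the only one by
   [no_single_simple_sheet]. *)
have [y [Fz Ez] yn] : exists2 y, sheet F E (u0 + y *: b) & y != 0.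
  apply: contrapT => h.
  have F2 : F \is ishomog1 (d - 2).+2 mdeg.
    by have -> : (d - 2).+2 = d by rewrite -addn2 subnK.
  apply: (@no_single_simple_sheet R 2 (d - 2) F E a0 u0 b F2 Fc hE EZ).
    move=> s t y e; have [|-> h1 h2] := free s (t + y) (y * c).
      by rewrite -e /b; apply/rowP => i; rewrite !mxE; ring.
    move: h2 h1 => /eqP; rewrite mulf_eq0 (negbTE cn) orbF => /eqP ->.
    by rewrite addr0.
  split; first by split; [exact: Fu0|exact: satV0].
  split; first exact: dFb.
  by move=> y sy; apply/eqP/negPn/negP => yn; apply: h; exists y.
have Gb t : evalp G (u0 + t *: b) = 0.
  have := Gpl (1 + t) (t * c); congr (evalp G _ = 0).
  by rewrite /b; apply/rowP => i; rewrite !mxE; ring.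
have zn t : u0 + t *: b != 0.
  have -> : u0 + t *: b = (1 + t) *: u0 + (t * c) *: u1.
    by rewrite /b; apply/rowP => i; rewrite !mxE; ring.
  apply/eqP => /ind[/eqP + /eqP]; rewrite mulf_eq0 (negbTE cn) orbF => + /eqP t0.
  by rewrite t0 addr0 oner_eq0.
set z := u0 + y *: b in Fz Ez.
have satWz : satisfies p q i0 (phi true) z.
  by apply: (satisfies_along _ (hphi true) dp dq _ satW0) => t; exact: coneW.
have [j jz] : exists j, P j = point_of z.
  have : range P (point_of z).
    rewrite hP; split; first exact/(zero_locusE F1 (zn y)).
    exact/(zero_locusE G1 (zn y)).
  by move=> [j _ <-]; exists j.
have jj0 : j != j0.
  apply/eqP => jE; have : z \in line (P j0) by rewrite -jE jz; exact: point_of_mem (zn y).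
  rewrite (lineE u0n u0P) => /vlineP[a zE].
  have : (1 + y - a) *: u0 + (y * c) *: u1 = 0.
    rewrite scalerBl -zE /z /b; apply/rowP => i; rewrite !mxE; ring.
  by move=> /ind[_ /eqP]; rewrite mulf_eq0 (negbTE yn) (negbTE cn).
have phiz := satisfies_agree (hphi false) (hphi true) (coneV z (zn y) Fz)
  (coneW z (zn y) (Gb y)) dq qn Ez satWz.
(* [f] takes the same value on the two lifts of [P j], so they coincide and [P j] lies in the
   component of [P j0], against the disjointness of the components. *)
have [_ triv] := hU; case/eqP: jj0; apply: (triv j j0) => //; exists (P j).
have [Vj Wj] := PVW j; split; first exact: connected_component_refl.
by apply: (restriction_inj finj Vj Wj); rewrite jz.
Qed.
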